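(* Let $1 \le p < \infty$, let $(\Omega,\Sigma,\mu)$ be a measure space and let $X=X(\mu)$ be a quasi-Banach function space over $\mu$. The following statements are equivalent: (i) $X$ is an abstract $L^p$ space such that $X_{[p]}$ has the Daugavet property. (ii) $X$ is equal to $L^p(h\,d\mu)$ (same functions, same norm) for some $0<h\in L^1(\mu)$, and the measure $\mu$ does not have atoms. (iii) $(X_{[p]})^*\neq\{0\}$, $X$ is constant $1$ $p$-concave, and for every $n\in\mathbb{N}$ and every finite set of rank-one continuous linear operators $T_i: X_{[p]}\to X_{[p]}$, $i\in\{1,\dots,n\}$, we have $$\sup_{f\in B_X}\Bigl\|\Bigl(\sum_{i=1}^n \varphi_{T_i}(f)^p\Bigr)^{1/p}\Bigr\|\le\Bigl(\sum_{i=1}^n\|\varphi_{T_i}\|^p\Bigr)^{1/p}$$ and, for each $i$, $$\sup_{f\in B_X}\bigl\||f^p+\varphi_{T_i}(f)^p|^{1/p}\bigr\|_X=(1+\|\varphi_{T_i}\|^p)^{1/p}.$$ (iv) $X$ is constant $1$ $p$-convex, constant $1$ $p$-concave, and for every rank-one continuous linear operator $T:X_{[p]}\to X_{[p]}$, $$\sup_{f\in B_X}\bigl\||f^p+\varphi_{T}(f)^p|^{1/p}\bigr\|_X=(1+\|\varphi_{T}\|^p)^{1/p}.$$ (v) $X$ is constant $1$ $p$-convex, and for every slice $S_{[p]}(x^*,\delta)$ (with $x^*\in S_{(X_{[p]})^*}$, $\delta>0$), every $\varepsilon>0$ and every finite dimensional subspace $X_0$ of $X$ there is an element $g\in S^{1/p}_{[p]}(x^*,\delta)$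 such that for every $n\in\mathbb{N}$, all $f_1,\dots,f_n\in X_0$ and all $\alpha_1,\dots,\alpha_n\ge 0$ satisfying $\sum_{i=1}^n\alpha_i^p=1$, $$\Bigl\|\Bigl(\sum_{i=1}^n|(\alpha_i g)^p+f_i^p|\Bigr)^{1/p}\Bigr\|^p\ge(1-\varepsilon)\Bigl(\|g\|^p+\sum_{i=1}^n\|f_i\|^p\Bigr).$$ (vi) $X$ is constant $1$ $p$-convex, and for every slice $S_{[p]}(x^*,\delta)$ (with $x^*\in S_{(X_{[p]})^*}$, $\delta>0$), every $\varepsilon>0$ and every finite dimensional subspace $X_0$ of $X$ there is an element $g\in S^{1/p}_{[p]}(x^*,\delta)$ and an element $x_0^*\in B_{(X_{[p]})^*}$ such that $$\Bigl(\frac{|f^p+g^p|}{\|f\|^p+\|g\|^p}\Bigr)^{1/p}\in S^{1/p}_{[p]}(x_0^*,\varepsilon)$$ for every $f\in X_0$.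
   Context: All spaces are real and nonzero; functions are real-valued and identified when equal $\mu$-a.e. Quasi-Banach function space: a linear subspace $X=X(\mu)$ of $L^0(\mu)$ (all measurable functions with the $\mu$-a.e. order) that is an ideal ($|f|\le|g|$, $g\in X$, $f\in L^0(\mu)$ imply $f\in X$), equipped with a complete quasi-norm $\|\cdot\|=\|\cdot\|_X$ which is a lattice quasi-norm ($|f|\le|g|$ implies $\|f\|\le\|g\|$), and such that $\chi_A\in X$ for all $A\in\Sigma$ of finite measure. It is a Banach function space if $\|\cdot\|$ is a norm. Constant $1$ $p$-convex: $\|(\sum_{i=1}^n|x_i|^p)^{1/p}\|\le(\sum_{i=1}^n\|x_i\|^p)^{1/p}$ for all finite families $(x_i)$ in $X$. Constant $1$ $p$-concave: $(\sum_{i=1}^n\|x_i\|^p)^{1/p}\le\|(\sum_{i=1}^n|x_i|^p)^{1/p}\|$ for all finite families. Signed powers: for a function $f$ and $r>0$, $f^r$ denotes $\operatorname{sign}(f)\,|f|^r$ (pointwise). $p$-th power: $X_{[p]}=\{h\in L^0(\mu): |h|^{1/p}\in X\}$ with $\|h\|_{X_{[p]}}=\||h|^{1/p}\|_X^p$. The map $f\mapsto f^p$ is a bijection $X\to X_{[p]}$ with $\|f^p\|_{X_{[p]}}=\|f\|_X^p$. $(X_{[p]})^*$ is the space of continuous linear functionals on $X_{[p]}$, with norm the supremum over the closed unit ball of $X_{[p]}$. $B_Y$ and $S_Y$ denote the closed unit ball and the unit sphere of $Y$. For $x^*\in B_{(X_{[p]})^*}$ and $\varepsilon>0$ the slice is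 $S_{[p]}(x^*,\varepsilon)=\{h\in B_{X_{[p]}}:\langle h,x^*\rangle\ge1-\varepsilon\}$, and its $1/p$-th power is $S^{1/p}_{[p]}(x^*,\varepsilon)=\{f\in X: f^p\in S_{[p]}(x^*,\varepsilon)\}$. For an operator $T:X_{[p]}\to X_{[p]}$, its $p$-convexification is the map $\varphi_T:X\to X$, $\varphi_T(f)=(T(f^p))^{1/p}$ (signed powers), and $\|\varphi_T\|:=\sup_{f\in B_X}\|\varphi_T(f)\|$. In particular $\varphi_T(f)^p=T(f^p)$. Daugavet property: a Banach space $Y$ has it if $\|\mathrm{Id}+T\|=1+\|T\|$ for every rank-one continuous linear operator $T:Y\to Y$. Abstract $L^p$ space: a Banach lattice $E$ such that $\|x+y\|^p=\|x\|^p+\|y\|^p$ for all disjoint $x,y\in E$.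
   Formalization: (i)⇒(ii) fails as stated, e.g. for L^p of Lebesgue measure on the line. For every μ, (i),(iii)–(vi) are proved equivalent and (ii)⇒(i); (ii) joins the equivalence when μ is σ-finite and the constant 1 lies in X, both of which (ii) forces. *)

(* Defs.v *)
From mathcomp Require Export all_boot all_order all_algebra.
From mathcomp Require Export all_classical all_reals all_analysis.

Set Implicit Arguments.
Unset Strict Implicit.
Unset Printing Implicit Defensive.

Import Order.TTheory GRing.Theory Num.Theory.
Import numFieldNormedType.Exports.

Local Open Scope classical_set_scope.
Local Open Scope ring_scope.

(* An element of L^0(mu) is represented by a measurable function T -> R;        *)
(* functions are compared with ae_eq. A function space is a set X of such       *)
(* functions, saturated under ae_eq, with a functional N which is only          *)
(* meaningful on X.                                                             *)

Section FunctionSpaces.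
Context (R : realType) (d : measure_display) (T : measurableType d).
Variable mu : {measure set T -> \bar R}.
Implicit Types (X Y : set (T -> R)) (N : (T -> R) -> R) (f g h k : T -> R).

Local Notation "f =ae g" := (ae_eq mu [set: T] f g) (at level 70).

Definition subspace X : Prop :=
  [/\ forall f, X f -> measurable_fun [set: T] f,
      forall f g, X f -> measurable_fun [set: T] g -> f =ae g -> X g,
      X (cst 0),
      forall f g, X f -> X g -> X (f + g)
    & forall (c : R) f, X f -> X (c *: f)].

Definition quasi_norm X N : Prop :=
  [/\ forall f, X f -> 0 <= N f,
      forall f, X f -> N f = 0 -> f =ae cst 0,
      forall (c : R) f, X f -> N (c *: f) = `|c| * N f
    & exists K : R, forall f g, X f -> X g -> N (f + g) <= K * (N f + N g)].

Definition subadditive X N : Prop :=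
  forall f g, X f -> X g -> N (f + g) <= N f + N g.

Definition complete_space X N : Prop :=
  forall u : nat -> T -> R, (forall n, X (u n)) ->
    (forall e : R, 0 < e -> exists n0 : nat, forall m n : nat,
       (n0 <= m)%N -> (n0 <= n)%N -> N (u m - u n) < e) ->
    exists2 f, X f & (fun n => N (u n - f)) @ \oo --> (0 : R).

Definition banach_space X N : Prop :=
  [/\ subspace X, quasi_norm X N, subadditive X N & complete_space X N].

Record quasi_banach_function_space X N : Prop := QuasiBanachFunctionSpace {
  qbfs_subspace : subspace X ;
  qbfs_nonzero : exists2 f, X f & ~ (f =ae cst 0) ;
  qbfs_ideal : forall f g, X g -> measurable_fun [set: T] f ->
    {ae mu, forall t, `|f t| <= `|g t|} -> X f ;
  qbfs_quasi_norm : quasi_norm X N ;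
  qbfs_lattice : forall f g, X f -> X g ->
    {ae mu, forall t, `|f t| <= `|g t|} -> N f <= N g ;
  qbfs_complete : complete_space X N ;
  qbfs_indic : forall A : set T, measurable A -> (mu A < +oo)%E -> X \1_A }.

Definition closed_ball_of X N : set (T -> R) := [set f | X f /\ N f <= 1].

(* In all uses below the set of values is bounded (F comes from a continuous    *)
(* linear operator), so the real-valued sup is the genuine supremum.            *)
Definition sup_norm X N (F : (T -> R) -> T -> R) : R :=
  sup [set N (F f) | f in closed_ball_of X N].

Record functional Y N (phi : (T -> R) -> R) : Prop := Functional {
  functional_ae : forall h k, Y h -> Y k -> h =ae k -> phi h = phi k ;
  functional_linear : forall (c : R) h k, Y h -> Y k ->
    phi (c *: h + k) = c * phi h + phi k ;
  functional_continuous : forall h, Y h -> forall e : R, 0 < e ->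
    exists2 r : R, 0 < r &
      forall k, Y k -> N (k - h) < r -> `|phi k - phi h| < e }.

Definition dual_norm Y N (phi : (T -> R) -> R) : R :=
  sup [set `|phi h| | h in closed_ball_of Y N].

Definition dual_ball Y N : set ((T -> R) -> R) :=
  [set phi | functional Y N phi /\ dual_norm Y N phi <= 1].

Definition dual_sphere Y N : set ((T -> R) -> R) :=
  [set phi | functional Y N phi /\ dual_norm Y N phi = 1].

Definition dual_nonzero Y N : Prop :=
  exists2 phi, functional Y N phi & exists2 h, Y h & phi h != 0.

Record operator Y N (S : (T -> R) -> T -> R) : Prop := Operator {
  operator_stable : forall h, Y h -> Y (S h) ;
  operator_ae : forall h k, Y h -> Y k -> h =ae k -> S h =ae S k ;
  operator_linear : forall (c : R) h k, Y h -> Y k ->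
    S (c *: h + k) =ae c *: S h + S k ;
  operator_continuous : forall h, Y h -> forall e : R, 0 < e ->
    exists2 r : R, 0 < r &
      forall k, Y k -> N (k - h) < r -> N (S k - S h) < e }.

Definition rank_one_operator Y N (S : (T -> R) -> T -> R) : Prop :=
  [/\ operator Y N S,
      exists2 h, Y h & ~ (S h =ae cst 0)
    & exists2 y, Y y & forall h, Y h -> exists c : R, S h =ae c *: y].

Definition daugavet Y N : Prop :=
  banach_space Y N /\
  forall S, rank_one_operator Y N S ->
    sup_norm Y N (fun h => h + S h) = 1 + sup_norm Y N S.

Definition finite_dimensional_subspace X (X0 : set (T -> R)) : Prop :=
  [/\ X0 `<=` X, subspace X0
    & exists n : nat, exists2 b : 'I_n -> T -> R, forall i, X0 (b i) &
        forall f, X0 f -> exists c : 'I_n -> R, f =ae \sum_i c i *: b i].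

Definition atomless : Prop :=
  forall A : set T, measurable A -> (0 < mu A)%E ->
    exists2 B : set T, measurable B /\ B `<=` A &
      (0 < mu B)%E /\ (0 < mu (A `\` B))%E.

Definition spow (r : R) f : T -> R := fun t => Num.sg (f t) * `|f t| `^ r.

Section Power.
Variable p : R.

Definition pspace X : set (T -> R) :=
  [set h : T -> R |
    measurable_fun [set: T] h /\ X (fun t => `|h t| `^ p^-1)].

Definition pnorm N : (T -> R) -> R :=
  fun h => N (fun t => `|h t| `^ p^-1) `^ p.

Definition p_convex1 X N : Prop :=
  forall (n : nat) (x : 'I_n -> T -> R), (forall i, X (x i)) ->
    N (fun t => (\sum_i `|x i t| `^ p) `^ p^-1)
      <= (\sum_i N (x i) `^ p) `^ p^-1.

Definition p_concave1 X N : Prop :=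
  forall (n : nat) (x : 'I_n -> T -> R), (forall i, X (x i)) ->
    (\sum_i N (x i) `^ p) `^ p^-1
      <= N (fun t => (\sum_i `|x i t| `^ p) `^ p^-1).

Definition abstract_Lp X N : Prop :=
  [/\ banach_space X N,
      forall f, X f -> X (fun t => `|f t|),
      forall f g, X f -> X g ->
        {ae mu, forall t, `|f t| <= `|g t|} -> N f <= N g
    & forall f g, X f -> X g ->
        {ae mu, forall t, Num.min `|f t| `|g t| = 0} ->
        N (f + g) `^ p = N f `^ p + N g `^ p].

Definition slice X N (phi : (T -> R) -> R) (e : R) : set (T -> R) :=
  [set h | closed_ball_of (pspace X) (pnorm N) h /\ 1 - e <= phi h].

Definition root_slice X N (phi : (T -> R) -> R) (e : R) : set (T -> R) :=
  [set f | X f /\ slice X N phi e (spow p f)].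

Definition convexification (S : (T -> R) -> T -> R) : (T -> R) -> T -> R :=
  fun f => spow p^-1 (S (spow p f)).

Definition p_daugavet_equation X N (S : (T -> R) -> T -> R) : Prop :=
  sup_norm X N
    (fun f t => `|spow p f t + spow p (convexification S f) t| `^ p^-1)
  = (1 + sup_norm X N (convexification S) `^ p) `^ p^-1.

Definition daugavet_abstract_Lp X N : Prop :=
  abstract_Lp X N /\ daugavet (pspace X) (pnorm N).

(* nu is the measure h dmu. Note that 0 < h in L^1(mu) forces mu to be          *)
(* sigma-finite and 1 to be in L^p(h dmu); both are automatic for a quasi-      *)
(* Banach function space over a finite mu, but not in general: L^p of the       *)
(* Lebesgue measure of the real line is an abstract L^p space whose p-th power  *)
(* L^1 has the Daugavet property, and it does not contain 1.                    *)
Definition weighted_Lp_atomless X N : Prop :=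
  (exists h : T -> R, exists nu : {measure set T -> \bar R},
     [/\ mu.-integrable [set: T] (EFin \o h),
         {ae mu, forall t, 0 < h t},
         forall A, measurable A -> nu A = (\int[mu]_(t in A) (h t)%:E)%E,
         X = [set f | f \in Lfun nu p%:E]
       & forall f, X f -> (N f)%:E = ('N[nu]_p%:E[EFin \o f])%E]) /\
  atomless.

Definition concave_daugavet X N : Prop :=
  [/\ dual_nonzero (pspace X) (pnorm N),
      p_concave1 X N
    & forall (n : nat) (S : 'I_n -> (T -> R) -> T -> R),
        (forall i, rank_one_operator (pspace X) (pnorm N) (S i)) ->
        sup_norm X N
          (fun f => spow p^-1 (\sum_i spow p (convexification (S i) f)))
        <= (\sum_i sup_norm X N (convexification (S i)) `^ p) `^ p^-1 /\
        forall i, p_daugavet_equation X N (S i)].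

Definition convex_concave_daugavet X N : Prop :=
  [/\ p_convex1 X N,
      p_concave1 X N
    & forall S, rank_one_operator (pspace X) (pnorm N) S ->
        p_daugavet_equation X N S].

Definition convex_slice_estimate X N : Prop :=
  p_convex1 X N /\
  forall phi, dual_sphere (pspace X) (pnorm N) phi ->
  forall delta : R, 0 < delta -> forall eps : R, 0 < eps ->
  forall X0, finite_dimensional_subspace X X0 ->
  exists2 g, root_slice X N phi delta g &
    forall (n : nat) (f : 'I_n -> T -> R) (alpha : 'I_n -> R),
      (forall i, X0 (f i)) -> (forall i, 0 <= alpha i) ->
      \sum_i alpha i `^ p = 1 ->
      (1 - eps) * (N g `^ p + \sum_i N (f i) `^ p)
      <= N (fun t => (\sum_i `|spow p (alpha i *: g) t + spow p (f i) t|)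
                       `^ p^-1) `^ p.

Definition convex_slice_functional X N : Prop :=
  p_convex1 X N /\
  forall phi, dual_sphere (pspace X) (pnorm N) phi ->
  forall delta : R, 0 < delta -> forall eps : R, 0 < eps ->
  forall X0, finite_dimensional_subspace X X0 ->
  exists2 g, root_slice X N phi delta g &
  exists2 psi, dual_ball (pspace X) (pnorm N) psi &
    forall f, X0 f ->
      root_slice X N psi eps
        (fun t => (`|spow p f t + spow p g t| / (N f `^ p + N g `^ p))
                    `^ p^-1).

End Power.
End FunctionSpaces.

(* Main.v *)
From HB Require Import structures.
Require Import Defs.
From mathcomp Require Import ring lra measurable_realfun.

Set Implicit Arguments.
Unset Strict Implicit.
Unset Printing Implicit Defensive.

Import Order.TTheory GRing.Theory Num.Theory.
Import numFieldNormedType.Exports.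

Local Open Scope classical_set_scope.
Local Open Scope ring_scope.

(** Everything happens in the p-th power Y = pspace p X, with M = pnorm p N.  It is
    again a quasi-Banach function space (pspace_qbfs), and signed p-th powers and
    roots identify its unit ball, its slices and the suprema of its operators with
    those of X.  Under this identification, p-convexity of X with constant 1 is
    the triangle inequality for M and p-concavity is the reverse inequality for
    nonnegative functions, so that both together say that M is additive on the
    positive cone (additive_on_coneP); and the equation for phi_T is the Daugavet
    equation for T (p_daugavet_equationP).

    Hence daugavet_abstract_Lp and convex_concave_daugavet both say that M is
    additive on the cone and that Y satisfies the Daugavet equation.  For the first
    one, additivity on disjoint functions is extended to the cone by cutting u + v
    along the values of u / (u + v) (disjoint_additive_superadditive).  In
    concave_daugavet the triangle inequality for M is hidden in the first
    inequality: test it with T_i = phi (x) y_i for one nonzero functional phi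
    (concave_daugavet_convex).

    The passage to slices goes through small_overlap: a slice contains elements h
    for which the overlap M(min(|h|, |e|)) with a given e is as small as one wants.
    The Daugavet equation, used for phi (x) y and then for a second operator built
    from - y, gives an h in the slice for which h + y and h - y both have norm
    almost 2; additivity then forces a small overlap of h and y
    (daugavet_small_overlap).  A finite-dimensional X_0 is dominated, relatively to
    the norm, by one function e (finite_dimensional_domination), so that an h
    almost disjoint from e^p is almost disjoint from all f^p at once; with
    g = h^(1/p) this is convex_slice_estimate.  The functional wanted in
    convex_slice_functional is then the integral w |-> M(w^+) - M(w^-).
    Conversely, either slice condition gives additivity of M when it is applied to
    large multiples of elements of X_0, and the one with a functional gives back
    the Daugavet equation when X_0 is spanned by a single root y^(1/p), because
    the Daugavet equation can be tested on slices (daugavet_of_slices).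

    If M is additive on the cone and e >= 0 belongs to Y, then A |-> M(e 1_A) is a
    finite measure (density_measure).  When mu has no atoms, neither has this
    measure, and halving repeatedly a set on which a functional almost attains its
    norm leads to elements of a slice with small overlap with e
    (atomless_small_overlap); so weighted_Lp_atomless implies the rest.
    Conversely, the Daugavet equation excludes atoms: if A is an atom, then
    h |-> - h 1_A has rank one, norm 1, and its sum with the identity is a
    contraction (daugavet_atomless).  If moreover mu is sigma-finite and e = 1
    belongs to Y, the Radon-Nikodym theorem represents the above measure as h dmu,
    and X = L^p(h dmu) by monotone convergence (density_integral). *)

(** * Real powers and signed roots *)

Section RealInequalities.
Context (R : realType).
Implicit Types (a b x y p q r : R).

Lemma powR_monotone r x y : 0 <= r -> 0 <= x -> x <= y -> x `^ r <= y `^ r.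
Proof.
move=> r0 x0 xy; apply: ge0_ler_powR => //; rewrite nnegrE //.
exact: le_trans xy.
Qed.

Lemma one_powR r : 1 `^ r = 1 :> R.
Proof. by rewrite powR1. Qed.

Lemma powRVK p x : p != 0 -> 0 <= x -> (x `^ p^-1) `^ p = x.
Proof. by move=> p0 x0; rewrite -powRrM mulVf// powRr1. Qed.

Lemma powRKV p x : p != 0 -> 0 <= x -> (x `^ p) `^ p^-1 = x.
Proof. by move=> p0 x0; rewrite -powRrM mulfV// powRr1. Qed.

(** Convexity of the power at the points x / a and y / b. *)
Lemma powR_split p a b x y : 1 <= p -> 0 < a -> 0 < b -> a + b = 1 ->
  0 <= x -> 0 <= y ->
  (x + y) `^ p <= a * (x / a) `^ p + b * (y / b) `^ p.
Proof.
move=> p1 a0 b0 ab x0 y0.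
have ha : Itv.spec (@Itv.num_sem R) (Itv.Real `[0%Z, 1%Z]) a.
  rewrite /Itv.spec /Itv.num_sem /= in_itv /=.
  by apply/and3P; split; [exact: num_real|exact: ltW|lra].
have xa : 0 <= x / a by apply: divr_ge0 => //; exact: ltW.
have yb : 0 <= y / b by apply: divr_ge0 => //; exact: ltW.
have := @convex_powR R p p1 (Itv.mk ha) (x / a) (y / b).
rewrite !inE /= !in_itv /= !andbT => /(_ xa yb) H.
have ab' : unstable.onem a = b by rewrite /unstable.onem; lra.
have conv_ab (z w : R) : a * z + unstable.onem a * w = a * z + b * w by rewrite ab'.
have xy : x + y = a * (x / a) + b * (y / b) by field; rewrite !gt_eqF.
rewrite xy -!conv_ab; exact: H.
Qed.

(** Both x and y are fractions of x + y, and z^p <= z for z in [0, 1]. *)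
Lemma powR_superadditive p x y : 1 <= p -> 0 <= x -> 0 <= y ->
  x `^ p + y `^ p <= (x + y) `^ p.
Proof.
move=> p1 x0 y0; have p0 : p != 0 by rewrite gt_eqF//; lra.
have [xy0|xyN0] := eqVneq (x + y) 0.
  have [-> ->] : x = 0 /\ y = 0 by lra.
  by rewrite addr0 powR0// addr0.
set s := x + y in xyN0 *; have s0 : 0 < s by rewrite lt_neqAle eq_sym xyN0 /s addr_ge0.
have key z : 0 <= z -> z <= s -> z `^ p <= z / s * s `^ p.
  move=> z0 zs; have [->|zN0] := eqVneq z 0; first by rewrite powR0// mul0r mul0r.
  have -> : z `^ p = (z / s * s) `^ p by rewrite divfK.
  apply: ge1r_powRZ => //; last exact: ltW.
  have z_gt0 : 0 < z by rewrite lt_neqAle eq_sym zN0.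
  by rewrite divr_gt0//= ler_pdivrMr ?mul1r.
apply: le_trans (lerD (key x x0 _) (key y y0 _)) _; rewrite /s; [lra|lra|].
by rewrite -mulrDl -mulrDl divff// mul1r.
Qed.

Lemma powRV_subadditive p x y : 1 <= p -> 0 <= x -> 0 <= y ->
  (x + y) `^ p^-1 <= x `^ p^-1 + y `^ p^-1.
Proof.
move=> p1 x0 y0; have p0 : p != 0 by rewrite gt_eqF//; lra.
have := powR_superadditive p1 (powR_ge0 x p^-1) (powR_ge0 y p^-1).
rewrite !powRVK// => /(powR_monotone (r := p^-1)) H.
rewrite -[leRHS](powRKV p0) ?addr_ge0 ?powR_ge0//.
by apply: H; rewrite ?invr_ge0 ?addr_ge0//; lra.
Qed.

Lemma powR_add_bound p x y : 1 <= p -> 0 <= x -> 0 <= y ->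
  (x + y) `^ p <= 2 `^ p * (x `^ p + y `^ p).
Proof.
move=> p1 x0 y0.
have h : (0:R) < 2^-1 by rewrite invr_gt0.
apply: le_trans (powR_split p1 h h _ x0 y0) _; first by field.
rewrite !invrK !powRM//; have := powR_ge0 2 p; have := powR_ge0 x p.
by have := powR_ge0 y p; nra.
Qed.

Lemma norm_sgMpowR r a : r != 0 -> `|Num.sg a * `|a| `^ r| = `|a| `^ r.
Proof.
move=> r0; rewrite normrM normr_sg (ger0_norm (powR_ge0 _ _)).
by have [->|_] := eqVneq a 0; rewrite ?mul1r// normr0 powR0// mulr0.
Qed.

Lemma sg_sgMpowR r a : Num.sg (Num.sg a * `|a| `^ r) = Num.sg a.
Proof.
rewrite sgrM sgr_id; have [->|aN0] := eqVneq a 0; first by rewrite sgr0 mul0r.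
by rewrite [X in _ * X]gtr0_sg ?mulr1// powR_gt0 ?normr_gt0.
Qed.

Lemma sgMpowRN r a : Num.sg (- a) * `|- a| `^ r = - (Num.sg a * `|a| `^ r).
Proof. by rewrite sgrN normrN mulNr. Qed.

Lemma sgMpowR_ge0 r a : r != 0 -> 0 <= a -> Num.sg a * `|a| `^ r = a `^ r.
Proof.
move=> r0; rewrite le_eqVlt => /predU1P[<-|a0].
  by rewrite sgr0 mul0r powR0.
by rewrite gtr0_sg// mul1r gtr0_norm.
Qed.

Lemma sgMpowRM r a b :
  Num.sg (a * b) * `|a * b| `^ r = (Num.sg a * `|a| `^ r) * (Num.sg b * `|b| `^ r).
Proof. by rewrite sgrM normrM powRM//; ring. Qed.

(** For equal signs this is subadditivity of the root; for opposite signs the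
    difference of the roots is a sum, which costs the factor 2^p. *)
Lemma signed_root_hoelder p a b : 1 <= p ->
  `|Num.sg a * `|a| `^ p^-1 - Num.sg b * `|b| `^ p^-1| `^ p <= 2 `^ p * `|a - b|.
Proof.
move=> p1; have p0 : p != 0 by rewrite gt_eqF//; lra.
have pV0 : p^-1 != 0 by rewrite invr_eq0.
have pVge0 : 0 <= p^-1 by rewrite invr_ge0; lra.
have two_p : 1 <= 2 `^ p.
  by rewrite -[leLHS](one_powR p) powR_monotone//; lra.
have same_sign x y : 0 <= y -> y <= x ->
    `|x `^ p^-1 - y `^ p^-1| `^ p <= 2 `^ p * `|x - y|.
  move=> y0 yx; have xy0 : 0 <= x - y by lra.
  have := powRV_subadditive p1 y0 xy0; rewrite subrKC => H.
  have xy' : y `^ p^-1 <= x `^ p^-1 by exact: powR_monotone.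
  rewrite (ger0_norm xy0) ger0_norm ?subr_ge0//.
  apply: (@le_trans _ _ (x - y)); last by rewrite ler_peMl.
  rewrite -[leRHS](powRVK p0)//; apply: powR_monotone; lra.
have opposite x y : 0 <= x -> 0 <= y ->
    `|x `^ p^-1 + y `^ p^-1| `^ p <= 2 `^ p * `|x + y|.
  move=> x0 y0; rewrite !ger0_norm ?addr_ge0 ?powR_ge0//.
  by have := powR_add_bound p1 (powR_ge0 x p^-1) (powR_ge0 y p^-1); rewrite !powRVK.
have pos x y : 0 <= x ->
    `|x `^ p^-1 - Num.sg y * `|y| `^ p^-1| `^ p <= 2 `^ p * `|x - y|.
  move=> x0; have [y0|y0] := leP 0 y.
    rewrite (sgMpowR_ge0 pV0 y0); have [xy|yx] := leP x y.
      by rewrite distrC (distrC x); exact: same_sign.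
    by apply: same_sign => //; exact: ltW.
  have yN : 0 <= - y by lra.
  by rewrite -[y in X in X <= _]opprK sgMpowRN (sgMpowR_ge0 pV0 yN) opprK opposite.
have [a0|a0] := leP 0 a; first by rewrite (sgMpowR_ge0 pV0 a0); exact: pos.
have aN : 0 <= - a by lra.
have := pos (- a) (- b) aN; rewrite sgMpowRN -(sgMpowR_ge0 pV0 aN) sgMpowRN.
by rewrite -!opprD !normrN.
Qed.

(** The constant in front of |a|^p can be made arbitrarily small because
    (1 - l)^(1 - p) tends to 1 as l tends to 0 in the convexity inequality. *)
Lemma signed_power_continuous p (eta : R) : 1 <= p -> 0 < eta ->
  exists2 C : R, 0 <= C & forall a b,
    `|Num.sg a * `|a| `^ p - Num.sg b * `|b| `^ p|
      <= eta * `|a| `^ p + C * `|a - b| `^ p.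
Proof.
move=> p1 eta0; have p_gt0 : 0 < p by lra.
have p0 : p != 0 by rewrite gt_eqF.
pose k := (1 + eta) `^ (- p^-1).
have k0 : 0 < k by rewrite powR_gt0//; lra.
have k1 : k < 1.
  rewrite /k powRN invf_lt1; last by rewrite powR_gt0//; lra.
  rewrite -[ltLHS](one_powR p^-1); apply: gt0_ltr_powR; rewrite ?invr_gt0 ?nnegrE//; lra.
have l0 : 0 < 1 - k by lra.
have kE : k * (k^-1) `^ p <= 1 + eta.
  rewrite /k powRN invrK -powRrM mulVf// powRr1; last by lra.
  rewrite ler_piMl//; first by lra.
  by rewrite -powRN -/k ltW.
pose C := Num.max 1 ((1 - k) * ((1 - k)^-1) `^ p).
have C1 : 1 <= C by rewrite /C le_max lexx.
have step x y : 0 <= x -> x <= y ->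
    y `^ p - x `^ p <= eta * x `^ p + C * `|y - x| `^ p.
  move=> x0 xy; have yx0 : 0 <= y - x by lra.
  have := powR_split p1 k0 l0 (subrKC _ _) x0 yx0.
  have k1_ge0 : 0 <= k^-1 by rewrite invr_ge0 ltW.
  have l1_ge0 : 0 <= (1 - k)^-1 by rewrite invr_ge0 ltW.
  rewrite subrKC (powRM p x0 k1_ge0) (powRM p yx0 l1_ge0).
  rewrite (ger0_norm yx0) => H.
  have Cl : (1 - k) * ((1 - k)^-1) `^ p <= C by rewrite /C le_max lexx orbT.
  have := ler_wpM2r (powR_ge0 x p) kE; have := ler_wpM2r (powR_ge0 (y - x) p) Cl.
  by nra.
have mono x y : 0 <= x -> 0 <= y ->
    `|x `^ p - y `^ p| <= eta * x `^ p + C * `|x - y| `^ p.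
  move=> x0 y0; have [xy|yx] := leP x y.
    rewrite distrC (distrC x) ger0_norm ?step// subr_ge0.
    by apply: powR_monotone => //; lra.
  have yx' : y `^ p <= x `^ p by apply: powR_monotone; lra.
  rewrite ger0_norm ?subr_ge0//; apply: le_trans (step y x y0 (ltW yx)) _.
  by rewrite lerD2r ler_wpM2l// ltW.
have pos x y : 0 <= x ->
    `|x `^ p - Num.sg y * `|y| `^ p| <= eta * x `^ p + C * `|x - y| `^ p.
  move=> x0; have [y0|y0] := leP 0 y; first by rewrite (sgMpowR_ge0 p0 y0) mono.
  have yN : 0 <= - y by lra.
  rewrite -[y in X in X <= _]opprK sgMpowRN (sgMpowR_ge0 p0 yN) opprK.
  rewrite ger0_norm ?addr_ge0 ?powR_ge0//.
  apply: le_trans (powR_superadditive p1 x0 yN) _.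
  rewrite ger0_norm; last by lra.
  have := powR_ge0 (x - y) p; have := powR_ge0 x p; nra.
exists C; first by lra.
move=> a b; have [a0|a0] := leP 0 a.
  by rewrite (sgMpowR_ge0 p0 a0) (ger0_norm a0); exact: pos.
have aN : 0 <= - a by lra.
have := pos (- a) (- b) aN; rewrite -{1}(sgMpowR_ge0 p0 aN) !sgMpowRN.
by rewrite -!opprD !normrN -(ltr0_norm a0).
Qed.

Lemma sup_powR r (A : set R) : 0 < r -> (forall x, A x -> 0 <= x) ->
  sup [set x `^ r | x in A] = (sup A) `^ r.
Proof.
move=> r0 A0; have rN0 : r != 0 by rewrite gt_eqF.
have rV0 : 0 <= r^-1 by rewrite invr_ge0 ltW.
have [hA|hA] := pselect (has_sup A); last first.
  rewrite (sup_out hA) powR0// sup_out// => -[[_ [x Ax _]] [b ub]].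
  apply: hA; split; first by exists x.
  exists (b `^ r^-1) => y Ay; rewrite -(powRKV rN0 (A0 _ Ay)).
  by apply: powR_monotone => //; [exact: powR_ge0|apply: ub; exists y].
have [[a Aa] ubA] := hA.
have s0 : 0 <= sup A by apply: le_trans (A0 _ Aa) _; exact: ub_le_sup.
have ubr : ubound [set x `^ r | x in A] (sup A `^ r).
  move=> _ [x Ax <-]; apply: powR_monotone; [exact: ltW|exact: A0|].
  exact: ub_le_sup.
apply/eqP; rewrite eq_le; apply/andP; split.
  by apply: ge_sup => //; exists (a `^ r), a.
set s' := leRHS.
have s'_ub x : A x -> x `^ r <= s'.
  by move=> Ax; apply: ub_le_sup; [exists (sup A `^ r)|exists x].
have s'0 : 0 <= s' by apply: le_trans (s'_ub _ Aa); exact: powR_ge0.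
rewrite -[leRHS](powRVK rN0 s'0); apply: powR_monotone; [exact: ltW|exact: s0|].
apply: ge_sup; first by exists a.
move=> x Ax; rewrite -(powRKV rN0 (A0 _ Ax)).
apply: powR_monotone => //; [exact: powR_ge0|exact: s'_ub].
Qed.

End RealInequalities.

(** * The Hahn-Banach theorem for seminorms *)

Section HahnBanach.
Context (R : realType) (V : lmodType R) (Y : set V) (q : V -> R).
Hypothesis Ylin : forall (c : R) u v, Y u -> Y v -> Y (c *: u + v).
Hypothesis qD : forall u v, Y u -> Y v -> q (u + v) <= q u + q v.
Hypothesis qZ : forall (c : R) u, Y u -> q (c *: u) = `|c| * q u.

(** A partial functional is represented by its graph; since q 0 = 0, the
    domination by q already forces such a linear set to be single-valued.  The
    last clause lets the empty graph in, so that unions of arbitrary chains of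
    such graphs are again of this form. *)
Let dominated_graph (y0 : V) (G : set (V * R)) :=
  [/\ forall g, G g -> Y g.1 /\ g.2 <= q g.1,
      forall (c : R) g h, G g -> G h -> G (c *: g.1 + h.1, c * g.2 + h.2)
    & forall g, G g -> G (y0, q y0)].

Lemma hahn_banach_seminorm y0 : Y y0 ->
  exists phi : V -> R,
    [/\ forall (c : R) u v, Y u -> Y v -> phi (c *: u + v) = c * phi u + phi v,
        forall u, Y u -> `|phi u| <= q u
      & phi y0 = q y0].
Proof.
move=> Yy0.
have Y0 : Y 0 by rewrite -(addNr y0) -scaleN1r; exact: Ylin.
have YZ (c : R) u : Y u -> Y (c *: u) by rewrite -[c *: u]addr0 => Yu; exact: Ylin.
have YD u v : Y u -> Y v -> Y (u + v) by rewrite -{2}[u]scale1r; exact: Ylin.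
have YN u : Y u -> Y (- u) by rewrite -scaleN1r; exact: YZ.
have q0 : q 0 = 0 by rewrite -(scale0r y0) qZ// normr0 mul0r.
have qN u : Y u -> q (- u) = q u by move=> Yu; rewrite -scaleN1r qZ// normrN1 mul1r.
have q_ge0 u : Y u -> 0 <= q u.
  by move=> Yu; have := qD Yu (YN u Yu); rewrite subrr q0 qN//; lra.
have chain F : F `<=` dominated_graph y0 -> total_on F subset ->
    dominated_graph y0 (\bigcup_(G in F) G).
  move=> FP Ftot; split.
  - by move=> g [G /FP[+ _ _]]; exact.
  - move=> c g h [G FG Gg] [H FH Hh].
    have [GH|HG] := Ftot _ _ FG FH.
      by exists H => //; have [_ HL _] := FP _ FH; apply: HL => //; exact: GH.
    by exists G => //; have [_ GL _] := FP _ FG; apply: GL => //; exact: HG.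
  - by move=> g [G FG Gg]; exists G => //; have [_ _] := FP _ FG; apply; exact: Gg.
have [G [[Gdom Glin Gpt] Gmax]] := Zorn_bigcup chain.
have Gy0 : G (y0, q y0).
  apply: contrapT => nGy0.
  pose L : set (V * R) := [set g | exists c, g = (c *: y0, c * q y0)].
  apply: (Gmax L).
    split; first by move=> g /Gpt.
    by move=> LG; apply/nGy0/LG; exists 1; rewrite scale1r mul1r.
  split.
  - move=> _ [c ->] /=; split; first exact: YZ.
    by rewrite qZ// ler_wpM2r ?q_ge0// ler_norm.
  - move=> c _ _ [a ->] [b ->]; exists (c * a + b) => /=.
    by rewrite scalerA scalerDl mulrA mulrDl.
  - by move=> _ _; exists 1; rewrite scale1r mul1r.
have G0 : G (0, 0).
  by have := Glin (-1) _ _ Gy0 Gy0; rewrite /= scaleN1r mulN1r !addNr.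
have GZ (c : R) g : G g -> G (c *: g.1, c * g.2).
  by move=> Gg; have := Glin c _ _ Gg G0; rewrite /= !addr0.
have GD g h : G g -> G h -> G (g.1 + h.1, g.2 + h.2).
  by move=> Gg Gh; have := Glin 1 _ _ Gg Gh; rewrite scale1r mul1r.
have Gfun u r s : G (u, r) -> G (u, s) -> r = s.
  move=> Gr Gs; have := Glin (-1) _ _ Gr Gs; have := Glin (-1) _ _ Gs Gr.
  rewrite /= scaleN1r !mulN1r addNr => /Gdom[_ /=]; rewrite q0 => rs /Gdom[_ /=].
  by rewrite q0; lra.
have Gtotal y : Y y -> exists r, G (y, r).
  move=> Yy; apply: contrapT => nGy.
  pose S : set R := [set g.2 - q (g.1 - y) | g in G].
  have Sub g h : G g -> G h -> h.2 - q (h.1 - y) <= q (g.1 + y) - g.2.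
    move=> Gg Gh; have [Yg _] := Gdom _ Gg; have [Yh _] := Gdom _ Gh.
    have [_ /=] := Gdom _ (GD _ _ Gg Gh).
    have := qD (YD _ _ Yg Yy) (YD _ _ Yh (YN _ Yy)).
    by rewrite addrACA subrr addr0; lra.
  have hS : has_sup S.
    split; first by exists (q y0 - q (y0 - y)), (y0, q y0).
    by exists (q (y0 + y) - q y0) => _ [g Gg <-]; exact: (Sub (y0, q y0) g).
  pose r := sup S.
  have rlow g : G g -> g.2 - r <= q (g.1 - y).
    move=> Gg; suff : g.2 - q (g.1 - y) <= r by lra.
    by apply: ub_le_sup; [exact: hS.2|exists g].
  have rup g : G g -> g.2 + r <= q (g.1 + y).
    move=> Gg; suff : r <= q (g.1 + y) - g.2 by lra.
    by apply: ge_sup; [exact: hS.1|move=> _ [h Gh <-]; exact: Sub].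
  pose B : set (V * R) :=
    [set h | exists g c, G g /\ h = (g.1 + c *: y, g.2 + c * r)].
  apply: (Gmax B).
    split; first by move=> g Gg; exists g, 0; rewrite scale0r mul0r !addr0 -surjective_pairing.
    move=> BG; apply: nGy; exists r; apply: BG; exists (0, 0), 1.
    by rewrite /= scale1r mul1r !add0r.
  split.
  - move=> _ [g [c [Gg ->]]] /=; have [Yg qg] := Gdom _ Gg.
    split; first by apply: YD => //; exact: YZ.
    have [c0|c0|->] := ltgtP c 0; last by rewrite scale0r mul0r !addr0.
    + have d0 : 0 < - c by lra.
      have := rlow _ (GZ (- c)^-1 _ Gg); rewrite /= => H.
      have -> : g.1 + c *: y = (- c) *: ((- c)^-1 *: g.1 - y).
        by rewrite scalerBr scalerA divff ?gt_eqF// scale1r scaleNr opprK.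
      rewrite qZ; last by apply: YD; [exact: YZ|exact: YN].
      rewrite gtr0_norm//; have := ler_wpM2l (ltW d0) H.
      by rewrite mulrBr mulrA divff ?gt_eqF// mul1r mulNr opprK.
    + have := rup _ (GZ c^-1 _ Gg); rewrite /= => H.
      have -> : g.1 + c *: y = c *: (c^-1 *: g.1 + y).
        by rewrite scalerDr scalerA divff ?gt_eqF// scale1r.
      rewrite qZ; last by apply: YD => //; exact: YZ.
      rewrite gtr0_norm//; have := ler_wpM2l (ltW c0) H.
      by rewrite mulrDr mulrA divff ?gt_eqF// mul1r.
  - move=> c _ _ [g [a [Gg ->]]] [h [b [Gh ->]]].
    exists (c *: g.1 + h.1, c * g.2 + h.2), (c * a + b); split; first exact: Glin.
    by rewrite /= scalerDr addrACA scalerA -scalerDl; congr (_, _); ring.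
  - by move=> _ _; exists (y0, q y0), 0; rewrite /= scale0r mul0r !addr0.
have [phi phiG] : exists phi : V -> R, forall y, Y y -> G (y, phi y).
  have /choice[phi phiP] : forall y, exists r, Y y -> G (y, r).
    move=> y; have [Yy|nYy] := pselect (Y y); last by exists 0.
    by have [r Gr] := Gtotal y Yy; exists r.
  by exists phi.
exists phi; split.
- move=> c u v Yu Yv; apply: (Gfun (c *: u + v)); first exact/phiG/Ylin.
  exact: Glin (phiG _ Yu) (phiG _ Yv).
- move=> u Yu; have [_ /= ub] := Gdom _ (phiG _ Yu).
  have := Gdom _ (GZ (-1) _ (phiG _ Yu)).
  rewrite /= scaleN1r mulN1r qN// => -[_ lb].
  by rewrite ler_norml; apply/andP; split; lra.
- by apply: (Gfun y0) => //; exact: phiG.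
Qed.
End HahnBanach.

(** * Halving sets of an atomless measure *)

Section AtomlessMeasures.
Context (R : realType) (d : measure_display) (T : measurableType d).

(** If there were no such B, every subset of A would be small (less than a third of A) or large
    (more than two thirds).  Unions of two small sets are again small, so the
    supremum of the measures of small sets is attained, and the complement of
    a maximal small set would be an atom. *)
Lemma atomless_split (la : {measure set T -> \bar R}) (A : set T) :
  atomless la -> (la [set: T] < +oo)%E -> measurable A ->
  exists B, [/\ measurable B, B `<=` A,
    fine (la B) <= 2 / 3 * fine (la A) &
    fine (la (A `\` B)) <= 2 / 3 * fine (la A)].
Proof.
move=> la_atomless la_fin mA; pose m (B : set T) : R := fine (la B).
have lafin B : measurable B -> la B \is a fin_num.
  move=> mB; rewrite ge0_fin_numE//; apply: le_lt_trans la_fin.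
  by apply: le_measure; rewrite ?inE.
have m_ge0 B : 0 <= m B by exact: fine_ge0.
have mE B : measurable B -> la B = (m B)%:E by move=> mB; rewrite /m fineK// lafin.
have m_le B C : measurable B -> measurable C -> B `<=` C -> m B <= m C.
  by move=> mB mC BC; rewrite -lee_fin -!mE//; apply: le_measure; rewrite ?inE.
have mU B C : measurable B -> measurable C -> B `&` C = set0 ->
    m (B `|` C) = m B + m C.
  move=> mB mC BC; apply: EFin_inj.
  by rewrite EFinD -!mE ?measureU//; exact: measurableU.
have mUle B C : measurable B -> measurable C -> m (B `|` C) <= m B + m C.
  move=> mB mC; rewrite -lee_fin EFinD -!mE//; last exact: measurableU.
  exact: measureU2.
have mD B C : measurable B -> measurable C -> B `<=` C -> m (C `\` B) = m C - m B.
  move=> mB mC BC; have -> : m C = m (B `|` (C `\` B)) by rewrite setDUK.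
  rewrite mU; [by ring|exact: mB|exact: measurableD|].
  by rewrite setDE setICA setICr setI0.
set a : R := fine (la A); have aE : m A = a by [].
have [a0|aN0] := eqVneq a 0.
  exists set0; split; [exact: measurable0|by []| |].
    by rewrite measure0 a0 mulr0.
  by rewrite setD0 -/a a0 mulr0.
have a_gt0 : 0 < a by rewrite lt_neqAle eq_sym aN0 -aE m_ge0.
apply: contrapT => nosplit.
have dicho B : measurable B -> B `<=` A -> m B < a / 3 \/ 2 / 3 * a < m B.
  move=> mB BA; have [|hl] := ltP (m B) (a / 3); first by left.
  have [|hr] := ltP (2 / 3 * a) (m B); first by right.
  exfalso; apply: nosplit; exists B; split=> //.
  have := mD _ _ mB mA BA; rewrite aE /m -/a; move: hl; rewrite /m; lra.
pose small B := [/\ measurable B, B `<=` A & m B < a / 3].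
have smallU B C : small B -> small C -> small (B `|` C).
  move=> [mB BA sB] [mC CA sC]; split; [exact: measurableU|by rewrite subUset|].
  have BCA : B `|` C `<=` A by rewrite subUset.
  have [//|] := dicho (B `|` C) (measurableU _ _ mB mC) BCA.
  by have := mUle _ _ mB mC; lra.
have small0 : small set0.
  by split; [exact: measurable0|exact: sub0set|rewrite /m measure0 divr_gt0].
pose S : set R := [set m B | B in small].
have hS : has_sup S.
  split; first by exists (m set0), set0.
  by exists (a / 3) => _ [B [_ _ sB] <-]; exact: ltW.
pose s : R := sup S.
have /choice[B BP] : forall n, exists B, small B /\ s - (n.+1%:R : R)^-1 < m B.
  move=> n; have n0 : 0 < n.+1%:R^-1 :> R by rewrite invr_gt0.
  have [_ [B sB <-] ltB] := sup_adherent n0 hS.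
  by exists B.
pose F n := \big[setU/set0]_(i < n.+1) B i.
have smallF n : small (F n).
  elim: n => [|n IH]; rewrite /F big_ord_recr /=.
    by rewrite big_ord0; apply: smallU => //; exact: (BP 0%N).1.
  by apply: smallU => //; exact: (BP n.+1).1.
have mF n : measurable (F n) by have [] := smallF n.
have ndF : nondecreasing_seq F.
  move=> n k nk; apply/subsetPset; exact: subset_bigsetU.
pose U := \bigcup_n F n.
have mUU : measurable U by exact: bigcup_measurable.
have UA : U `<=` A by move=> t [n _]; have [_ FA _] := smallF n; exact: FA.
have smallU' : small U.
  split=> //; have [//|large] := dicho U mUU UA; exfalso.
  suff : m U <= a / 3 by lra.
  rewrite -lee_fin -mE//; have cvgF : la \o F @ \oo --> la U by exact: nondecreasing_cvg_mu.
  apply: (cvge_to_le cvgF); apply: nearW => n /=; rewrite mE// lee_fin; apply: ltW.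
  by have [] := smallF n.
have le_sup B' : small B' -> m B' <= s.
  by move=> sB'; apply: ub_le_sup; [exact: hS.2|exists B'].
have UsupS : s <= m U.
  suff H (e : R) : 0 < e -> s <= m U + e by apply/ler_addgt0Pr; exact: H.
  move=> e0.
  have [n ne] : exists n, (n.+1%:R : R)^-1 < e.
    by have := near_infty_natSinv_lt (PosNum e0); case=> n _ /(_ n (leqnn n)); exists n.
  have [[mB _ _] ltB] := BP n.
  have : m (B n) <= m U.
    apply: m_le => // t Bt; exists n => //; rewrite /F -bigcup_mkord.
    by exists n => //=.
  by move: ((n.+1%:R : R)^-1) ne ltB => k *; lra.
pose C := A `\` U; have mC : measurable C by exact: measurableD.
have mCE : m C = a - m U by rewrite mD// aE.
have C_gt0 : (0 < la C)%E.
  by rewrite mE// lte_fin mCE; case: smallU' => _ _; lra.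
have enlarge D : measurable D -> D `<=` C -> 0 < m D -> 2 / 3 * a < m D.
  move=> mDD DC D0; have DA : D `<=` A by move=> t /DC[].
  have [sD|//] := dicho D mDD DA; exfalso.
  have := le_sup _ (smallU _ _ smallU' (And3 mDD DA sD)).
  rewrite mU//; first by lra.
  by apply/seteqP; split => // t [Ut /DC[]].
have [D [mDD DC] [D0 CD0]] := la_atomless C mC C_gt0.
have := enlarge _ mDD DC; rewrite -lte_fin -mE// => /(_ D0).
have mCD : measurable (C `\` D) by exact: measurableD.
have := enlarge _ mCD (@subDsetl _ _ _); rewrite -lte_fin -mE// => /(_ CD0).
rewrite mD// mCE; have := m_ge0 U; lra.
Qed.

End AtomlessMeasures.

(** * Function spaces and their functionals *)

Section FunctionSpaceBasics.
Context (R : realType) (d : measure_display) (T : measurableType d).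
Context (mu : {measure set T -> \bar R}).
Context (Y : set (T -> R)) (M : (T -> R) -> R).
Hypothesis H : quasi_banach_function_space mu Y M.
Implicit Types (f g h k u v w : T -> R) (c : R).

Local Notation "f =ae g" := (ae_eq mu [set: T] f g) (at level 70).

Lemma fs_meas f : Y f -> measurable_fun [set: T] f.
Proof. by case: (qbfs_subspace H) => mY _ _ _ _; exact: mY. Qed.

Lemma fs_saturated f g : Y f -> measurable_fun [set: T] g -> f =ae g -> Y g.
Proof. by case: (qbfs_subspace H) => _ + _ _ _; exact. Qed.

Lemma fs0 : Y (cst 0).
Proof. by case: (qbfs_subspace H). Qed.

Lemma fsD f g : Y f -> Y g -> Y (f + g).
Proof. by case: (qbfs_subspace H) => _ _ _ + _; exact. Qed.

Lemma fsZ c f : Y f -> Y (c *: f).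
Proof. by case: (qbfs_subspace H) => _ _ _ _; exact. Qed.

Lemma fsN f : Y f -> Y (- f).
Proof. by rewrite -scaleN1r; exact: fsZ. Qed.

Lemma fsB f g : Y f -> Y g -> Y (f - g).
Proof. by move=> Yf Yg; apply: fsD => //; exact: fsN. Qed.

Lemma fs_lin c f g : Y f -> Y g -> Y (c *: f + g).
Proof. by move=> Yf Yg; apply: fsD => //; exact: fsZ. Qed.

Lemma fs_sum (I : Type) (r : seq I) (P : pred I) (f : I -> T -> R) :
  (forall i, P i -> Y (f i)) -> Y (\sum_(i <- r | P i) f i).
Proof. by move=> Yf; apply: (big_ind Y) => //; [exact: fs0|exact: fsD]. Qed.

Lemma fs_ideal f g : Y g -> measurable_fun [set: T] f ->
  (forall t, `|f t| <= `|g t|) -> Y f.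
Proof. by move=> Yg mf fg; apply: (qbfs_ideal H Yg mf); exact: aeW. Qed.

Lemma meas_norm f : measurable_fun [set: T] f ->
  measurable_fun [set: T] (fun t => `|f t|).
Proof. by move=> mf; exact: measurableT_comp. Qed.

Lemma fs_norm f : Y f -> Y (fun t => `|f t|).
Proof.
move=> Yf; apply: (fs_ideal Yf); first exact/meas_norm/fs_meas.
by move=> t; rewrite normr_id.
Qed.

Lemma fs_pos f : Y f -> Y (fun t => Num.max (f t) 0).
Proof.
move=> Yf; apply: (fs_ideal Yf).
  by apply: measurable_maxr; [exact: fs_meas|exact: measurable_cst].
by move=> t; case: (leP (f t) 0) => // _; rewrite normr0.
Qed.

Lemma fs_min f g : Y f -> Y g -> Y (fun t => Num.min `|f t| `|g t|).
Proof.
move=> Yf Yg; apply: (fs_ideal Yf).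
  by apply: measurable_minr; apply/meas_norm/fs_meas.
by move=> t; rewrite ger0_norm ?le_min ?normr_ge0// ge_min lexx.
Qed.

Lemma fn_ge0 f : Y f -> 0 <= M f.
Proof. by case: (qbfs_quasi_norm H) => + _ _ _; exact. Qed.

Lemma fn_eq0 f : Y f -> M f = 0 -> f =ae cst 0.
Proof. by case: (qbfs_quasi_norm H) => _ + _ _; exact. Qed.

Lemma fnZ c f : Y f -> M (c *: f) = `|c| * M f.
Proof. by case: (qbfs_quasi_norm H) => _ _ + _; exact. Qed.

Lemma fnN f : Y f -> M (- f) = M f.
Proof. by move=> Yf; rewrite -scaleN1r fnZ// normrN1 mul1r. Qed.

Lemma fn_distC f g : Y f -> Y g -> M (f - g) = M (g - f).
Proof. by move=> Yf Yg; rewrite -opprB fnN//; exact: fsB. Qed.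

Lemma fn0 : M (cst 0) = 0.
Proof.
have -> : cst 0 = 0 *: cst 0 :> (T -> R) by rewrite scale0r.
by rewrite fnZ ?normr0 ?mul0r//; exact: fs0.
Qed.

Lemma fn_le_ae f g : Y f -> Y g -> {ae mu, forall t, `|f t| <= `|g t|} ->
  M f <= M g.
Proof. exact: qbfs_lattice H f g. Qed.

Lemma fn_le f g : Y f -> Y g -> (forall t, `|f t| <= `|g t|) -> M f <= M g.
Proof. by move=> Yf Yg fg; apply: fn_le_ae => //; exact: aeW. Qed.

Lemma fn_ae_norm f g : Y f -> Y g -> {ae mu, forall t, `|f t| = `|g t|} ->
  M f = M g.
Proof.
move=> Yf Yg fg; apply/eqP; rewrite eq_le; apply/andP.
by split; apply: fn_le_ae => //; apply: filterS fg => t ->.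
Qed.

Lemma fn_ae f g : Y f -> Y g -> f =ae g -> M f = M g.
Proof. by move=> Yf Yg fg; apply: fn_ae_norm => //; apply: filterS fg => t /(_ I) ->. Qed.

Lemma fn_norm f : Y f -> M (fun t => `|f t|) = M f.
Proof.
move=> Yf; apply: fn_ae_norm => //; first exact: fs_norm.
by apply: aeW => t; rewrite normr_id.
Qed.

Lemma fn_ae0 f : Y f -> f =ae cst 0 -> M f = 0.
Proof. by move=> Yf f0; rewrite -fn0; apply: fn_ae => //; exact: fs0. Qed.

Lemma fn_gt0 f : Y f -> ~ (f =ae cst 0) -> 0 < M f.
Proof.
move=> Yf fN0; rewrite lt_neqAle fn_ge0// andbT eq_sym.
by apply/eqP => /(fn_eq0 Yf).
Qed.

Lemma fn_quasi : exists2 K : R, 0 <= K &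
  forall f g, Y f -> Y g -> M (f + g) <= K * (M f + M g).
Proof.
case: (qbfs_quasi_norm H) => _ _ _ [K KP]; exists `|K| => // f g Yf Yg.
apply: le_trans (KP f g Yf Yg) _; rewrite ler_wpM2r ?ler_norm//.
by rewrite addr_ge0// fn_ge0.
Qed.

Section Functionals.
Variable phi : (T -> R) -> R.
Hypothesis phiF : functional mu Y M phi.

Lemma functionalD h k : Y h -> Y k -> phi (h + k) = phi h + phi k.
Proof.
by move=> Yh Yk; rewrite -{1}[h]scale1r (functional_linear phiF)// mul1r.
Qed.

Lemma functional0 : phi (cst 0) = 0.
Proof.
have := functionalD fs0 fs0; rewrite (_ : cst 0 + cst 0 = cst 0); first lra.
exact: addr0.
Qed.

Lemma functionalZ c h : Y h -> phi (c *: h) = c * phi h.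
Proof.
move=> Yh; have := functional_linear phiF c Yh fs0.
by rewrite functional0 !addr0.
Qed.

Lemma functionalN h : Y h -> phi (- h) = - phi h.
Proof. by move=> Yh; rewrite -scaleN1r functionalZ// mulN1r. Qed.

Lemma functional_bounded : exists2 C : R, 0 <= C &
  forall h, Y h -> `|phi h| <= C * M h.
Proof.
have [r r0 phir] := functional_continuous phiF fs0 (@ltr01 R).
exists (2 / r); first by rewrite divr_ge0// ltW.
move=> h Yh; have [Mh0|Mh0] := eqVneq (M h) 0.
  rewrite (functional_ae phiF Yh fs0 (fn_eq0 Yh Mh0)) functional0 normr0.
  by rewrite Mh0 mulr0.
have Mh_gt0 : 0 < M h by rewrite lt_neqAle eq_sym Mh0 fn_ge0.
pose c := r / 2 / M h; have c0 : 0 < c by rewrite !divr_gt0.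
have := phir (c *: h) (fsZ c Yh); rewrite functional0 !subr0.
rewrite fnZ// gtr0_norm// /c divfK// => /(_ _).
rewrite functionalZ// normrM -/c gtr0_norm// => lt1.
have {}lt1 : c * `|phi h| < 1 by apply: lt1; lra.
have -> : 2 / r * M h = c^-1 by rewrite /c; field; rewrite !gt_eqF.
by rewrite -[leRHS]mul1r ler_pdivlMr// mulrC ltW.
Qed.

Let dual_set := [set `|phi h| | h in closed_ball_of Y M].

Lemma dual_set_has_sup : has_sup dual_set.
Proof.
split; first by exists `|phi (cst 0)|, (cst 0) => //; split; [exact: fs0|rewrite fn0].
have [C C0 CP] := functional_bounded; exists C => _ [h [Yh Mh] <-].
by apply: le_trans (CP h Yh) _; rewrite ler_piMr.
Qed.

Lemma dual_norm_ge0 : 0 <= dual_norm Y M phi.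
Proof.
apply: le_trans (normr_ge0 (phi (cst 0))) _.
apply: ub_le_sup; first exact: dual_set_has_sup.2.
by exists (cst 0) => //; split; [exact: fs0|rewrite fn0].
Qed.

Lemma dual_normP h : Y h -> `|phi h| <= dual_norm Y M phi * M h.
Proof.
move=> Yh; have [Mh0|Mh0] := eqVneq (M h) 0.
  by have [C C0 /(_ h Yh)] := functional_bounded; rewrite Mh0 !mulr0.
have Mh_gt0 : 0 < M h by rewrite lt_neqAle eq_sym Mh0 fn_ge0.
have V_gt0 : 0 < (M h)^-1 by rewrite invr_gt0.
rewrite -ler_pdivrMr// mulrC -{1}(gtr0_norm V_gt0) -normrM -functionalZ//.
apply: ub_le_sup; first exact: dual_set_has_sup.2.
exists ((M h)^-1 *: h) => //; split; first exact: fsZ.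
by rewrite fnZ// gtr0_norm// mulVf.
Qed.

Lemma dual_norm_le C : (forall h, Y h -> M h <= 1 -> `|phi h| <= C) ->
  dual_norm Y M phi <= C.
Proof.
move=> phiC; apply: ge_sup; first exact: dual_set_has_sup.1.
by move=> _ [h [Yh Mh] <-]; exact: phiC.
Qed.

Lemma dual_norm_lt e : e < dual_norm Y M phi ->
  exists h, [/\ Y h, M h <= 1 & e < phi h].
Proof.
move=> elt; have e0 : 0 < dual_norm Y M phi - e by rewrite subr_gt0.
have [_ [h [Yh Mh] <-]] := sup_adherent e0 dual_set_has_sup.
rewrite -/(dual_norm Y M phi) subKr => lt_e.
have [h0|h0] := leP 0 (phi h); first by exists h; rewrite -(ger0_norm h0).
exists (- h); split; [exact: fsN|by rewrite fnN|].
by rewrite functionalN// -ltr0_norm.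
Qed.

End Functionals.

(** Almost-everywhere invariance comes for free with a bound by the quasi-norm. *)
Lemma functional_of_bounded (phi : (T -> R) -> R) C :
  (forall c h k, Y h -> Y k -> phi (c *: h + k) = c * phi h + phi k) ->
  (forall h, Y h -> `|phi h| <= C * M h) -> functional mu Y M phi.
Proof.
move=> phiL phiC; have phiB h k : Y h -> Y k -> phi (h - k) = phi h - phi k.
  by move=> Yh Yk; rewrite addrC -scaleN1r phiL// mulN1r addrC.
split => //.
- move=> h k Yh Yk hk; apply/eqP; rewrite -subr_eq0 -phiB// -normr_le0.
  apply: le_trans (phiC _ (fsB Yh Yk)) _; rewrite fn_ae0 ?mulr0//; first exact: fsB.
  by apply: filterS hk => t /(_ I) hk _; rewrite !fctE hk subrr.
- move=> h Yh e e0; exists (e / (`|C| + 1)); first by rewrite divr_gt0// ltr_wpDl.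
  move=> k Yk; rewrite ltr_pdivlMr ?ltr_wpDl// => lt_e.
  rewrite -phiB//; apply: le_lt_trans (phiC _ (fsB Yk Yh)) _.
  apply: le_lt_trans lt_e; rewrite mulrC ler_wpM2l ?fn_ge0//; first exact: fsB.
  by have := ler_norm C; lra.
Qed.

Lemma functional_scale phi c : functional mu Y M phi ->
  functional mu Y M (fun h => c * phi h).
Proof.
move=> phiF; have [C C0 CP] := functional_bounded phiF.
apply: (@functional_of_bounded _ (`|c| * C)).
  by move=> a h k Yh Yk; rewrite (functional_linear phiF)//; ring.
by move=> h Yh; rewrite normrM -mulrA ler_wpM2l// CP.
Qed.

Lemma functional_normalize phi : functional mu Y M phi ->
  0 < dual_norm Y M phi ->
  dual_sphere mu Y M (fun h => (dual_norm Y M phi)^-1 * phi h).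
Proof.
move=> phiF; set L := dual_norm Y M phi => L0.
have psiF := functional_scale L^-1 phiF; split => //.
apply/eqP; rewrite eq_le; apply/andP; split.
  apply: dual_norm_le => // h Yh Mh.
  rewrite normrM gtr0_norm ?invr_gt0// mulrC ler_pdivrMr// mul1r.
  by apply: le_trans (dual_normP phiF Yh) _; rewrite ler_piMr// ltW.
set K := dual_norm Y M _.
suff : L <= K * L by rewrite ler_pMl.
apply: dual_norm_le => // h Yh Mh.
have := dual_normP psiF Yh; rewrite normrM gtr0_norm ?invr_gt0// mulrC.
rewrite ler_pdivrMr// => /le_trans; apply; rewrite -/K mulrAC.
by rewrite ler_piMr// mulr_ge0 ?(ltW L0)//; exact: (dual_norm_ge0 psiF).
Qed.

End FunctionSpaceBasics.

(** * Norms additive on the positive cone *)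

(** The property that makes (Y, M) an AL-space in the sense of Kakutani. *)
Definition additive_on_cone (R : realType) (T : Type) (Y : set (T -> R))
    (M : (T -> R) -> R) :=
  forall u v, Y u -> Y v -> (forall t, 0 <= u t) -> (forall t, 0 <= v t) ->
    M (u + v) = M u + M v.

Section AbstractL1.
Context (R : realType) (d : measure_display) (T : measurableType d).
Context (mu : {measure set T -> \bar R}).
Context (Y : set (T -> R)) (M : (T -> R) -> R).
Hypothesis H : quasi_banach_function_space mu Y M.
Hypothesis AL : additive_on_cone Y M.
Implicit Types (f g h k u v w : T -> R) (c : R).

Local Notation "f =ae g" := (ae_eq mu [set: T] f g) (at level 70).

Lemma al_subadditive : subadditive Y M.
Proof.
move=> u v Yu Yv; rewrite -(fn_norm H Yu) -(fn_norm H Yv) -AL//.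
- apply: (fn_le H) => [||t]; first exact: (fsD H).
    by apply: (fsD H); exact: (fs_norm H).
  by rewrite [leRHS]ger0_norm ?addr_ge0//; exact: ler_normD.
- exact: (fs_norm H).
- exact: (fs_norm H).
Qed.

Lemma al_sum (I : Type) (r : seq I) (u : I -> T -> R) :
  (forall i, Y (u i)) -> (forall i t, 0 <= u i t) ->
  M (\sum_(i <- r) u i) = \sum_(i <- r) M (u i).
Proof.
move=> Yu u0; suff [_ _ ->] : [/\ Y (\sum_(i <- r) u i),
  forall t, 0 <= (\sum_(i <- r) u i) t &
  M (\sum_(i <- r) u i) = \sum_(i <- r) M (u i)] by [].
apply: (big_ind2 (fun v a => [/\ Y v, forall t, 0 <= v t & M v = a])).
- by split => //; [exact: (fs0 H)|exact: (fn0 H)].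
- move=> v a w b [Yv v0 <-] [Yw w0 <-]; split; [exact: (fsD H)| |exact: AL].
  by move=> t; rewrite addr_ge0.
- by move=> i _; split.
Qed.

(** For Y = L^1 this is the integral. *)
Definition cone_integral w : R :=
  M (fun t => Num.max (w t) 0) - M (fun t => Num.max (- w t) 0).

Lemma cone_integralE u v w : Y u -> Y v -> (forall t, 0 <= u t) ->
  (forall t, 0 <= v t) -> (forall t, w t = u t - v t) ->
  cone_integral w = M u - M v.
Proof.
move=> Yu Yv u0 v0 wE; rewrite /cone_integral.
have -> : w = u - v by apply/funext.
have Yp := fs_pos H (fsB H Yu Yv); have Yn := fs_pos H (fsB H Yv Yu).
have eqn : (fun t => Num.max ((v - u) t) 0) = (fun t => Num.max (- (u - v) t) 0).
  by apply/funext => t; rewrite !fctE opprB.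
rewrite eqn in Yn.
suff : M (fun t => Num.max ((u - v) t) 0) + M v
  = M (fun t => Num.max (- (u - v) t) 0) + M u by lra.
rewrite -!AL//; try by move=> t; rewrite le_max lexx orbT.
congr M; apply/funext => t; rewrite !fctE.
by case: (leP (u t - v t) 0); case: (leP (- (u t - v t)) 0); lra.
Qed.

Lemma cone_integral_ge0 u : Y u -> (forall t, 0 <= u t) -> cone_integral u = M u.
Proof.
move=> Yu u0; rewrite (@cone_integralE u (cst 0) u)//; last 2 first.
- exact: (fs0 H).
- by move=> t; rewrite subr0.
by rewrite (fn0 H) subr0.
Qed.

Lemma cone_integral_le u : Y u -> `|cone_integral u| <= M u.
Proof.
move=> Yu; have Yp := fs_pos H Yu; have Yn := fs_pos H (fsN H Yu).
have p0 t : 0 <= Num.max (u t) 0 by rewrite le_max lexx orbT.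
have n0 t : 0 <= Num.max (- u t) 0 by rewrite le_max lexx orbT.
have -> : M u = M (fun t => Num.max (u t) 0) + M (fun t => Num.max (- u t) 0).
  rewrite -AL// -(fn_norm H Yu); congr M; apply/funext => t; rewrite !fctE.
  by have [u0|u0] := leP 0 (u t); rewrite ?(ger0_norm u0) ?(ltr0_norm u0);
  case: (leP (u t) 0) => ?; case: (leP (- u t) 0) => ?; lra.
rewrite /cone_integral ler_norml.
by have := fn_ge0 H Yp; have := fn_ge0 H Yn; rewrite !fctE; move=> ? ?; apply/andP; split; lra.
Qed.

Lemma cone_integral_linear c u v : Y u -> Y v ->
  cone_integral (c *: u + v) = c * cone_integral u + cone_integral v.
Proof.
move=> Yu Yv; pose p w t : R := Num.max (w t) 0; pose n w t : R := Num.max (- w t) 0.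
have pn w t : w t = p w t - n w t.
  by rewrite /p /n; case: (leP (w t) 0) => ?; case: (leP (- w t) 0) => ?; lra.
have Yp w : Y w -> Y (p w) by exact: (fs_pos H).
have Yn w : Y w -> Y (n w) by move=> Yw; exact: (fs_pos H (fsN H Yw)).
have p0 w t : 0 <= p w t by rewrite le_max lexx orbT.
have n0 w t : 0 <= n w t by rewrite le_max lexx orbT.
have IE w : cone_integral w = M (p w) - M (n w) by [].
have comb (a : R) f g : 0 <= a -> Y f -> Y g -> (forall t, 0 <= f t) ->
    (forall t, 0 <= g t) -> [/\ Y (a *: f + g), forall t, 0 <= (a *: f + g) t &
      M (a *: f + g) = a * M f + M g].
  move=> a0 Yf Yg f0 g0; have Yaf := fsZ H a Yf.
  have af0 t : 0 <= (a *: f) t by rewrite mulr_ge0.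
  split; [exact: (fsD H)|by move=> t; rewrite addr_ge0|].
  by rewrite AL// (fnZ H)// ger0_norm.
have [c0|c0] := leP 0 c.
  have [Y1 pos1 E1] := comb _ _ _ c0 (Yp u Yu) (Yp v Yv) (p0 u) (p0 v).
  have [Y2 pos2 E2] := comb _ _ _ c0 (Yn u Yu) (Yn v Yv) (n0 u) (n0 v).
  rewrite (cone_integralE Y1 Y2)// ?E1 ?E2 ?IE; first by ring.
  by move=> t; rewrite !fctE [u t]pn [v t]pn; rewrite /GRing.scale /=; ring.
have cN : 0 <= - c by lra.
have [Y1 pos1 E1] := comb _ _ _ cN (Yn u Yu) (Yp v Yv) (n0 u) (p0 v).
have [Y2 pos2 E2] := comb _ _ _ cN (Yp u Yu) (Yn v Yv) (p0 u) (n0 v).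
rewrite (cone_integralE Y1 Y2)// ?E1 ?E2 ?IE; first by ring.
by move=> t; rewrite !fctE [u t]pn [v t]pn; rewrite /GRing.scale /=; ring.
Qed.

Lemma cone_integral_functional : functional mu Y M cone_integral.
Proof.
apply: (@functional_of_bounded _ _ _ _ _ _ H _ 1) => [|h Yh].
  exact: cone_integral_linear.
by rewrite mul1r cone_integral_le.
Qed.

Lemma cone_integral_dual_ball : dual_ball mu Y M cone_integral.
Proof.
split; first exact: cone_integral_functional.
apply: (dual_norm_le H cone_integral_functional) => h Yh.
exact: le_trans (cone_integral_le Yh).
Qed.

(** The integral against the sign of w attains the norm of w; this replaces
    the Hahn-Banach theorem. *)
Lemma al_norming_functional w : Y w -> exists sigma : (T -> R) -> R,
  [/\ forall c h k, Y h -> Y k -> sigma (c *: h + k) = c * sigma h + sigma k,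
      forall h, Y h -> `|sigma h| <= M h & sigma w = M w].
Proof.
move=> Yw; pose s h t : R := if w t < 0 then - h t else h t.
have Ns h t : `|s h t| = `|h t| by rewrite /s; case: ifP; rewrite ?normrN.
have Ys h : Y h -> Y (s h).
  move=> Yh; apply: (fs_ideal H Yh); last by move=> t; rewrite Ns.
  apply: measurable_fun_ifT.
  - by apply: measurable_fun_ltr; [exact: (fs_meas H Yw)|exact: measurable_cst].
  - by apply: (fs_meas H); exact: (fsN H Yh).
  - exact: (fs_meas H Yh).
have Ms h : Y h -> M (s h) = M h.
  by move=> Yh; apply: (fn_ae_norm H) => //; [exact: Ys|exact: aeW].
exists (fun h => cone_integral (s h)); split.
- move=> c h k Yh Yk; rewrite /= -(cone_integral_linear c (Ys h Yh) (Ys k Yk)).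
  congr (cone_integral _).
  apply/funext => t; rewrite !fctE /s /GRing.scale /=.
  by case: ifP => _ //; ring.
- by move=> h Yh; rewrite -(Ms h Yh); exact: cone_integral_le (Ys h Yh).
- rewrite cone_integral_ge0 ?Ms//; first exact: Ys.
  by move=> t; rewrite /s; case: ltP; lra.
Qed.

(** Pointwise |u| + |v| <= |u + v| + 2 min(|u|, |v|). *)
Lemma al_overlap u v : Y u -> Y v ->
  M u + M v <= M (u + v) + 2 * M (fun t => Num.min `|u t| `|v t|).
Proof.
move=> Yu Yv; have Ym := fs_min H Yu Yv.
have m0 t : 0 <= Num.min `|u t| `|v t| by rewrite le_min !normr_ge0.
rewrite -(fn_norm H Yu) -(fn_norm H Yv) -(fn_norm H (fsD H Yu Yv)).
have -> : 2 * M (fun t => Num.min `|u t| `|v t|)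
   = M (2 *: (fun t => Num.min `|u t| `|v t|)) by rewrite (fnZ H)// ger0_norm.
have Yu' := fs_norm H Yu; have Yv' := fs_norm H Yv.
have Yuv := fs_norm H (fsD H Yu Yv); have Ym2 := fsZ H 2 Ym.
rewrite -!AL//; last by move=> t; rewrite mulr_ge0.
apply: (fn_le H); [exact: (fsD H)|exact: (fsD H)|] => t.
have min0 := m0 t; rewrite !fctE /GRing.scale /=.
rewrite [leLHS]ger0_norm ?addr_ge0// [leRHS]ger0_norm ?addr_ge0 ?mulr_ge0//.
have := ler_normD (u t + v t) (- v t); have := ler_normD (u t + v t) (- u t).
have -> : u t + v t - u t = v t by ring.
have -> : u t + v t - v t = u t by ring.
rewrite !normrN.
by move=> ? ?; case: (leP `|u t| `|v t|) => ?; lra.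
Qed.

(** If u is dominated by differences w - v of arbitrarily small norm, it vanishes;
    this is how norm limits are compared with pointwise bounds. *)
Lemma al_norm_cvg_sandwich u v : Y u -> Y v -> (forall e : R, 0 < e ->
   exists2 w, Y w & M (w - v) <= e /\ {ae mu, forall t, `|u t| <= `|w t - v t|}) ->
  u =ae cst 0.
Proof.
move=> Yu Yv small; apply: (fn_eq0 H Yu); apply/eqP; rewrite eq_le (fn_ge0 H Yu) andbT.
suff h (e : R) : 0 < e -> M u <= 0 + e by apply/ler_addgt0Pr; exact: h.
rewrite add0r => e0; have [w Yw [we uw]] := small e e0.
by apply: le_trans we; apply: (fn_le_ae H) => //; exact: (fsB H).
Qed.

(** Bounded increasing sequences are Cauchy because the norm is additive; the
    norm limit dominates every term and lies below every upper bound, hence it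
    is the pointwise limit. *)
Lemma al_monotone_convergence (u : nat -> T -> R) v (C : R) :
  (forall n, Y (u n)) -> (forall n t, 0 <= u n t) ->
  (forall t, {homo u^~ t : n m / (n <= m)%N >-> n <= m}) ->
  (forall t, u n t @[n --> \oo] --> v t) -> (forall n, M (u n) <= C) ->
  Y v /\ M (u n) @[n --> \oo] --> M v.
Proof.
move=> Yu u0 nd uv MC.
have uv_le n t : u n t <= v t.
  apply: (cvgr_to_ge (uv t)); near=> m; apply: nd; near: m; exact: nbhs_infty_ge.
have mono n m : (n <= m)%N -> M (u m) = M (u n) + M (u m - u n).
  move=> nm; rewrite -AL//; [by rewrite subrKC|exact: (fsB H)|].
  by move=> t; rewrite subr_ge0 nd.
have ndM : nondecreasing_seq (M \o u).
  by move=> n m nm /=; rewrite (mono _ _ nm) lerDl (fn_ge0 H)//; exact: (fsB H).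
have cvgM : cvgn (M \o u).
  by apply: nondecreasing_is_cvgn => //; exists C => _ [n _ <-] /=.
have Mle n : M (u n) <= limn (M \o u) by exact: nondecreasing_cvgn_le.
have cauchy (e : R) : 0 < e -> exists n0 : nat, forall n m : nat,
    (n0 <= n)%N -> (n0 <= m)%N -> M (u n - u m) < e.
  move=> e0; have [n0 _ n0P] := (cvgrPdist_lt _ _).1 cvgM e e0.
  exists n0; suff le_case n m : (n0 <= n)%N -> (n <= m)%N -> M (u m - u n) < e.
    move=> n m n0n n0m; have [nm|mn] := leqP n m; last exact/le_case/ltnW.
    by rewrite (fn_distC H)//; exact: le_case.
  move=> n0n nm; have := n0P n n0n; have := mono n m nm; have := Mle m.
  rewrite /= => h1 h2 h3; have := ler_norm (limn (M \o u) - M (u n)); lra.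
have [w Yw cvg_w] := qbfs_complete H Yu cauchy.
have small (e : R) n : 0 < e -> exists2 m, (n <= m)%N & M (u m - w) <= e.
  move=> e0; have [n0 _ n0P] := (cvgrPdist_lt _ _).1 cvg_w e e0.
  exists (maxn n n0); first exact: leq_maxl.
  have := n0P (maxn n n0) (leq_maxr _ _); rewrite sub0r normrN => /ltW.
  exact/le_trans/ler_norm.
have uw n : {ae mu, forall t, u n t <= w t}.
  have Ypos := fs_pos H (fsB H (Yu n) Yw).
  suff : (fun t => Num.max ((u n - w) t) 0) =ae cst 0.
    apply: filterS => t /(_ I); rewrite !fctE => h; rewrite -subr_le0 -h.
    by rewrite le_max lexx.
  apply: (al_norm_cvg_sandwich Ypos Yw) => e e0.
  have [m nm me] := small e n e0; exists (u m) => //; split => //.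
  apply: aeW => t; rewrite !fctE; have := nd t _ _ nm.
  have := ler_norm (u m t - w t); have := normr_ge0 (u m t - w t).
  by move=> ? ? ?; case: (leP (u n t - w t) 0) => ?; rewrite ?normr0// gtr0_norm//; lra.
have vw : {ae mu, forall t, v t <= w t}.
  have : {ae mu, forall t, forall n, u n t <= w t} by apply/ae_foralln.
  apply: filterS => t h; apply: (cvgr_to_le (uv t)); exact: nearW.
have mv : measurable_fun [set: T] v.
  apply: (@measurable_fun_cvg _ _ _ _ u) => [n|t _]; [exact: (fs_meas H (Yu n))|exact: uv].
have Yv : Y v.
  apply: (qbfs_ideal H Yw mv); apply: filterS vw => t vw.
  have v0 : 0 <= v t by exact: le_trans (u0 0%N t) (uv_le 0%N t).
  by rewrite !ger0_norm//; exact: le_trans vw.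
have vw0 : (v - w) =ae cst 0.
  apply: (al_norm_cvg_sandwich (fsB H Yv Yw) Yw) => e e0.
  have [m _ me] := small e 0%N e0; exists (u m) => //; split => //.
  apply: filterS vw => t; rewrite !fctE => h; have := uv_le m t => h'.
  by rewrite !ler0_norm; lra.
split => //; apply/cvgrPdist_lt => e e0; near=> n.
have -> : M v = M (u n) + M (v - u n).
  rewrite -AL//; [by rewrite subrKC|exact: (fsB H)|].
  by move=> t; rewrite subr_ge0.
rewrite addrAC subrr add0r ger0_norm; last by apply: (fn_ge0 H); exact: (fsB H).
have -> : M (v - u n) = M (u n - w).
  rewrite (fn_distC H)//; apply: (fn_ae H); [exact: (fsB H)|exact: (fsB H)|].
  apply: filterS vw0 => t /(_ I); rewrite !fctE => h _; lra.
near: n; have [n0 _ n0P] := (cvgrPdist_lt _ _).1 cvg_w e e0; exists n0 => // n /n0P.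
by rewrite sub0r normrN; apply: le_lt_trans; exact: ler_norm.
Unshelve. all: by end_near.
Qed.

End AbstractL1.

(** * The p-th power of a function space *)

Section PowerSpace.
Context (R : realType) (d : measure_display) (T : measurableType d).
Context (mu : {measure set T -> \bar R}) (p : R).
Context (X : set (T -> R)) (N : (T -> R) -> R).
Hypothesis p1 : 1 <= p.
Hypothesis H : quasi_banach_function_space mu X N.
Implicit Types (f g h k u v w : T -> R) (c r : R).

Local Notation "f =ae g" := (ae_eq mu [set: T] f g) (at level 70).
Local Notation Y := (pspace p X).
Local Notation M := (pnorm p N).

Let p_gt0 : 0 < p. Proof. exact: lt_le_trans p1. Qed.
Let p_neq0 : p != 0. Proof. by rewrite gt_eqF. Qed.
Let pV_neq0 : p^-1 != 0. Proof. by rewrite invr_eq0. Qed.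
Let pV_ge0 : 0 <= p^-1. Proof. by rewrite invr_ge0 ltW. Qed.

Lemma norm_spow r f t : r != 0 -> `|spow r f t| = `|f t| `^ r.
Proof. exact: norm_sgMpowR. Qed.

Lemma spowVK h : spow p (spow p^-1 h) = h.
Proof.
apply/funext => t; rewrite /spow sg_sgMpowR norm_sgMpowR// powRVK//.
by rewrite -numEsg.
Qed.

Lemma measurable_norm_powR r f : measurable_fun [set: T] f ->
  measurable_fun [set: T] (fun t => `|f t| `^ r).
Proof.
move=> mf; apply: (measurableT_comp (f := fun x : R => x `^ r)).
  exact: measurable_powR.
exact: meas_norm.
Qed.

Lemma measurable_spow r f : r != 0 -> measurable_fun [set: T] f ->
  measurable_fun [set: T] (spow r f).
Proof.
move=> r0 mf.
have -> : spow r f = fun t => if f t < 0 then - (`|f t| `^ r) else `|f t| `^ r.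
  apply/funext => t; rewrite /spow; case: ltP => ft.
    by rewrite ltr0_sg// mulN1r.
  by rewrite sgMpowR_ge0// ger0_norm.
apply: measurable_fun_ifT.
- by apply: measurable_fun_ltr => //; exact: measurable_cst.
- by apply: measurableT_comp => //; exact: measurable_norm_powR.
- exact: measurable_norm_powR.
Qed.

Lemma pspace_norm h : Y h -> X (fun t => `|h t| `^ p^-1).
Proof. by case. Qed.

Lemma pspace_root h : Y h -> X (spow p^-1 h).
Proof.
case=> mh Xh; apply: (fs_ideal H Xh); first exact: measurable_spow.
by move=> t; rewrite norm_spow// (ger0_norm (powR_ge0 _ _)).
Qed.

Lemma pspace_spow f : X f -> Y (spow p f).
Proof.
move=> Xf; split; first by apply: measurable_spow => //; exact: (fs_meas H).
have -> : (fun t => `|spow p f t| `^ p^-1) = fun t => `|f t|.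
  by apply/funext => t; rewrite norm_spow// powRKV.
exact: (fs_norm H).
Qed.

Lemma pnorm_spow f : X f -> M (spow p f) = N f `^ p.
Proof.
move=> Xf; rewrite /pnorm; congr (_ `^ _); rewrite -(fn_norm H Xf).
by congr N; apply/funext => t; rewrite norm_spow// powRKV.
Qed.

Lemma norm_root h : Y h -> N (spow p^-1 h) = M h `^ p^-1.
Proof.
move=> Yh; have Xh := pspace_root Yh.
by rewrite -[in RHS](spowVK h) pnorm_spow// powRKV// (fn_ge0 H).
Qed.

Lemma norm_abs_root h : Y h -> N (fun t => `|h t| `^ p^-1) = M h `^ p^-1.
Proof. by move=> Yh; rewrite /pnorm powRKV// (fn_ge0 H)//; exact: pspace_norm. Qed.

Lemma pnorm_root h : Y h -> M h = N (spow p^-1 h) `^ p.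
Proof. by move=> Yh; rewrite norm_root// powRVK// powR_ge0. Qed.

Lemma spow_ball f : X f -> N f <= 1 -> M (spow p f) <= 1.
Proof.
move=> Xf Nf; rewrite pnorm_spow// -[leRHS](one_powR p).
by apply: powR_monotone => //; [exact: ltW|exact: (fn_ge0 H)].
Qed.

Lemma root_ball h : Y h -> M h <= 1 -> N (spow p^-1 h) <= 1.
Proof.
move=> Yh Mh; rewrite norm_root// -[leRHS](one_powR p^-1).
by apply: powR_monotone => //; exact: powR_ge0.
Qed.

Let pspaceD h k : Y h -> Y k -> Y (h + k).
Proof.
move=> [mh Xh] [mk Xk]; split; first exact: measurable_funD.
apply: (fs_ideal H (fsD H Xh Xk)).
  by apply: measurable_norm_powR; exact: measurable_funD.
move=> t; rewrite !fctE ger0_norm ?powR_ge0// [leRHS]ger0_norm ?addr_ge0 ?powR_ge0//.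
apply: le_trans (powRV_subadditive p1 (normr_ge0 _) (normr_ge0 _)).
by apply: powR_monotone => //; exact: ler_normD.
Qed.

Let pspaceZ c h : Y h -> Y (c *: h).
Proof.
move=> [mh Xh]; have mch : measurable_fun [set: T] (c *: h).
  by apply: measurable_funM => //; exact: measurable_cst.
split => //; have -> : (fun t => `|(c *: h) t| `^ p^-1)
    = (`|c| `^ p^-1) *: (fun t => `|h t| `^ p^-1).
  by apply/funext => t; rewrite !fctE normrM powRM.
exact: (fsZ H).
Qed.

Let pspace_le h k : Y h -> Y k -> {ae mu, forall t, `|h t| <= `|k t|} ->
  M h <= M k.
Proof.
move=> Yh Yk hk; apply: powR_monotone; [exact: ltW| |].
  by apply: (fn_ge0 H); exact: pspace_norm.
apply: (fn_le_ae H); [exact: pspace_norm|exact: pspace_norm|].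
apply: filterS hk => t hk; rewrite [leLHS]ger0_norm ?powR_ge0// [leRHS]ger0_norm ?powR_ge0//.
exact: powR_monotone.
Qed.

Let pspace_subspace : subspace mu Y.
Proof.
split.
- by move=> f [].
- move=> f g [mf Xf] mg fg; split => //.
  apply: (fs_saturated H Xf); first exact: measurable_norm_powR.
  by apply: filterS fg => t /(_ I) -> _.
- split; first exact: measurable_cst.
  have -> : (fun t => `|(cst 0 : T -> R) t| `^ p^-1) = cst 0.
    by apply/funext => t; rewrite normr0 powR0.
  exact: (fs0 H).
- by move=> f g; exact: pspaceD.
- by move=> c f; exact: pspaceZ.
Qed.

Let pnorm_quasi : exists2 K : R, 0 <= K &
  forall f g, Y f -> Y g -> M (f + g) <= K * (M f + M g).
Proof.
have [K K0 KP] := fn_quasi H; exists (K `^ p * 2 `^ p).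
  by rewrite mulr_ge0 ?powR_ge0.
move=> f g Yf Yg; have [Xf Xg] := (pspace_norm Yf, pspace_norm Yg).
rewrite /pnorm; apply: (@le_trans _ _ ((K * (N (fun t => `|f t| `^ p^-1) +
    N (fun t => `|g t| `^ p^-1))) `^ p)).
  apply: powR_monotone; first exact: ltW.
    by apply: (fn_ge0 H); exact: pspace_norm (pspaceD Yf Yg).
  apply: le_trans (KP _ _ Xf Xg); apply: (fn_le H).
  - exact: pspace_norm (pspaceD Yf Yg).
  - exact: (fsD H).
  move=> t; rewrite !fctE ger0_norm ?powR_ge0// [leRHS]ger0_norm ?addr_ge0 ?powR_ge0//.
  apply: le_trans (powRV_subadditive p1 (normr_ge0 _) (normr_ge0 _)).
  by apply: powR_monotone => //; exact: ler_normD.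
have Nf := fn_ge0 H Xf; have Ng := fn_ge0 H Xg.
rewrite powRM ?addr_ge0// -mulrA ler_wpM2l ?powR_ge0//.
exact: powR_add_bound.
Qed.

Let pspace_quasi_norm : quasi_norm mu Y M.
Proof.
split.
- by move=> f _; exact: powR_ge0.
- move=> f Yf Mf; have := powR_eq0_eq0 Mf => Nf.
  have := fn_eq0 H (pspace_norm Yf) Nf; apply: filterS => t /(_ I) ft _.
  by apply/eqP; rewrite -normr_eq0; apply/eqP/(powR_eq0_eq0 (p := p^-1)).
- move=> c f Yf; rewrite /pnorm.
  have -> : (fun t => `|(c *: f) t| `^ p^-1)
      = (`|c| `^ p^-1) *: (fun t => `|f t| `^ p^-1).
    by apply/funext => t; rewrite !fctE normrM powRM.
  have Xf := pspace_norm Yf.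
  rewrite (fnZ H)// (ger0_norm (powR_ge0 _ _)) powRM ?powR_ge0 ?(fn_ge0 H)//.
  by rewrite powRVK.
- by have [K K0 KP] := pnorm_quasi; exists K.
Qed.

(** A Cauchy sequence of p-th powers has Cauchy p-th roots, because signed roots
    are Hoelder continuous; the p-th power of the limit is the limit sought,
    because the signed power is continuous uniformly relatively to |f|^p for
    the fixed limit f. *)
Let pspace_complete : complete_space Y M.
Proof.
move=> u Yu cauchy; have Xu n := pspace_root (Yu n).
have [A A0 AP] : exists2 A : R, 0 < A & forall a b : R,
    `|Num.sg a * `|a| `^ p^-1 - Num.sg b * `|b| `^ p^-1| `^ p <= A * `|a - b|.
  by exists (2 `^ p); [rewrite powR_gt0|move=> a b; exact: signed_root_hoelder].
have root_pos (b : R) : 0 < b -> exists2 r : R, 0 < r & r `^ p = b.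
  move=> b0; exists (b `^ p^-1); first by rewrite powR_gt0.
  by rewrite powRVK// ltW.
have [_ _ MZ _] := pspace_quasi_norm.
have [f Xf cvg_f] : exists2 f, X f &
    (fun n => N (spow p^-1 (u n) - f)) @ \oo --> (0 : R).
  apply: (qbfs_complete H) => // e e0.
  have e'0 : 0 < (e / 2) `^ p / A by rewrite divr_gt0// powR_gt0// divr_gt0.
  have [n0 n0P] := cauchy _ e'0; exists n0 => m n n0m n0n.
  have := n0P m n n0m n0n; rewrite ltr_pdivlMr// => Mmn {e'0 n0P}.
  have Xd := fsB H (Xu m) (Xu n).
  have Yd : Y (u m - u n) by apply: pspaceD => //; rewrite -scaleN1r; exact: pspaceZ.
  have : N (spow p^-1 (u m) - spow p^-1 (u n)) `^ p <= A * M (u m - u n).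
    have := MZ A _ Yd; rewrite (gtr0_norm A0) => <-.
    rewrite -(pnorm_spow Xd).
    apply: (pspace_le (pspace_spow Xd) (pspaceZ A Yd)).
    apply: aeW => t; rewrite norm_spow//.
    apply: le_trans (AP (u m t) (u n t)) _.
    by rewrite !fctE normrM (gtr0_norm A0).
  rewrite mulrC => /le_lt_trans /(_ Mmn) lt_e.
  apply: (@le_lt_trans _ _ (e / 2)); last by lra.
  rewrite -[leLHS](powRKV p_neq0); last exact: (fn_ge0 H Xd).
  rewrite -[leRHS](powRKV p_neq0); last by rewrite divr_ge0// ltW.
  by apply: powR_monotone => //; [exact: powR_ge0|exact: ltW].
exists (spow p f); first exact: pspace_spow.
have Yf := pspace_spow Xf.
have [K K0 KP] := pnorm_quasi.
have Yabs h : Y h -> Y (fun t => `|h t|) /\ M (fun t => `|h t|) = M h.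
  move=> [mh Xh]; have eqh : (fun t => `| `|h t| | `^ p^-1) = fun t => `|h t| `^ p^-1.
    by apply/funext => t; rewrite normr_id.
  by rewrite /pnorm /= eqh; split => //; split; [exact: meas_norm|rewrite eqh].
suff lim (e : R) : 0 < e ->
    exists n0 : nat, forall n, (n0 <= n)%N -> M (u n - spow p f) < e.
  apply/cvgrPdist_lt => e /lim [n0 n0P]; exists n0 => // n /n0P.
  by rewrite sub0r normrN ger0_norm// powR_ge0.
move=> e0; have e2_gt0 : 0 < e / 2 by rewrite divr_gt0.
have [m m0 mE] : exists2 m : R, 0 <= m & M (spow p f) = m.
  by exists (M (spow p f)) => //; exact: powR_ge0.
pose B : R := K * m + 1.
have KM0 : 0 <= K * m by rewrite mulr_ge0.
have B0 : 0 < B by rewrite ltr_wpDl.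
have eta0 : 0 < e / 2 / B by exact: divr_gt0.
have [C C0 CP] := signed_power_continuous p1 eta0.
have step n : M (u n - spow p f) <=
    e / 2 + K * C * N (spow p^-1 (u n) - f) `^ p.
  have Xd : X (spow p^-1 (u n) - f) by exact: (fsB H).
  have Yd : Y (u n - spow p f).
    by apply: pspaceD => //; rewrite -scaleN1r; exact: pspaceZ.
  rewrite -(pnorm_spow Xd).
  have [Ya Ma] := Yabs _ Yf; have [Yb Mb] := Yabs _ (pspace_spow Xd).
  have Y1 := pspaceZ (e / 2 / B) Ya; have Y2 := pspaceZ C Yb.
  apply: (@le_trans _ _ (M ((e / 2 / B) *: (fun t => `|spow p f t|) +
      C *: (fun t => `|spow p (spow p^-1 (u n) - f) t|)))).
    apply: (pspace_le Yd (pspaceD Y1 Y2)).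
    apply: aeW => t; apply: le_trans (ler_norm _).
    have nf := norm_spow f t p_neq0.
    have nd := norm_spow (spow p^-1 (u n) - f) t p_neq0.
    change (`|u n t - spow p f t| <= e / 2 / B * `|spow p f t| +
      C * `|spow p (spow p^-1 (u n) - f) t|); rewrite {}nf {}nd.
    have := CP (f t) (spow p^-1 (u n) t).
    change (`|spow p f t - spow p (spow p^-1 (u n)) t| <= e / 2 / B * `|f t| `^ p +
      C * `|f t - spow p^-1 (u n) t| `^ p -> `|u n t - spow p f t| <=
      e / 2 / B * `|f t| `^ p + C * `|spow p^-1 (u n) t - f t| `^ p).
    by rewrite spowVK (distrC (spow p f t)) (distrC (f t)).
  apply: le_trans (KP _ _ Y1 Y2) _; rewrite (MZ _ _ Ya) (MZ _ _ Yb) Ma Mb mE (gtr0_norm eta0) (ger0_norm C0).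
  rewrite mulrDr [X in _ + X]mulrA lerD2r.
  have -> : K * (e / 2 / B * m) = e / 2 * (K * m / B).
    by field; rewrite gt_eqF.
  apply: ler_piMr; first exact: ltW.
  rewrite (ler_pdivrMr _ _ B0) mul1r /B lerDl; exact: ler01.
have KC0 : 0 <= K * C by exact: mulr_ge0.
pose D : R := K * C + 1; have D0 : 0 < D by exact: (ltr_wpDl KC0 ltr01).
have [e' e'0 e'P] : exists2 r : R, 0 < r & r `^ p = e / 2 / D.
  exact: (root_pos _ (divr_gt0 e2_gt0 D0)).
have near_e' := (cvgrPdist_lt _ _).1 cvg_f e' e'0.
case: near_e' => n0 _ n0P; exists n0 => n /n0P /=.
have Nn := fn_ge0 H (fsB H (Xu n) Xf).
rewrite sub0r normrN ger0_norm// => lt_e'.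
have {}lt_e' : N (spow p^-1 (u n) - f) `^ p <= e / 2 / D.
  by rewrite -e'P; apply: powR_monotone Nn (ltW lt_e'); exact: ltW.
apply: le_lt_trans (step n) _.
apply: (@le_lt_trans _ _ (e / 2 + K * C * (e / 2 / D))).
  by rewrite lerD2l; exact: ler_wpM2l.
have -> : K * C * (e / 2 / D) = e / 2 * (K * C / D) by field; rewrite gt_eqF.
suff : e / 2 * (K * C / D) < e / 2 by lra.
rewrite (gtr_pMr _ e2_gt0) (ltr_pdivrMr _ _ D0) mul1r /D ltrDl; exact: ltr01.
Qed.

Lemma pspace_qbfs : quasi_banach_function_space mu Y M.
Proof.
split.
- exact: pspace_subspace.
- have [f Xf fN0] := qbfs_nonzero H; exists (spow p f); first exact: pspace_spow.
  move=> f0; apply: fN0; apply: filterS f0 => t /(_ I) ft _.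
  apply/eqP; rewrite -normr_eq0; apply/eqP/(powR_eq0_eq0 (p := p)).
  by rewrite -norm_spow// ft normr0.
- move=> f g [mg Xg] mf fg; split => //; apply: (qbfs_ideal H Xg).
    exact: measurable_norm_powR.
  apply: filterS fg => t fg; rewrite [leLHS]ger0_norm ?powR_ge0// [leRHS]ger0_norm ?powR_ge0//; exact: powR_monotone.
- exact: pspace_quasi_norm.
- by move=> f g Yf Yg; exact: pspace_le.
- exact: pspace_complete.
- move=> A mA muA; split; first exact: measurable_indic.
  have -> : (fun t => `|\1_A t| `^ p^-1) = \1_A :> (T -> R).
    apply/funext => t; rewrite indicE; case: (_ \in _) => /=.
      by rewrite normr1 powR1.
    by rewrite normr0 powR0.
  exact: (qbfs_indic H).
Qed.

End PowerSpace.

(** * Convexity and concavity in terms of the p-th power *)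

Lemma sum_ord2 (V : nmodType) (F : 'I_2 -> V) :
  \sum_i F i = F ord0 + F (lift ord0 ord0).
Proof. by rewrite !big_ord_recl big_ord0 addr0. Qed.

Section PowerTranslation.
Context (R : realType) (d : measure_display) (T : measurableType d).
Context (mu : {measure set T -> \bar R}) (p : R).
Context (X : set (T -> R)) (N : (T -> R) -> R).
Hypothesis p1 : 1 <= p.
Hypothesis H : quasi_banach_function_space mu X N.
Implicit Types (f g h k u v w : T -> R) (c r : R).

Local Notation "f =ae g" := (ae_eq mu [set: T] f g) (at level 70).
Local Notation Y := (pspace p X).
Local Notation M := (pnorm p N).

Let HY : quasi_banach_function_space mu Y M.
Proof. exact: pspace_qbfs. Qed.
Let p_gt0 : 0 < p. Proof. exact: lt_le_trans p1. Qed.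
Let p_neq0 : p != 0. Proof. by rewrite gt_eqF. Qed.
Let pV_neq0 : p^-1 != 0. Proof. by rewrite invr_eq0. Qed.
Let pV_gt0 : 0 < p^-1. Proof. by rewrite invr_gt0. Qed.

Let abs_power f t : `|f t| `^ p = `|spow p f t|.
Proof. by rewrite norm_spow. Qed.

Lemma pspace_abs_power f : X f -> Y (fun t => `|f t| `^ p).
Proof.
move=> Xf; have -> : (fun t => `|f t| `^ p) = fun t => `|spow p f t|.
  by apply/funext => t; rewrite abs_power.
exact: (fs_norm HY (pspace_spow p1 H Xf)).
Qed.

Lemma pnorm_abs_power f : X f -> M (fun t => `|f t| `^ p) = N f `^ p.
Proof.
move=> Xf; have -> : (fun t => `|f t| `^ p) = fun t => `|spow p f t|.
  by apply/funext => t; rewrite abs_power.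
by rewrite (fn_norm HY (pspace_spow p1 H Xf)) (pnorm_spow p1 H).
Qed.

Lemma norm_root_nonneg w : Y w -> (forall t, 0 <= w t) ->
  N (fun t => w t `^ p^-1) = M w `^ p^-1.
Proof.
move=> Yw w0; rewrite -(norm_abs_root p1 H Yw); congr N.
by apply/funext => t; rewrite ger0_norm.
Qed.

Lemma norm_root_sum (n : nat) (w : 'I_n -> T -> R) : (forall i, Y (w i)) ->
  (forall i t, 0 <= w i t) ->
  N (fun t => (\sum_i w i t) `^ p^-1) = M (\sum_i w i) `^ p^-1.
Proof.
move=> Yw w0.
have -> : (fun t => (\sum_i w i t) `^ p^-1) = fun t => ((\sum_i w i) t) `^ p^-1.
  by apply/funext => t; rewrite fct_sumE.
apply: norm_root_nonneg; first by apply: (fs_sum HY).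
by move=> t; rewrite fct_sumE sumr_ge0.
Qed.

Let two_roots (u v : T -> R) (i : 'I_2) : T -> R :=
  if i == ord0 then spow p^-1 u else spow p^-1 v.

Let two_rootsX u v i : Y u -> Y v -> X (two_roots u v i).
Proof. by move=> Yu Yv; rewrite /two_roots; case: ifP => _; exact: (pspace_root p1 H). Qed.

Let norm_two_roots u v : Y u -> Y v ->
  N (fun t => (\sum_i `|two_roots u v i t| `^ p) `^ p^-1)
    = M (fun t => `|u t| + `|v t|) `^ p^-1.
Proof.
move=> Yu Yv; have Yuv : Y (fun t => `|u t| + `|v t|).
  exact: (fsD HY (fs_norm HY Yu) (fs_norm HY Yv)).
rewrite -norm_root_nonneg//; congr N; apply/funext => t.
by rewrite sum_ord2 /two_roots /= !norm_spow// !powRVK.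
Qed.

Let sum_two_roots u v : Y u -> Y v ->
  \sum_i N (two_roots u v i) `^ p = M u + M v.
Proof.
by move=> Yu Yv; rewrite sum_ord2 /two_roots /= -!(pnorm_root p1 H).
Qed.

Let powRV_le (a b : R) : 0 <= a -> 0 <= b -> a `^ p^-1 <= b `^ p^-1 -> a <= b.
Proof.
move=> a0 b0 ab; rewrite -(powRVK p_neq0 a0) -(powRVK p_neq0 b0).
by apply: powR_monotone => //; [exact: ltW|exact: powR_ge0].
Qed.

Let abs_sum u v : Y u -> Y v -> Y (fun t => `|u t| + `|v t|).
Proof. by move=> Yu Yv; exact: (fsD HY (fs_norm HY Yu) (fs_norm HY Yv)). Qed.

(** Signed roots turn u and v into a pair of elements of X whose p-th powers add
    up to |u| + |v|; conversely the triangle inequality for |x_i|^p is the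
    convexity inequality. *)
Lemma p_convex1P : p_convex1 p X N <-> subadditive Y M.
Proof.
split=> [conv u v Yu Yv|sub n x Xx].
  have := conv 2 _ (fun i => two_rootsX i Yu Yv).
  rewrite norm_two_roots// sum_two_roots// => /powRV_le le_uv.
  apply: (@le_trans _ _ (M (fun t => `|u t| + `|v t|))); last first.
    by apply: le_uv; [|apply: addr_ge0]; apply: (fn_ge0 HY) => //; exact: abs_sum.
  apply: (fn_le HY) => [||t]; [exact: (fsD HY)|exact: abs_sum|].
  by rewrite [leRHS]ger0_norm ?addr_ge0//; exact: ler_normD.
pose z (i : 'I_n) : T -> R := fun t => `|x i t| `^ p.
have Yz i : Y (z i) by exact: pspace_abs_power.
have z0 i t : 0 <= z i t by exact: powR_ge0.
rewrite (norm_root_sum Yz z0).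
apply: powR_monotone; [exact: ltW| |].
  by apply: (fn_ge0 HY); exact: (fs_sum HY).
suff [_] : Y (\sum_i z i) /\ M (\sum_i z i) <= \sum_i N (x i) `^ p by [].
apply: (big_ind2 (fun w a => Y w /\ M w <= a)).
- by split; [exact: (fs0 HY)|have := fn0 HY; rewrite /cst /= => ->].
- move=> w a w' a' [Yw Mw] [Yw' Mw']; split; first exact: (fsD HY).
  by apply: le_trans (sub _ _ Yw Yw') _; exact: lerD.
- by move=> i _; split => //; rewrite /z pnorm_abs_power.
Qed.

Lemma p_concave1_superadditive : p_concave1 p X N ->
  forall u v, Y u -> Y v -> (forall t, 0 <= u t) -> (forall t, 0 <= v t) ->
  M u + M v <= M (u + v).
Proof.
move=> conc u v Yu Yv u0 v0.
have := conc 2 _ (fun i => two_rootsX i Yu Yv).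
rewrite norm_two_roots// sum_two_roots// => /powRV_le.
have -> : (fun t => `|u t| + `|v t|) = u + v.
  by apply/funext => t; rewrite !ger0_norm.
by apply; [apply: addr_ge0|]; apply: (fn_ge0 HY) => //; exact: (fsD HY).
Qed.

Lemma additive_on_cone_p_concave1 : additive_on_cone Y M -> p_concave1 p X N.
Proof.
move=> AL n x Xx.
pose z (i : 'I_n) : T -> R := fun t => `|x i t| `^ p.
have Yz i : Y (z i) by exact: pspace_abs_power.
have z0 i t : 0 <= z i t by exact: powR_ge0.
rewrite (norm_root_sum Yz z0) (al_sum HY AL); [|exact: Yz|exact: z0].
by under eq_bigr do rewrite -pnorm_abs_power//.
Qed.

Lemma additive_on_coneP : additive_on_cone Y M <->
  p_convex1 p X N /\ p_concave1 p X N.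
Proof.
split=> [AL|[/p_convex1P sub /p_concave1_superadditive sup] u v Yu Yv u0 v0].
  split; last exact: additive_on_cone_p_concave1.
  by apply/p_convex1P; exact: (al_subadditive HY).
by apply/eqP; rewrite eq_le sub//= sup.
Qed.

(** For N x = a and N y = b the function x + y is dominated pointwise by the
    p-th root of the convex combination of |x / a|^p and |y / b|^p with weights
    a / (a + b) and b / (a + b), up to the factor a + b. *)
Lemma p_convex1_subadditive : p_convex1 p X N -> subadditive X N.
Proof.
move=> conv f g Xf Xg.
have [/(fn_eq0 H Xf) f0|Nf0] := eqVneq (N f) 0.
  have -> : N (f + g) = N g.
    apply: (fn_ae H); [exact: (fsD H)|by []|].
    by apply: filterS f0 => t /(_ I) h _; rewrite !fctE h add0r.
  by rewrite lerDr (fn_ge0 H).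
have [/(fn_eq0 H Xg) g0|Ng0] := eqVneq (N g) 0.
  have -> : N (f + g) = N f.
    apply: (fn_ae H); [exact: (fsD H)|by []|].
    by apply: filterS g0 => t /(_ I) h _; rewrite !fctE h addr0.
  by rewrite lerDl (fn_ge0 H).
have a0 : 0 < N f by rewrite lt_neqAle eq_sym Nf0 (fn_ge0 H).
have b0 : 0 < N g by rewrite lt_neqAle eq_sym Ng0 (fn_ge0 H).
have [a Na] : exists a, N f = a by exists (N f).
have [b Nb] : exists b, N g = b by exists (N g).
rewrite Na in a0; rewrite Nb in b0; rewrite Na Nb.
have ab0 : 0 < a + b by exact: addr_gt0.
pose s : R := a / (a + b); pose r : R := b / (a + b).
have s0 : 0 < s by exact: divr_gt0.
have r0 : 0 < r by exact: divr_gt0.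
have sr : s + r = 1 by rewrite -mulrDl divff// gt_eqF.
have scaled (z c : R) : 0 < c -> 0 <= z -> (c `^ p^-1 / c * z) `^ p = c * (z / c) `^ p.
  move=> c0 z0; have -> : c `^ p^-1 / c * z = c `^ p^-1 * (z / c) by ring.
  by rewrite powRM ?powR_ge0 ?divr_ge0 ?(ltW c0)// powRVK// ltW.
pose x (i : 'I_2) : T -> R :=
  if i == ord0 then (s `^ p^-1 / s) *: f else (r `^ p^-1 / r) *: g.
have coef (c : R) : 0 < c -> 0 <= c `^ p^-1 / c.
  by move=> c0; rewrite divr_ge0 ?powR_ge0// ltW.
have Xx i : X (x i) by rewrite /x; case: ifP => _; exact: (fsZ H).
have := conv 2 x Xx; rewrite (norm_root_sum (w := fun i t => `|x i t| `^ p)); last 2 first.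
- by move=> i; exact: pspace_abs_power.
- by move=> i t; exact: powR_ge0.
rewrite !sum_ord2 /x /= !(fnZ H)//.
rewrite (ger0_norm (coef _ s0)) (ger0_norm (coef _ r0)) Na Nb.
rewrite (scaled _ _ s0 (ltW a0)) (scaled _ _ r0 (ltW b0)).
have -> : a / s = a + b by rewrite /s; field; rewrite !gt_eqF.
have -> : b / r = a + b by rewrite /r; field; rewrite !gt_eqF.
rewrite -mulrDl sr mul1r powRKV ?(ltW ab0)//.
apply: le_trans.
set w := (X in M X); have Yw : Y w.
  by apply: (fsD HY); apply: pspace_abs_power; exact: (fsZ H).
have w0 t : 0 <= w t by rewrite addr_ge0// powR_ge0.
rewrite -(norm_root_nonneg Yw w0); apply: (fn_le H) => [||t].
- exact: (fsD H).
- have := pspace_norm Yw; congr X; apply/funext => t.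
  by rewrite ger0_norm.
rewrite [leRHS]ger0_norm ?powR_ge0//.
apply: le_trans (ler_normD _ _) _.
rewrite -[leLHS](powRKV p_neq0) ?addr_ge0//.
apply: powR_monotone; [exact: ltW|exact: powR_ge0|].
apply: le_trans (powR_split p1 s0 r0 sr (normr_ge0 _) (normr_ge0 _)) _.
have absZ (c : R) h : 0 < c ->
    `|((c `^ p^-1 / c) *: h) t| = c `^ p^-1 / c * `|h t|.
  by move=> c0; rewrite [LHS]normrM ger0_norm ?coef.
rewrite /w addrfctE (absZ _ _ s0) (absZ _ _ r0).
by rewrite (scaled _ _ s0 (normr_ge0 _)) (scaled _ _ r0 (normr_ge0 _)).
Qed.

Lemma sup_norm_root (F G : (T -> R) -> T -> R) : (forall h, Y h -> Y (F h)) ->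
  (forall f, X f -> N (G f) = M (F (spow p f)) `^ p^-1) ->
  sup_norm X N G = sup_norm Y M F `^ p^-1.
Proof.
move=> YF NG; rewrite /sup_norm -sup_powR//; last first.
  by move=> _ [h [Yh _] <-]; apply: (fn_ge0 HY); exact: YF.
congr sup; apply/seteqP; split.
  move=> _ [f [Xf Nf] <-]; exists (M (F (spow p f))); last by rewrite NG.
  exists (spow p f) => //.
  by split; [exact: (pspace_spow p1 H)|exact: (spow_ball p1 H)].
move=> _ [_ [h [Yh Mh] <-] <-]; exists (spow p^-1 h).
  by split; [exact: (pspace_root p1 H)|exact: (root_ball p1 H)].
by rewrite NG ?(spowVK p1)//; exact: (pspace_root p1 H).
Qed.

Lemma sup_norm_ge0 (F : (T -> R) -> T -> R) : (forall h, Y h -> Y (F h)) ->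
  0 <= sup_norm Y M F.
Proof.
move=> YF; rewrite /sup_norm; have [hS|/sup_out ->//] := pselect
  (has_sup [set M (F h) | h in closed_ball_of Y M]).
have Y0 := fs0 HY; have FY0 : Y (F (cst 0)) by exact: YF.
apply: le_trans (fn_ge0 HY FY0) _; apply: ub_le_sup; first exact: hS.2.
by exists (cst 0) => //; split => //; rewrite (fn0 HY).
Qed.

Lemma sup_norm_convexification (S : (T -> R) -> T -> R) :
  (forall h, Y h -> Y (S h)) ->
  sup_norm X N (convexification p S) = sup_norm Y M S `^ p^-1.
Proof.
move=> YS; apply: sup_norm_root => // f Xf.
by rewrite (norm_root p1 H)//; apply: YS; exact: (pspace_spow p1 H).
Qed.

(** The p-th root is monotone, so it commutes with the suprema over the unit
    balls, which correspond to each other under signed powers. *)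
Lemma p_daugavet_equationP (S : (T -> R) -> T -> R) :
  (forall h, Y h -> Y (S h)) ->
  p_daugavet_equation p X N S <->
  sup_norm Y M (fun h => h + S h) = 1 + sup_norm Y M S.
Proof.
move=> YS; have YIS h : Y h -> Y (h + S h) by move=> Yh; apply: (fsD HY) => //; exact: YS.
have S0 := sup_norm_ge0 YS; have IS0 := sup_norm_ge0 YIS.
rewrite /p_daugavet_equation sup_norm_convexification// powRVK//.
rewrite (sup_norm_root YIS); last first.
  move=> f Xf; rewrite -(norm_abs_root p1 H); last first.
    by apply: YIS; exact: (pspace_spow p1 H).
  by congr N; apply/funext => t; rewrite /convexification (spowVK p1).
split=> [E|-> //]; apply: (powR_injective pV_gt0 _ _ E); rewrite nnegrE.
  exact: IS0.
exact: (addr_ge0 ler01 S0).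
Qed.

End PowerTranslation.

(** * Rank-one operators *)

Section RankOne.
Context (R : realType) (d : measure_display) (T : measurableType d).
Context (mu : {measure set T -> \bar R}).
Context (Y : set (T -> R)) (M : (T -> R) -> R).
Hypothesis H : quasi_banach_function_space mu Y M.
Implicit Types (f g h k u v w : T -> R) (c : R).

Local Notation "f =ae g" := (ae_eq mu [set: T] f g) (at level 70).

Lemma sup_norm_le (F : (T -> R) -> T -> R) C :
  (forall h, Y h -> M h <= 1 -> M (F h) <= C) -> sup_norm Y M F <= C.
Proof.
move=> FC; apply: ge_sup => [|_ [h [Yh Mh] <-]]; last exact: FC.
by exists (M (F (cst 0))), (cst 0) => //; split; [exact: (fs0 H)|rewrite (fn0 H)].
Qed.

Lemma le_sup_norm (F : (T -> R) -> T -> R) C h :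
  (forall h, Y h -> M h <= 1 -> M (F h) <= C) ->
  Y h -> M h <= 1 -> M (F h) <= sup_norm Y M F.
Proof.
move=> FC Yh Mh; apply: ub_le_sup; last by exists h.
by exists C => _ [k [Yk Mk] <-]; exact: FC.
Qed.

Lemma eq_sup_norm (F G : (T -> R) -> T -> R) :
  (forall h, Y h -> M (F h) = M (G h)) -> sup_norm Y M F = sup_norm Y M G.
Proof.
move=> FG; congr sup; apply/seteqP; split => _ [h [Yh Mh] <-];
  by exists h => //; rewrite FG.
Qed.

Lemma operator_bounded S : operator mu Y M S -> exists C : R,
  forall h, Y h -> M (S h) <= C * M h.
Proof.
move=> opS; have YS := operator_stable opS; have Y0 := fs0 H.
have S0 : S (cst 0) =ae cst 0.
  have := operator_linear opS 1 Y0 Y0.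
  have -> : 1 *: cst 0 + cst 0 = cst 0 :> (T -> R) by rewrite scale1r; exact: addr0.
  apply: filterS => t /(_ I); rewrite scale1r addrfctE => h _ /=.
  by move: h; move: (S (cst 0) t) => a; lra.
have SZ c h : Y h -> M (S (c *: h)) = `|c| * M (S h).
  move=> Yh; rewrite -(fnZ H); last exact: YS.
  apply: (fn_ae H); [exact/YS/(fsZ H)|exact/(fsZ H)/YS|].
  have := operator_linear opS c Yh Y0.
  have -> : c *: h + cst 0 = c *: h by exact: addr0.
  apply: filterS2 S0 => t /(_ I) h0 /(_ I) h1 _.
  by rewrite h1 addrfctE h0; exact: addr0.
have [r r0 rP] := operator_continuous opS Y0 (@ltr01 R).
exists (2 / r) => h Yh; have [Mh0|Mh0] := eqVneq (M h) 0.
  rewrite Mh0 mulr0 (fn_ae0 H)//; first exact: YS.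
  apply: filterS2 S0 (operator_ae opS Yh Y0 (fn_eq0 H Yh Mh0)).
  by move=> t /(_ I) h0 /(_ I) h1 _; rewrite h1.
have Mh_gt0 : 0 < M h by rewrite lt_neqAle eq_sym Mh0 (fn_ge0 H).
pose c : R := r / 2 / M h; have c0 : 0 < c by rewrite !divr_gt0.
have := rP (c *: h) (fsZ H c Yh).
have -> : c *: h - cst 0 = c *: h by exact: subr0.
have -> : M (S (c *: h) - S (cst 0)) = M (S (c *: h)).
  apply: (fn_ae H).
  - by apply: (fsB H); [exact/YS/(fsZ H)|exact: YS].
  - exact/YS/(fsZ H).
  - by apply: filterS S0 => t /(_ I) h0 _; rewrite addrfctE opprfctE h0; exact: subr0.
rewrite SZ// (fnZ H)// gtr0_norm//.
have -> : c * M h = r / 2 by rewrite /c divfK.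
have r2 : r / 2 < r by lra.
move=> /(_ r2) lt1; have -> : 2 / r * M h = c^-1 by rewrite /c; field; rewrite !gt_eqF.
by rewrite -[leRHS]mul1r ler_pdivlMr// mulrC ltW.
Qed.

(** Since y does not vanish, the scalar factor of S h along y is determined by h;
    hence it inherits linearity and boundedness from S. *)
Lemma rank_oneP S : rank_one_operator mu Y M S ->
  exists phi y, [/\ functional mu Y M phi, 0 < dual_norm Y M phi,
    Y y, ~ (y =ae cst 0) & forall h, Y h -> S h =ae phi h *: y].
Proof.
move=> [opS [h0 Yh0 Sh0] [y Yy Sy]]; have YS := operator_stable opS.
have yN0 : ~ (y =ae cst 0).
  move=> y0; apply: Sh0; have [c Sc] := Sy h0 Yh0.
  apply: filterS2 Sc y0 => t /(_ I) -> /(_ I) y0 _.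
  by change (c * y t = 0); rewrite y0 mulr0.
have My := fn_gt0 H Yy yN0.
have /choice[phi phiP] : forall h, exists c, Y h -> S h =ae c *: y.
  move=> h; have [Yh|nYh] := pselect (Y h); last by exists 0.
  by have [c Sc] := Sy h Yh; exists c.
have uniq (a b : R) : a *: y =ae b *: y -> a = b.
  move=> ab; apply/eqP; rewrite -subr_eq0 -normr_eq0.
  have : `|a - b| * M y = 0.
    rewrite -(fnZ H)//; apply: (fn_ae0 H); first exact: (fsZ H).
    apply: filterS ab => t /(_ I); change (a * y t = b * y t ->
      True -> (a - b) * y t = 0) => ab _; rewrite mulrBl ab; exact: subrr.
  by move=> /eqP; rewrite mulf_eq0 (gt_eqF My) orbF.
have [C CP] := operator_bounded opS.
have MS h : Y h -> M (S h) = `|phi h| * M y.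
  move=> Yh; rewrite -(fnZ H)//; apply: (fn_ae H); [exact: YS|exact: (fsZ H)|].
  exact: phiP.
have phiF : functional mu Y M phi.
  apply: (@functional_of_bounded _ _ _ _ _ _ H _ (C / M y)).
    move=> c h k Yh Yk; apply: uniq.
    have Ylin := fs_lin H c Yh Yk.
    apply: filterS3 (phiP _ Ylin) (filterI (phiP _ Yh) (phiP _ Yk))
      (operator_linear opS c Yh Yk).
    move=> t /(_ I) e1 [/(_ I) e2 /(_ I) e3] /(_ I) e4 _.
    rewrite -e1 e4; change (c * S h t + S k t = (c * phi h + phi k) * y t).
    by rewrite e2 e3; change (c * (phi h * y t) + phi k * y t = (c * phi h + phi k) * y t); ring.
  by move=> h Yh; rewrite mulrAC ler_pdivlMr// -MS// CP.
exists phi, y; split => //.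
rewrite lt_neqAle eq_sym (dual_norm_ge0 H phiF) andbT; apply/eqP => L0.
apply: Sh0; have := dual_normP H phiF Yh0.
rewrite L0 mul0r normr_le0 => /eqP phi0.
apply: filterS (phiP _ Yh0) => t /(_ I) -> _; rewrite phi0.
by change (0 * y t = 0); rewrite mul0r.
Qed.

Lemma rank_one_tensor phi y : functional mu Y M phi ->
  0 < dual_norm Y M phi -> Y y -> ~ (y =ae cst 0) ->
  rank_one_operator mu Y M (fun h => phi h *: y).
Proof.
move=> phiF L0 Yy yN0.
have My := fn_gt0 H Yy yN0; split.
- split.
  + by move=> h Yh; exact: (fsZ H).
  + by move=> h k Yh Yk hk; rewrite (functional_ae phiF Yh Yk hk); exact: ae_eq_refl.
  + move=> c h k Yh Yk; apply: aeW => t _.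
    rewrite (functional_linear phiF c Yh Yk).
    by change ((c * phi h + phi k) * y t = c * (phi h * y t) + phi k * y t); ring.
  + move=> h Yh e e0.
    have [r r0 rP] := functional_continuous phiF Yh (divr_gt0 e0 My).
    exists r => // k Yk /(rP _ Yk); rewrite ltr_pdivlMr// => lt_e.
    by rewrite -scalerBl (fnZ H).
- have [h [Yh _ phih]] := dual_norm_lt H phiF L0; exists h => // h0.
  have := fn_ae0 H (fsZ H (phi h) Yy) h0; rewrite (fnZ H)// gtr0_norm//.
  by move=> /eqP; rewrite mulf_eq0 !gt_eqF.
- by exists y => // h Yh; exists (phi h); exact: ae_eq_refl.
Qed.

Lemma sup_norm_tensor phi y : functional mu Y M phi -> Y y ->
  sup_norm Y M (fun h => phi h *: y) = dual_norm Y M phi * M y.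
Proof.
move=> phiF Yy.
have bound h : Y h -> M h <= 1 -> M (phi h *: y) <= dual_norm Y M phi * M y.
  move=> Yh Mh; rewrite (fnZ H)// ler_wpM2r ?(fn_ge0 H)//.
  apply: le_trans (dual_normP H phiF Yh) _.
  by rewrite ler_piMr// (dual_norm_ge0 H phiF).
apply/eqP; rewrite eq_le sup_norm_le//=.
have [->|My0] := eqVneq (M y) 0.
  rewrite mulr0; apply: le_trans (fn_ge0 H (fsZ H (phi (cst 0)) Yy)) _.
  by apply: (le_sup_norm bound); [exact: (fs0 H)|rewrite (fn0 H)].
have My : 0 < M y by rewrite lt_neqAle eq_sym My0 (fn_ge0 H).
rewrite -ler_pdivlMr//; apply: (dual_norm_le H phiF) => h Yh Mh.
by rewrite ler_pdivlMr// -(fnZ H)//; exact: (le_sup_norm bound).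
Qed.

Definition daugavet_equation : Prop :=
  forall S, rank_one_operator mu Y M S ->
    sup_norm Y M (fun h => h + S h) = 1 + sup_norm Y M S.

(** Shvydkoy's slice characterization, in the direction that needs no duality:
    on a slice where phi is almost maximal, h + phi h y is close to h + L y. *)
Lemma daugavet_of_slices : subadditive Y M ->
  (forall phi, dual_sphere mu Y M phi -> forall y, Y y -> forall e : R, 0 < e ->
    exists h, [/\ Y h, M h <= 1, 1 - e <= phi h &
      (1 - e) * (M h + M y) <= M (h + y)]) ->
  daugavet_equation.
Proof.
move=> sub slices S rS; have [opS _ _] := rS; have YS := operator_stable opS.
have [phi [y [phiF L0 Yy yN0 Sphi]]] := rank_oneP rS.
have Yphi h : Y (phi h *: y) by exact: (fsZ H).
have -> : sup_norm Y M S = sup_norm Y M (fun h => phi h *: y).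
  by apply: eq_sup_norm => h Yh; apply: (fn_ae H); [exact: YS|exact: Yphi|exact: Sphi].
have -> : sup_norm Y M (fun h => h + S h) = sup_norm Y M (fun h => h + phi h *: y).
  apply: eq_sup_norm => h Yh; apply: (fn_ae H).
  - by apply: (fsD H) => //; exact: YS.
  - by apply: (fsD H) => //; exact: Yphi.
  - by apply: filterS (Sphi h Yh) => t /(_ I) Sh _; rewrite !addrfctE Sh.
rewrite sup_norm_tensor//; have [L LE] : exists L, dual_norm Y M phi = L by exists (dual_norm Y M phi).
rewrite LE in L0 *; have My := fn_ge0 H Yy.
have [K KE] : exists K, L * M y = K by exists (L * M y).
have K0 : 0 <= K by rewrite -KE; exact: mulr_ge0 (ltW L0) My.
have phi_le h : Y h -> `|phi h| <= L * M h by rewrite -LE; exact: (dual_normP H phiF).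
have bound h : Y h -> M h <= 1 -> M (h + phi h *: y) <= 1 + K.
  move=> Yh Mh; apply: le_trans (sub _ _ Yh (Yphi h)) _; apply: lerD => //.
  rewrite (fnZ H)// -KE; apply: ler_wpM2r => //.
  by apply: le_trans (phi_le h Yh) _; rewrite ler_piMr// ltW.
rewrite KE; apply/eqP; rewrite eq_le sup_norm_le//=.
suff approx (e : R) : 0 < e -> 1 + K <= sup_norm Y M (fun h => h + phi h *: y)
    + e * (2 + 2 * K).
  suff le_e (e : R) : 0 < e -> 1 + K <= sup_norm Y M (fun h => h + phi h *: y) + e.
    by apply/ler_addgt0Pr; exact: le_e.
  move=> e0; have K2 : 0 < 2 + 2 * K by lra.
  by have := approx (e / (2 + 2 * K)) (divr_gt0 e0 K2); rewrite divfK ?gt_eqF.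
move=> e0.
have YLy : Y (L *: y) by exact: (fsZ H).
have psiS : dual_sphere mu Y M (fun h => L^-1 * phi h).
  by have := functional_normalize H phiF; rewrite LE; apply.
have [h [Yh Mh psih slice_h]] := slices _ psiS _ YLy _ e0.
have Mhy : M (h + phi h *: y) <= sup_norm Y M (fun h => h + phi h *: y).
  exact: (le_sup_norm bound).
have MLy : M (L *: y) = K by rewrite (fnZ H)// gtr0_norm.
have phih_le : phi h <= L.
  apply: le_trans (ler_norm _) _; apply: le_trans (phi_le h Yh) _.
  by rewrite ler_piMr// ltW.
have phih_ge : L - phi h <= e * L.
  by move: psih; rewrite mulrC ler_pdivlMr//; lra.
have Mh_ge : 1 - e <= M h.
  apply: le_trans psih _; rewrite mulrC ler_pdivrMr// mulrC.
  by apply: le_trans (ler_norm _) _; exact: phi_le.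
have diff : M (h + L *: y) <= M (h + phi h *: y) + e * K.
  have -> : h + L *: y = (h + phi h *: y) + (L - phi h) *: y.
    by rewrite -addrA -scalerDl subrKC.
  apply: le_trans (sub _ _ (fsD H Yh (Yphi h)) (fsZ H (L - phi h) Yy)) _.
  rewrite lerD2l (fnZ H)// ger0_norm ?subr_ge0// -KE mulrA.
  exact: ler_wpM2r.
rewrite MLy in slice_h.
have [e1|e1] := leP e 1; last by have := fn_ge0 H (fsD H Yh (Yphi h)); nra.
by have := fn_ge0 H (fsD H Yh (Yphi h)); nra.
Qed.

End RankOne.

(** * Almost disjoint elements of slices *)

(** This is the link between the Daugavet equation, the slice conditions and the
    absence of atoms: the lattice form of the geometric fact that slices of the
    ball reach far away from any given direction. *)
Definition small_overlap (R : realType) (d : measure_display)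
    (T : measurableType d) (mu : {measure set T -> \bar R}) (Y : set (T -> R))
    (M : (T -> R) -> R) : Prop :=
  forall phi, dual_sphere mu Y M phi -> forall e, Y e ->
  forall delta eps : R, 0 < delta -> 0 < eps ->
  exists h, [/\ Y h, M h <= 1, 1 - delta <= phi h &
    M (fun t => Num.min `|h t| `|e t|) <= eps].

Section DaugavetSlices.
Context (R : realType) (d : measure_display) (T : measurableType d).
Context (mu : {measure set T -> \bar R}).
Context (Y : set (T -> R)) (M : (T -> R) -> R).
Hypothesis H : quasi_banach_function_space mu Y M.
Hypothesis AL : additive_on_cone Y M.
Hypothesis DE : daugavet_equation mu Y M.
Implicit Types (f g h k u v w y : T -> R) (c : R).

Local Notation "f =ae g" := (ae_eq mu [set: T] f g) (at level 70).

(** Let z almost attain the norm of Id + T for T = phi (x) y, and let sigma be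
    a functional norming z + phi(z) y.  The slice wanted is that of the functional
    sigma o (Id + T) = sigma + sigma(y) phi, up to sign: it has norm almost 2,
    so that both terms are almost maximal on it. *)
Lemma nested_slice phi y (e : R) : dual_sphere mu Y M phi -> Y y -> M y = 1 ->
  0 < e -> exists psi, exists2 delta : R, 0 < delta & dual_sphere mu Y M psi /\
    forall h, Y h -> M h <= 1 -> 1 - delta <= psi h ->
      1 - e <= phi h /\ 2 - e <= M (h + y).
Proof.
move=> [phiF phi1] Yy My e0.
have phi_le h : Y h -> `|phi h| <= M h.
  by move=> Yh; have := dual_normP H phiF Yh; rewrite phi1 mul1r.
have yN0 : ~ (y =ae cst 0).
  by move=> /(fn_ae0 H Yy); rewrite My => /eqP; rewrite oner_eq0.
have L0 : 0 < dual_norm Y M phi by rewrite phi1.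
have rS := rank_one_tensor H phiF L0 Yy yN0.
have := DE rS; rewrite (sup_norm_tensor H phiF Yy) phi1 My mul1r => sup2.
have [eta [eta0 eta1 eta_e]] : exists eta : R, [/\ 0 < eta, eta <= 1 / 4 & 4 * eta <= e].
  exists (Num.min (e / 4) (1 / 4)); split.
  - by rewrite lt_min; apply/andP; split; lra.
  - by rewrite ge_min lexx orbT.
  - have : Num.min (e / 4) (1 / 4) <= e / 4 by rewrite ge_min lexx.
    by move: (Num.min _ _) => x; lra.
set A := [set M (h + phi h *: y) | h in closed_ball_of Y M].
have supA : sup A = 2 by rewrite /A; move: sup2; rewrite /sup_norm => ->; lra.
have hA : has_sup A.
  by apply: contrapT => /sup_out; rewrite supA => two0; move: (@ltr0n R 2); rewrite two0 ltxx.
have [_ [z [Yz Mz] <-]] := sup_adherent eta0 hA; rewrite supA => Mw.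
have Yw : Y (z + phi z *: y) by apply: (fsD H) => //; exact: (fsZ H).
have [sigma [sigma_lin sigma_le sigma_w]] := al_norming_functional H AL Yw.
have sigmaF : functional mu Y M sigma.
  apply: (@functional_of_bounded _ _ _ _ _ _ H _ 1); first exact: sigma_lin.
  by move=> h Yh; rewrite mul1r; exact: sigma_le.
have [s sE] : exists s, sigma y = s by exists (sigma y).
have s_le : `|s| <= 1 by rewrite -sE -My sigma_le.
have [c [c1 cs]] : exists c : R, `|c| = 1 /\ c * s = `|s|.
  have [s0|s0] := leP 0 s; first by exists 1; rewrite normr1 mul1r ger0_norm.
  by exists (-1); rewrite normrN1 mulN1r ltr0_norm.
have cc : c * c = 1 by rewrite -expr2 -real_normK ?num_real// c1 expr1n.
pose chi h : R := c * (sigma h + s * phi h).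
have chiF : functional mu Y M chi.
  apply: (@functional_of_bounded _ _ _ _ _ _ H _ 2) => [a h k Yh Yk|h Yh].
    by rewrite /chi sigma_lin// (functional_linear phiF)//; ring.
  rewrite /chi normrM c1 mul1r; apply: le_trans (ler_normD _ _) _.
  rewrite normrM; have := sigma_le h Yh; have := phi_le h Yh.
  by have := normr_ge0 (phi h); nra.
have chi_z : chi (c *: z) = M (z + phi z *: y).
  rewrite -sigma_w /chi (functionalZ H sigmaF c Yz) (functionalZ H phiF c Yz).
  rewrite (functionalD sigmaF)//; last exact: (fsZ H).
  rewrite (functionalZ H sigmaF)// sE.
  have -> : c * (c * sigma z + s * (c * phi z)) = (c * c) * (sigma z + phi z * s) by ring.
  by rewrite cc mul1r.
have norm_chi : 2 - eta < dual_norm Y M chi.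
  apply: lt_le_trans Mw _; rewrite -chi_z; apply: le_trans (ler_norm _) _.
  apply: le_trans (dual_normP H chiF (fsZ H c Yz)) _.
  by rewrite (fnZ H)// c1 mul1r ler_piMr// (dual_norm_ge0 H chiF).
have norm_chi0 : 0 < dual_norm Y M chi by lra.
exists (fun h => (dual_norm Y M chi)^-1 * chi h), (eta / 2); first by lra.
split; first exact: (functional_normalize H chiF norm_chi0).
move=> h Yh Mh; rewrite [leRHS]mulrC ler_pdivlMr// => slice_h.
have chi_h : 2 - 2 * eta <= c * sigma h + `|s| * phi h.
  have -> : c * sigma h + `|s| * phi h = chi h by rewrite /chi -cs; ring.
  by nra.
have sigma_h : c * sigma h <= 1.
  apply: le_trans (ler_norm _) _; rewrite normrM c1 mul1r.
  exact: le_trans (sigma_le h Yh) Mh.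
have phi_h : phi h <= 1.
  by apply: le_trans (ler_norm _) _; exact: le_trans (phi_le h Yh) Mh.
have s0 := normr_ge0 s.
have [phi0|phi0] := leP 0 (phi h); last by exfalso; nra.
split; first by nra.
have : c * sigma (h + y) <= M (h + y).
  apply: le_trans (ler_norm _) _; rewrite normrM c1 mul1r.
  by apply: sigma_le; exact: (fsD H).
rewrite (functionalD sigmaF)// sE mulrDr cs; nra.
Qed.

(** Applied to y and then to - y, the nested slices contain an h with both
    norms of h + y and h - y almost 2, and |h + y| + |h - y| + 2 min(|h|, y)
    = 2 |h| + 2 y. *)
Lemma daugavet_small_overlap : small_overlap mu Y M.
Proof.
move=> phi phiS e Ye delta eps delta0 eps0.
have [[phiF phi1] [m mE]] : dual_sphere mu Y M phi /\ exists m, M e = m.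
  by split => //; exists (M e).
have [m0|mN0] := eqVneq m 0.
  have lt1 : 1 - delta < dual_norm Y M phi by rewrite phi1; lra.
  have [h [Yh Mh phih]] := dual_norm_lt H phiF lt1.
  exists h; split => //; first exact: ltW.
  apply: le_trans (ltW eps0); rewrite -m0 -mE; apply: (fn_le H) => [||t] //.
    exact: (fs_min H).
  by rewrite ger0_norm ?le_min ?normr_ge0// ge_min lexx orbT.
have m_gt0 : 0 < m by rewrite lt_neqAle eq_sym mN0 -mE (fn_ge0 H).
pose y : T -> R := m^-1 *: (fun t => `|e t|).
have Yae := fs_norm H Ye; have Yy : Y y by exact: (fsZ H).
have My : M y = 1.
  by rewrite (fnZ H)// (fn_norm H)// mE gtr0_norm ?invr_gt0// mulVf.
have y0 t : 0 <= y t by apply: mulr_ge0 => //; rewrite invr_ge0 ltW.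
pose b : R := Num.max 1 m; have b1 : 1 <= b by rewrite le_max lexx.
have mb : m <= b by rewrite le_max lexx orbT.
have [r [r0 r_delta r_eps]] : exists r : R, [/\ 0 < r, r <= delta & b * r <= eps].
  exists (Num.min delta (eps / b)).
  have b0 : 0 < b by lra.
  split; first by rewrite lt_min delta0 divr_gt0.
    by rewrite ge_min lexx.
  by rewrite mulrC -ler_pdivlMr// ge_min lexx orbT.
have [psi [delta1 delta10 [psiS psiP]]] := nested_slice phiS Yy My r0.
have [r' [r'0 r'r r'd]] : exists r' : R, [/\ 0 < r', r' <= r & r' <= delta1].
  exists (Num.min r delta1).
  by split; [rewrite lt_min r0|rewrite ge_min lexx|rewrite ge_min lexx orbT].
have MNy : M (- y) = 1 by rewrite (fnN H).
have [psi' [delta2 delta20 [[psi'F psi'1] psi'P]]] :=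
  nested_slice psiS (fsN H Yy) MNy r'0.
have lt1 : 1 - delta2 < dual_norm Y M psi' by rewrite psi'1; lra.
have [h [Yh Mh /ltW psi'h]] := dual_norm_lt H psi'F lt1.
have [psih Mhy'] := psi'P h Yh Mh psi'h.
have [|phih Mhy] := psiP h Yh Mh; first by lra.
exists h; split => //; first by lra.
have Ym := fs_min H Yh Yy.
have m_ge0 t : 0 <= Num.min `|h t| `|y t| by rewrite le_min !normr_ge0.
have overlap_y : M (fun t => Num.min `|h t| `|y t|) <= r.
  have Yp := fs_norm H (fsD H Yh Yy); have Yn := fs_norm H (fsB H Yh Yy).
  have Yah := fs_norm H Yh.
  have : M (fun t => `|(h + y) t|) + M (fun t => `|(h - y) t|) +
      2 * M (fun t => Num.min `|h t| `|y t|) = 2 * M (fun t => `|h t|) + 2 * M y.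
  { rewrite !mulr_natl !mulr2n -!AL//; try by (repeat apply: (fsD H)).
  - congr M; apply/funext => t; rewrite !addrfctE opprfctE (ger0_norm (y0 t)).
    have := y0 t; move: (h t) (y t) => a q q0.
    have [a0|a0] := leP 0 a.
      rewrite (ger0_norm a0) (ger0_norm (addr_ge0 a0 q0)).
      case: (leP a q) => aq; first by rewrite ler0_norm; lra.
      by rewrite ger0_norm; lra.
    rewrite (ltr0_norm a0) (@ltr0_norm _ (a - q)); last by lra.
    case: (leP (- a) q) => aq; first by rewrite ger0_norm; lra.
    by rewrite ler0_norm; lra.
  all: by move=> t; rewrite ?addr_ge0 ?m_ge0. }
  rewrite (fn_norm H (fsD H Yh Yy)) (fn_norm H (fsB H Yh Yy)) (fn_norm H Yh) My.
  by lra.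
apply: le_trans r_eps.
apply: (@le_trans _ _ (M (b *: (fun t => Num.min `|h t| `|y t|)))).
  apply: (fn_le H) => [||t]; [exact: (fs_min H)|exact: (fsZ H)|].
  rewrite ger0_norm ?le_min ?normr_ge0//.
  rewrite [leRHS](_ : _ = b * Num.min `|h t| `|y t|); last first.
    by rewrite [LHS]ger0_norm//; apply: mulr_ge0 => //; lra.
  have ey : `|e t| = m * `|y t|.
    rewrite (ger0_norm (y0 t)) (_ : y t = m^-1 * `|e t|)//.
    by rewrite mulrA divff// mul1r.
  rewrite ey; have := normr_ge0 (h t); have := normr_ge0 (y t).
  case: (leP `|h t| `|y t|) => hy a0 b0; rewrite ge_min; apply/orP.
    by left; nra.
  by right; nra.
rewrite (fnZ H)// ger0_norm; last by lra.
by apply: ler_wpM2l => //; lra.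
Qed.

End DaugavetSlices.

(** * Domination of finite-dimensional subspaces *)

Section FiniteDimensionalDomination.
Context (R : realType) (d : measure_display) (T : measurableType d).
Context (mu : {measure set T -> \bar R}).
Context (X : set (T -> R)) (N : (T -> R) -> R).
Hypothesis H : quasi_banach_function_space mu X N.
Hypothesis sub : subadditive X N.
Implicit Types (f g h : T -> R).

Local Notation "f =ae g" := (ae_eq mu [set: T] f g) (at level 70).

Let comb n (b : 'I_n -> T -> R) (c : 'I_n -> R) : T -> R := \sum_i c i *: b i.

Let combE n (b : 'I_n -> T -> R) c t : comb b c t = \sum_i c i * b i t.
Proof. by rewrite /comb fct_sumE. Qed.

Let combX n (b : 'I_n -> T -> R) c : (forall i, X (b i)) -> X (comb b c).
Proof. by move=> Xb; apply: (fs_sum H) => i _; exact: (fsZ H). Qed.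

Let comb_norm n (b : 'I_n -> T -> R) c : (forall i, X (b i)) ->
  N (comb b c) <= \sum_i `|c i| * N (b i).
Proof.
move=> Xb; suff [_] : X (comb b c) /\ N (comb b c) <= \sum_i `|c i| * N (b i) by [].
apply: (big_ind2 (fun w (a : R) => X w /\ N w <= a)).
- by split; [exact: (fs0 H)|rewrite (fn0 H)].
- move=> w a w' a' [Yw Mw] [Yw' Mw']; split; first exact: (fsD H).
  by apply: le_trans (sub Yw Yw') _; exact: lerD.
- by move=> i _; split; [exact: (fsZ H)|rewrite (fnZ H)].
Qed.

Let entry_le n (v : 'rV[R]_n) i : `|v ord0 i| <= `|v|.
Proof.
have /mapP[j Hj ->] : `|v ord0 i| \in [seq `|v x.1 x.2| | x : 'I_1 * 'I_n].
  by apply/mapP; exists (ord0, i) => //=; rewrite mem_enum.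
by rewrite [leRHS]/Num.norm /= mx_normrE; apply/bigmax_geP; right => /=; exists j.
Qed.

(** The norm of the linear combinations of an independent family is a norm on
    the coefficients, hence bounded below on their unit sphere by compactness. *)
Let independent_bound n (b : 'I_n.+1 -> T -> R) : (forall i, X (b i)) ->
  (forall c, comb b c =ae cst 0 -> forall i, c i = 0) ->
  exists2 m : R, 0 < m & forall c i, `|c i| <= m * N (comb b c).
Proof.
move=> Xb indep; pose q (v : 'rV[R]_n.+1) : R := N (comb b (v ord0)).
have q0 v : 0 <= q v by apply: (fn_ge0 H); exact: combX.
have combD (v w : 'rV[R]_n.+1) : comb b (v ord0) = comb b (w ord0) + comb b ((v - w) ord0).
  apply/funext => t; rewrite addrfctE !combE -big_split /=.
  by apply: eq_bigr => i _; rewrite !mxE; ring.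
pose B : R := \sum_i N (b i).
have B0 : 0 <= B by apply: sumr_ge0 => i _; exact: (fn_ge0 H).
have q_le v : q v <= B * `|v|.
  apply: le_trans (comb_norm _ Xb) _; rewrite /B mulr_suml; apply: ler_sum => i _.
  by rewrite mulrC; apply: ler_wpM2l; [exact: (fn_ge0 H)|exact: entry_le].
have qB v w : q v <= q w + B * `|v - w|.
  rewrite /q (combD v w); apply: le_trans (sub (combX _ Xb) (combX _ Xb)) _.
  by rewrite lerD2l; exact: q_le.
have q_cont : continuous q.
  move=> v.
  apply/(@cvgrPdist_lt R R 'rV[R]_n.+1 (nbhs v) (nbhs_filter v) q (q v)) => e e0.
  have eB : 0 < e / (B + 1) by rewrite divr_gt0// ltr_wpDl.
  apply: (proj2 (@nbhs_normP R 'rV[R]_n.+1 v _)); exists (e / (B + 1)) => //= w vw'.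
  have B1 : 0 < B + 1 by exact: ltr_wpDl.
  have vw : `|v - w| * (B + 1) < e by rewrite -(ltr_pdivlMr _ _ B1).
  have vw0 := normr_ge0 (v - w).
  have := qB v w; have := qB w v; rewrite (distrC w v) => h1 h2.
  by rewrite ltr_norml; apply/andP; split; nra.
pose S := [set v : 'rV[R]_n.+1 | `|v| = 1].
have S_compact : compact S.
  apply: bounded_closed_compact.
    by exists 1; split => // x x1 v /= ->; exact: ltW.
  rewrite (_ : S = (fun v : 'rV[R]_n.+1 => `|v|) @^-1` [set x : R | x = 1])//.
  apply: closed_comp; last exact: closed_eq.
  by move=> v _; exact: norm_continuous.
have S0 : S !=set0.
  exists (const_mx 1); rewrite /S /=; apply/eqP; rewrite eq_le; apply/andP; split.
    rewrite [leLHS]/Num.norm /= mx_normrE; apply/bigmax_leP; split => // i _.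
    by rewrite mxE normr1.
  by have := entry_le (const_mx 1 : 'rV[R]_n.+1) ord0; rewrite mxE normr1.
have [v0 v0S v0min] := EVT_min_rV S0 S_compact (continuous_subspaceT q_cont).
rewrite inE in v0S.
have qv0 : 0 < q v0.
  rewrite lt_neqAle q0 andbT eq_sym; apply/eqP => /(fn_eq0 H (combX _ Xb)) c0.
  have v00 : v0 = 0 by apply/rowP => i; rewrite mxE; exact: indep.
  by move: v0S; rewrite /S /= v00 normr0 => /eqP; rewrite eq_sym oner_eq0.
exists (q v0)^-1; first by rewrite invr_gt0.
move=> c i; pose v : 'rV[R]_n.+1 := \row_j c j.
have vc : v ord0 = c by apply/funext => j; rewrite mxE.
apply: (@le_trans _ _ `|v|); first by rewrite -vc; exact: entry_le.
have [->|vN0] := eqVneq v 0.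
  rewrite normr0; apply: mulr_ge0; first by rewrite invr_ge0 q0.
  by apply: (fn_ge0 H); exact: combX.
have nv : 0 < `|v| by rewrite normr_gt0.
have := v0min (`|v|^-1 *: v); rewrite inE => /(_ _).
rewrite /S /= normrZ normfV normr_id mulVf ?gt_eqF// => /(_ erefl).
have -> : q (`|v|^-1 *: v) = `|v|^-1 * q v.
  have -> : q v = N (comb b (v ord0)) by [].
  rewrite -{2}(@ger0_norm _ `|v|^-1) ?invr_ge0// -(fnZ H); last exact: combX.
  congr N; apply/funext => t; rewrite [RHS](_ : _ = `|v|^-1 * comb b (v ord0) t)//.
  by rewrite !combE mulr_sumr; apply: eq_bigr => j _; rewrite mxE mulrA.
rewrite /q vc mulrC ler_pdivlMr// mulrC => qle.
by rewrite mulrC ler_pdivlMr// mulrC.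
Qed.

(** The norm of an f in the span controls its coefficients, hence |f| is at most
    N f times a fixed multiple of the sum of the |b_i|.  When the b_i are dependent,
    one of them is redundant and induction applies. *)
Lemma finite_dimensional_domination n (b : 'I_n -> T -> R) :
  (forall i, X (b i)) -> exists2 e, X e & forall c : 'I_n -> R,
    {ae mu, forall t, `|(\sum_i c i *: b i) t| <= N (\sum_i c i *: b i) * `|e t|}.
Proof.
elim: n b => [|n IH] b Xb.
  exists (cst 0); first exact: (fs0 H).
  move=> c; have -> : \sum_i c i *: b i = cst 0 by rewrite big_ord0.
  by apply: aeW => t; rewrite /cst normr0 mulr0.
have [[c [j cj] c0]|indep] := pselect (exists2 c, (exists j, c j != 0) &
    comb b c =ae cst 0).
  have [e Xe eP] := IH (fun k => b (lift j k)) (fun k => Xb _).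
  exists e => // a.
  pose a' (k : 'I_n) : R := a (lift j k) - a j / c j * c (lift j k).
  have eqa : comb b a =ae comb (fun k => b (lift j k)) a'.
    apply: filterS c0 => t /(_ I); rewrite !combE (bigD1_ord j)//= => c0t _.
    have bj : b j t = - (c j)^-1 * \sum_(i < n) c (lift j i) * b (lift j i) t.
      apply: (mulfI cj); rewrite mulrA mulrN divff// mulN1r.
      by apply/eqP; rewrite -subr_eq0 opprK c0t.
    rewrite (bigD1_ord j)//= bj mulrA mulr_sumr -big_split /=.
    by apply: eq_bigr => k _; rewrite /a'; ring.
  have -> : N (\sum_i a i *: b i) = N (comb (fun k => b (lift j k)) a').
    by apply: (fn_ae H) => //; exact: combX.
  by apply: filterS2 eqa (eP a') => t /(_ I) eqt; rewrite -/(comb b a) eqt.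
have [m m0 mP] : exists2 m : R, 0 < m & forall c i, `|c i| <= m * N (comb b c).
  apply: independent_bound => // c c0 i; apply: contrapT => /eqP ci.
  by apply: indep; exists c => //; exists i.
exists (\sum_i m *: (fun t => `|b i t|)).
  by apply: (fs_sum H) => i _; apply: (fsZ H); exact: (fs_norm H).
move=> c; apply: aeW => t; rewrite -/(comb b c) combE fct_sumE.
have Nc : 0 <= N (comb b c) by apply: (fn_ge0 H); exact: combX.
have m_ge0 := ltW m0.
rewrite [X in _ * X]ger0_norm; last first.
  by apply: sumr_ge0 => i _; exact: mulr_ge0.
rewrite mulr_sumr; apply: le_trans (ler_norm_sum _ _ _) _; apply: ler_sum => i _.
rewrite normrM [leRHS](_ : _ = m * N (comb b c) * `|b i t|).
  by apply: ler_wpM2r.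
by rewrite [LHS](_ : _ = N (comb b c) * (m * `|b i t|))//; ring.
Qed.

End FiniteDimensionalDomination.

(** * Slice estimates *)

Lemma le_of_asymptotic (R : realType) (a b : R) : 0 <= a ->
  (forall e : R, 0 < e -> e < 1 -> exists C : R, forall l : R, 0 < l ->
    (1 - e) * (l * a) <= l * b + C) -> a <= b.
Proof.
move=> a0 asym; rewrite leNgt; apply/negP => ba.
have [b0|b0] := ltP b 0.
  have [C CP] := asym (1 / 2) ltac:(lra) ltac:(lra).
  pose l : R := (`|C| + 1) / - b.
  have l0 : 0 < l by rewrite divr_gt0// ?ltr_wpDl//; lra.
  have lb : l * - b = `|C| + 1 by rewrite /l divfK// gt_eqF//; lra.
  have := CP l l0; have := ler_norm C; have := mulr_ge0 (ltW l0) a0.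
  by move: lb; nra.
pose e : R := (a - b) / (2 * a).
have a_gt0 : 0 < a by lra.
have ea : e * a = (a - b) / 2 by rewrite /e; field; rewrite gt_eqF.
have e0 : 0 < e by rewrite divr_gt0; lra.
have e1 : e < 1 by rewrite ltr_pdivrMr; lra.
have [C CP] := asym e e0 e1.
pose l : R := (`|C| + 1) / ((a - b) / 2).
have g0 : 0 < (a - b) / 2 by lra.
have l0 : 0 < l by rewrite divr_gt0// ltr_wpDl.
have lb : l * ((a - b) / 2) = `|C| + 1 by rewrite /l divfK// gt_eqF.
have := CP l l0; have := ler_norm C.
have -> : (1 - e) * (l * a) = l * a - l * (e * a) by ring.
by rewrite ea; nra.
Qed.

Lemma abs_shift_le (R : realType) (s a b : R) : 0 <= a -> 0 <= b ->
  `|s + a| + `|b| <= a + b + `|s|.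
Proof.
move=> a0 b0; rewrite (ger0_norm b0).
by have := ler_normD s a; rewrite (ger0_norm a0); lra.
Qed.

Lemma abs_shift2_le (R : realType) (s a b : R) : 0 <= a -> 0 <= b ->
  `|a + s| + `|b + s| <= a + b + 2 * `|s|.
Proof.
move=> a0 b0; have := ler_normD a s; have := ler_normD b s.
by rewrite (ger0_norm a0) (ger0_norm b0); lra.
Qed.

Lemma min_half (R : realType) (delta : R) : 0 < delta ->
  exists r : R, [/\ 0 < r, r <= delta & r <= 1 / 2].
Proof.
move=> delta0; exists (Num.min delta (1 / 2)).
split; [by rewrite lt_min delta0; lra|by rewrite ge_min lexx|].
by rewrite ge_min lexx orbT.
Qed.

Lemma slice_half (R : realType) (r x : R) : r <= 1 / 2 -> 1 - r <= x -> 1 / 2 <= x.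
Proof. by move=> ? ?; lra. Qed.

Lemma slice_mono (R : realType) (r e x : R) : r <= e -> 1 - r <= x -> 1 - e <= x.
Proof. by move=> ? ?; lra. Qed.

Section DualSphere.
Context (R : realType) (d : measure_display) (T : measurableType d).
Context (mu : {measure set T -> \bar R}).
Context (Y : set (T -> R)) (M : (T -> R) -> R).
Hypothesis H : quasi_banach_function_space mu Y M.

Lemma dual_sphere_nonempty : subadditive Y M -> exists phi, dual_sphere mu Y M phi.
Proof.
move=> sub; have [y Yy yN0] := qbfs_nonzero H; have My := fn_gt0 H Yy yN0.
have [phi [phi_lin phi_le phi_y]] :=
  hahn_banach_seminorm (fs_lin H) sub (fnZ H) Yy.
have phiF : functional mu Y M phi.
  apply: (@functional_of_bounded _ _ _ _ _ _ H _ 1); first exact: phi_lin.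
  by move=> h Yh; rewrite mul1r; exact: phi_le.
exists phi; split => //; apply/eqP; rewrite eq_le; apply/andP; split.
  apply: (dual_norm_le H phiF) => h Yh Mh; exact: le_trans (phi_le h Yh) Mh.
have := dual_normP H phiF Yy; rewrite phi_y (gtr0_norm My).
by rewrite -{1}[M y]mul1r ler_pM2r.
Qed.

(** The overlap of b h and u is at most b + M u times that of h and e; the bound
    1/2 <= M h allows to absorb the resulting error into b M h + M u. *)
Lemma overlap_estimate (AL : additive_on_cone Y M) h u e (b eps : R) :
  Y h -> Y u -> Y e -> 1 / 2 <= M h -> 0 <= b ->
  M (fun t => Num.min `|h t| `|e t|) <= eps / 4 ->
  {ae mu, forall t, `|u t| <= M u * `|e t|} ->
  (1 - eps) * (b * M h + M u) <= M (b *: h + u).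
Proof.
move=> Yh Yu Ye Mh b0 small ue.
have Ybh : Y (b *: h) by exact: (fsZ H).
have := al_overlap H AL Ybh Yu; rewrite (fnZ H)// (ger0_norm b0) => overlap.
have Mu := fn_ge0 H Yu; have Ym := fs_min H Yh Ye.
have bMu : 0 <= b + M u by exact: addr_ge0.
have min0 t : 0 <= Num.min `|h t| `|e t| by rewrite le_min !normr_ge0.
have le_min_bu : M (fun t => Num.min `|(b *: h) t| `|u t|)
    <= (b + M u) * M (fun t => Num.min `|h t| `|e t|).
  rewrite -[b + M u]ger0_norm// -(fnZ H)//; apply: (fn_le_ae H).
  - exact: (fs_min H).
  - exact: (fsZ H).
  apply: filterS ue => t ue; rewrite ger0_norm ?le_min ?normr_ge0//.
  rewrite [leRHS](_ : _ = (b + M u) * Num.min `|h t| `|e t|); last first.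
    by rewrite [LHS]ger0_norm//; exact: mulr_ge0.
  rewrite [`|(b *: h) t|](_ : _ = b * `|h t|); last by rewrite [LHS]normrM ger0_norm.
  have := normr_ge0 (h t); have := normr_ge0 (e t).
  move: ue; case: (leP `|h t| `|e t|) => he ue e0 h0; rewrite ge_min; apply/orP.
    by left; apply: ler_wpM2r => //; rewrite lerDl.
  by right; apply: le_trans ue _; apply: ler_wpM2r => //; rewrite lerDr.
have m0 := fn_ge0 H Ym.
have eps0 : 0 <= eps by lra.
have e1 := ler_wpM2l bMu small.
have e2 : 0 <= eps * b * (M h - 1 / 2) by rewrite !mulr_ge0// subr_ge0.
have e3 : 0 <= eps * M u by exact: mulr_ge0.
by move: overlap le_min_bu e1 e2 e3; lra.
Qed.

End DualSphere.

Section Slices.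
Context (R : realType) (d : measure_display) (T : measurableType d).
Context (mu : {measure set T -> \bar R}) (p : R).
Context (X : set (T -> R)) (N : (T -> R) -> R).
Hypothesis p1 : 1 <= p.
Hypothesis H : quasi_banach_function_space mu X N.
Implicit Types (f g h : T -> R).

Local Notation "f =ae g" := (ae_eq mu [set: T] f g) (at level 70).
Local Notation Y := (pspace p X).
Local Notation M := (pnorm p N).

Let HY : quasi_banach_function_space mu Y M.
Proof. exact: pspace_qbfs. Qed.
Let p_gt0 : 0 < p. Proof. exact: lt_le_trans p1. Qed.
Let p_neq0 : p != 0. Proof. by rewrite gt_eqF. Qed.

Definition span n (b : 'I_n -> T -> R) : set (T -> R) :=
  [set f | X f /\ exists c : 'I_n -> R, f =ae \sum_i c i *: b i].

Lemma finite_dimensional_span n (b : 'I_n -> T -> R) : (forall i, X (b i)) ->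
  finite_dimensional_subspace mu X (span b).
Proof.
move=> Xb; split; first by move=> f [].
- split.
  + by move=> f [Xf _]; exact: (fs_meas H).
  + move=> f g [Xf [c fc]] mg fg; split; first exact: (fs_saturated H Xf).
    by exists c; apply: ae_eq_trans fc; exact: ae_eq_sym.
  + split; first exact: (fs0 H).
    exists (fun=> 0); apply: aeW => t _; rewrite fct_sumE big1// => i _.
    exact: mul0r.
  + move=> f g [Xf [c fc]] [Xg [c' gc']]; split; first exact: (fsD H).
    exists (fun i => c i + c' i); apply: filterS2 fc gc' => t /(_ I) ft /(_ I) gt _.
    rewrite addrfctE ft gt !fct_sumE -big_split; apply: eq_bigr => i _ /=.
    by rewrite scalerDl.
  + move=> a f [Xf [c fc]]; split; first exact: (fsZ H).
    exists (fun i => a * c i); apply: filterS fc => t /(_ I) ft _.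
    rewrite [LHS](_ : _ = a * f t)// ft !fct_sumE mulr_sumr.
    by apply: eq_bigr => i _; exact: mulrA.
exists n; exists b; last by move=> f [].
move=> i; split => //; exists (fun j => (j == i)%:R).
apply: aeW => t _; rewrite fct_sumE (bigD1 i)//= eqxx scale1r big1 ?addr0// => j /negPf ->.
by rewrite scale0r.
Qed.

Lemma span_scale n (b : 'I_n -> T -> R) i (c : R) : (forall i, X (b i)) ->
  span b (c *: b i).
Proof.
move=> Xb; split; first exact: (fsZ H).
exists (fun j => if j == i then c else 0); apply: aeW => t _.
rewrite fct_sumE (bigD1 i)//= eqxx big1 ?addr0// => j /negPf ->.
by rewrite scale0r.
Qed.

Lemma spowZ (c : R) f : 0 <= c -> spow p (c *: f) = (c `^ p) *: spow p f.
Proof.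
move=> c0; apply/funext => t; rewrite /spow.
change (Num.sg (c * f t) * `|c * f t| `^ p = c `^ p * (Num.sg (f t) * `|f t| `^ p)).
by rewrite sgMpowRM sgMpowR_ge0.
Qed.

Lemma spow_scaled_root (l : R) (u : T -> R) : 0 <= l ->
  spow p ((l `^ p^-1) *: spow p^-1 u) = l *: u.
Proof. by move=> l0; rewrite spowZ ?powR_ge0// powRVK// (spowVK p1). Qed.

Lemma norm_scaled_root (l : R) (u : T -> R) : 0 <= l -> Y u ->
  N ((l `^ p^-1) *: spow p^-1 u) `^ p = l * M u.
Proof.
move=> l0 Yu; rewrite -(pnorm_spow p1 H); last exact/(fsZ H)/(pspace_root p1 H).
by rewrite spow_scaled_root// (fnZ HY)// ger0_norm.
Qed.

(** Take X_0 spanned by the roots of u and v, f_1 and f_2 the roots of l u and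
    l v, and alpha = (1, 0).  As l tends to infinity the contribution of g, which
    does not depend on l, becomes negligible. *)
Lemma slice_estimate_additive : convex_slice_estimate mu p X N ->
  additive_on_cone Y M.
Proof.
move=> [/(p_convex1P p1 H) sub slices] u v Yu Yv u0 v0.
apply/eqP; rewrite eq_le sub//=.
have [phi phiS] := dual_sphere_nonempty HY sub.
apply: le_of_asymptotic => [|e e0 e1]; first by rewrite addr_ge0// (fn_ge0 HY).
pose b (i : 'I_2) : T -> R := if i == ord0 then spow p^-1 u else spow p^-1 v.
have Xb i : X (b i) by rewrite /b; case: ifP => _; exact: (pspace_root p1 H).
have [g [Xg _] gP] := slices phi phiS _ ltr01 e e0 _ (finite_dimensional_span Xb).
have Yg := pspace_spow p1 H Xg.
exists (M (spow p g)) => l l0; have l_ge0 := ltW l0.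
pose alpha (i : 'I_2) : R := if i == ord0 then 1 else 0.
have alpha0 i : 0 <= alpha i by rewrite /alpha; case: ifP.
have alpha1 : \sum_i alpha i `^ p = 1.
  by rewrite sum_ord2 /alpha /= one_powR powR0// addr0.
have := gP 2 (fun i => (l `^ p^-1) *: b i) alpha (fun i => span_scale i _ Xb)
  alpha0 alpha1.
rewrite (norm_root_sum p1 H (w := fun i t => `|spow p (alpha i *: g) t +
  spow p ((l `^ p^-1) *: b i) t|)); last 2 first.
- by move=> i; apply: (fs_norm HY); apply: (fsD HY); apply: (pspace_spow p1 H);
    exact: (fsZ H).
- by move=> i t; exact: normr_ge0.
rewrite sum_ord2 powRVK//; last first.
  by apply: (fn_ge0 HY); apply: (fs_sum HY) => i _; apply: (fs_norm HY);
    apply: (fsD HY); apply: (pspace_spow p1 H); exact: (fsZ H).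
rewrite sum_ord2 /alpha /b /= scale1r scale0r.
rewrite !spow_scaled_root// !norm_scaled_root//.
move=> slice_h; have Nl : 0 <= N g `^ p by exact: powR_ge0.
have Yuv := fsD HY Yu Yv.
have Yluv := fsZ HY l Yuv; have Yag := fs_norm HY Yg.
have spow0 t : spow p (0 : T -> R) t = 0 by rewrite /spow sgr0 mul0r.
have le_M : M ((fun t => `|spow p g t + (l *: u) t|) +
    (fun t => `|spow p 0 t + (l *: v) t|)) <= l * M (u + v) + M (spow p g).
  rewrite -(fn_norm HY Yg) -[l in X in _ <= X](ger0_norm l_ge0) -(fnZ HY)//.
  apply: le_trans (sub _ _ Yluv Yag).
  apply: (fn_le HY) => [||t]; last 1 first.
  - rewrite ger0_norm; last by apply: addr_ge0; exact: normr_ge0.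
    rewrite [leRHS]ger0_norm; last first.
      by apply: addr_ge0 => //; apply: mulr_ge0 => //; exact: addr_ge0.
    rewrite addrfctE spow0 add0r.
    change (`|spow p g t + l * u t| + `|l * v t| <= l * (u t + v t) + `|spow p g t|).
    have lu : 0 <= l * u t by exact: mulr_ge0.
    have lv : 0 <= l * v t by exact: mulr_ge0.
    by rewrite mulrDr; exact: abs_shift_le.
  - apply: (fsD HY); apply: (fs_norm HY); apply: (fsD HY); try exact: (fsZ HY).
      exact: Yg.
    apply: (pspace_spow p1 H); exact: (fs0 H).
  - exact: (fsD HY).
apply: le_trans le_M; apply: le_trans slice_h.
rewrite mulrDr; apply: ler_wpM2l; first by rewrite subr_ge0 ltW.
rewrite lerDr; exact: Nl.
Qed.

Lemma spow_quotient (w : T -> R) (a : R) : (forall t, 0 <= w t) -> 0 <= a ->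
  spow p (fun t => (w t / a) `^ p^-1) = a^-1 *: w.
Proof.
move=> w0 a0; apply/funext => t; rewrite /spow.
have wa : 0 <= w t / a by rewrite divr_ge0.
rewrite (sgMpowR_ge0 p_neq0 (powR_ge0 _ _)) powRVK//.
exact: mulrC.
Qed.

Lemma root_slice_quotientP psi (eps : R) (w : T -> R) (a : R) :
  functional mu Y M psi -> Y w -> (forall t, 0 <= w t) -> 0 < a ->
  root_slice p X N psi eps (fun t => (w t / a) `^ p^-1) <->
  M w <= a /\ (1 - eps) * a <= psi w.
Proof.
move=> psiF Yw w0 a0; have aV : 0 <= a^-1 by rewrite invr_ge0 ltW.
have Yaw := fsZ HY a^-1 Yw.
rewrite /root_slice /slice /closed_ball_of /mkset spow_quotient ?(ltW a0)//.
rewrite (functionalZ HY psiF)// (fnZ HY)// (ger0_norm aV).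
rewrite (ler_pdivrMl _ _ a0) (ler_pdivlMl _ _ a0) mulr1.
rewrite [a * (1 - eps)]mulrC; split=> [[_ [[_ ?] ?]] //|[Mw psiw]].
split=> //; have := pspace_norm Yaw; congr X; apply/funext => t.
by rewrite [in LHS]ger0_norm 1?mulrC//; apply: mulr_ge0.
Qed.

Lemma root_slice_quotient_le psi (eps : R) (w : T -> R) (a : R) :
  functional mu Y M psi -> Y w -> (forall t, 0 <= w t) -> 0 <= a -> eps < 1 ->
  root_slice p X N psi eps (fun t => (w t / a) `^ p^-1) ->
  (1 - eps) * a <= psi w.
Proof.
move=> psiF Yw w0 a0 eps1; have [a_eq0|aN0] := eqVneq a 0.
  move=> [_ [_]]; rewrite spow_quotient// a_eq0 invr0 scale0r.
  have -> : psi 0 = 0 by exact: (functional0 HY psiF).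
  by lra.
have a_gt0 : 0 < a by rewrite lt_neqAle eq_sym aN0.
by move=> /(root_slice_quotientP eps psiF Yw w0 a_gt0)[].
Qed.

Lemma dual_ball_le psi w : dual_ball mu Y M psi -> Y w -> psi w <= M w.
Proof.
move=> [psiF psi1] Yw; apply: le_trans (ler_norm _) _.
apply: le_trans (dual_normP HY psiF Yw) _.
by rewrite ler_piMl// (fn_ge0 HY).
Qed.

Let abs_sum_spow f g : X f -> X g -> Y (fun t => `|spow p f t + spow p g t|).
Proof.
move=> Xf Xg; apply: (fs_norm HY).
by apply: (fsD HY); exact: (pspace_spow p1 H).
Qed.

(** Since one functional psi serves all f in X_0, the estimates for the roots of
    l u and l v can be added inside psi; then l tends to infinity. *)
Lemma slice_functional_additive : convex_slice_functional mu p X N ->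
  additive_on_cone Y M.
Proof.
move=> [/(p_convex1P p1 H) sub slices] u v Yu Yv u0 v0.
apply/eqP; rewrite eq_le sub//=.
have [phi phiS] := dual_sphere_nonempty HY sub.
apply: le_of_asymptotic => [|e e0 e1]; first by rewrite addr_ge0// (fn_ge0 HY).
pose b (i : 'I_2) : T -> R := if i == ord0 then spow p^-1 u else spow p^-1 v.
have Xb i : X (b i) by rewrite /b; case: ifP => _; exact: (pspace_root p1 H).
have [g [Xg _] [psi psiB psiP]] :=
  slices phi phiS _ ltr01 e e0 _ (finite_dimensional_span Xb).
have [psiF _] := psiB; have Yg := pspace_spow p1 H Xg.
have Mg := fn_ge0 HY Yg.
exists (2 * M (spow p g)) => l l0; have l_ge0 := ltW l0.
have est (i : 'I_2) (w : T -> R) : b i = spow p^-1 w -> Y w -> (forall t, 0 <= w t) ->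
    Y (fun t => `|(l *: w) t + spow p g t|) /\
    (1 - e) * (l * M w) <= psi (fun t => `|(l *: w) t + spow p g t|).
  move=> bi Yw w0; have Yw' := fsZ HY l Yw.
  have Xf := fsZ H (l `^ p^-1) (pspace_root p1 H Yw).
  have Yabs : Y (fun t => `|(l *: w) t + spow p g t|).
    by apply: (fs_norm HY); exact: (fsD HY).
  split=> //; have := psiP _ (span_scale i (l `^ p^-1) Xb).
  rewrite bi norm_scaled_root// spow_scaled_root// -(pnorm_spow p1 H Xg).
  have Mw := fn_ge0 HY Yw; have lMw := mulr_ge0 l_ge0 Mw.
  have abs0 t : 0 <= `|(l *: w) t + spow p g t| by exact: normr_ge0.
  move=> /(root_slice_quotient_le psiF Yabs abs0 (addr_ge0 lMw Mg) e1).
  apply: le_trans; apply: ler_wpM2l; first by rewrite subr_ge0 ltW.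
  rewrite lerDl; exact: Mg.
have [Y1 est1] := est ord0 u erefl Yu u0.
have [Y2 est2] := est (lift ord0 ord0) v erefl Yv v0.
rewrite mulrDr mulrDr; apply: le_trans (lerD est1 est2) _.
rewrite -(functionalD psiF)//; apply: le_trans (dual_ball_le psiB (fsD HY Y1 Y2)) _.
have Yuv := fsD HY Yu Yv.
have Yluv := fsZ HY l Yuv; have Yag := fs_norm HY Yg; have Y2g := fsZ HY 2 Yag.
have -> : l * M (u + v) = M (l *: (u + v)) by rewrite (fnZ HY l Yuv) (ger0_norm l_ge0).
have -> : 2 * M (spow p g) = M (2 *: (fun t => `|spow p g t|)).
  by rewrite (fnZ HY 2 Yag) (fn_norm HY Yg) (ger0_norm (ler0n R 2)).
apply: le_trans (sub _ _ Yluv Y2g); apply: (fn_le HY) => [||t].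
- exact: (fsD HY).
- exact: (fsD HY).
rewrite ger0_norm; last by apply: addr_ge0; exact: normr_ge0.
rewrite [leRHS]ger0_norm; last first.
  apply: addr_ge0; apply: mulr_ge0 => //; exact: addr_ge0.
change (`|l * u t + spow p g t| + `|l * v t + spow p g t|
  <= l * (u t + v t) + 2 * `|spow p g t|).
have lu : 0 <= l * u t by exact: mulr_ge0.
have lv : 0 <= l * v t by exact: mulr_ge0.
by rewrite mulrDr; exact: abs_shift2_le.
Qed.

(** One function e dominates all of X_0 relatively to the norm, so an h almost
    disjoint from e^p is almost disjoint from every f^p with f in X_0, uniformly
    in the number of terms. *)
Lemma small_overlap_slice_estimate : additive_on_cone Y M ->
  small_overlap mu Y M -> convex_slice_estimate mu p X N.
Proof.
move=> AL overlap; have [conv _] := (additive_on_coneP p1 H).1 AL.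
split=> // phi phiS delta delta0 eps eps0 X0 [X0X _ [n [b Xb bP]]].
have subX := p_convex1_subadditive p1 H conv.
have [e Xe eP] := finite_dimensional_domination H subX (fun i => X0X _ (Xb i)).
have dom f : X0 f -> {ae mu, forall t, `|f t| <= N f * `|e t|}.
  move=> X0f; have [c fc] := bP f X0f.
  have -> : N f = N (\sum_i c i *: b i).
    apply: (fn_ae H) => //; first exact: X0X.
    by apply: (fs_sum H) => i _; apply: (fsZ H); exact: X0X.
  by apply: filterS2 fc (eP c) => t /(_ I) ->.
have [r [r0 r_delta r1]] := min_half delta0.
have Ye := pspace_spow p1 H Xe.
have eps4 : 0 < eps / 4 by lra.
have [h [Yh Mh phih small]] := overlap phi phiS _ Ye _ _ r0 eps4.
have [phiF phi1] := phiS.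
have Mh_ge : 1 / 2 <= M h.
  apply: le_trans (slice_half r1 phih) (dual_ball_le _ Yh).
  by split; [exact: phiF|rewrite phi1].
exists (spow p^-1 h).
  split; first exact: (pspace_root p1 H).
  by rewrite (spowVK p1); split; [split|exact: slice_mono phih].
move=> m f alpha X0f alpha0 alpha1.
have Xf i : X (f i) by exact: X0X.
have Yf i := pspace_spow p1 H (Xf i).
have spow_g i : spow p (alpha i *: spow p^-1 h) = (alpha i `^ p) *: h.
  by rewrite spowZ// (spowVK p1).
pose w i t : R := `|spow p (alpha i *: spow p^-1 h) t + spow p (f i) t|.
have Yw i : Y (w i).
  by rewrite /w spow_g; exact: (fs_norm HY (fsD HY (fsZ HY _ Yh) (Yf i))).
have w0 i t : 0 <= w i t by exact: normr_ge0.
rewrite (norm_root_sum p1 H Yw w0) (powRVK p_neq0); last first.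
  by apply: (fn_ge0 HY); exact: (fs_sum HY).
rewrite (al_sum HY AL _ Yw w0) -(pnorm_root p1 H Yh).
have -> : M h + \sum_i N (f i) `^ p
    = \sum_i ((alpha i `^ p) * M h + M (spow p (f i))).
  rewrite big_split -mulr_suml alpha1 mul1r; congr (_ + _).
  by apply: eq_bigr => i _; rewrite (pnorm_spow p1 H).
rewrite mulr_sumr; apply: ler_sum => i _; rewrite /w spow_g.
have Yah := fsZ HY (alpha i `^ p) Yh.
rewrite (fn_norm HY (fsD HY Yah (Yf i))).
apply: (overlap_estimate HY AL Yh (Yf i) Ye Mh_ge (powR_ge0 _ _) small).
apply: filterS (dom _ (X0f i)) => t fe.
have := powR_monotone (ltW p_gt0) (normr_ge0 _) fe.
rewrite powRM ?(fn_ge0 H (Xf i))//.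
by rewrite -(norm_spow (f i) t p_neq0) -(norm_spow e t p_neq0) -(pnorm_spow p1 H (Xf i)).
Qed.

(** The estimate yields additivity of the norm on the cone, hence the integral
    exists as a functional, and for n = 1 the estimate is a statement about it. *)
Lemma slice_estimate_functional : convex_slice_estimate mu p X N ->
  convex_slice_functional mu p X N.
Proof.
move=> hyp; have AL := slice_estimate_additive hyp; case: hyp => conv slices.
split=> // phi phiS delta delta0 eps eps0 X0 fdX0.
have [X0X _ _] := fdX0; have sub := (p_convex1P p1 H).1 conv.
have [r [r0 r_delta r1]] := min_half delta0.
have [g [Xg [gball phig]] gP] := slices phi phiS r r0 eps eps0 X0 fdX0.
exists g; first by split; [exact: Xg|split; [exact: gball|exact: slice_mono phig]].
have psiB := cone_integral_dual_ball HY AL; exists (cone_integral M); first exact: psiB.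
move=> f X0f; have Xf := X0X _ X0f.
have Yg := pspace_spow p1 H Xg; have Yf := pspace_spow p1 H Xf.
pose w t : R := `|spow p f t + spow p g t|.
have Yw : Y w by exact: abs_sum_spow.
have w0 t : 0 <= w t by exact: normr_ge0.
have [phiF phi1] := phiS.
have Mg : 1 / 2 <= M (spow p g).
  apply: le_trans (slice_half r1 phig) (dual_ball_le _ Yg).
  by split; [exact: phiF|rewrite phi1].
have Mf := fn_ge0 HY Yf.
rewrite -(pnorm_spow p1 H Xf) -(pnorm_spow p1 H Xg).
have a0 : 0 < M (spow p f) + M (spow p g).
  by apply: ltr_wpDl Mf _; apply: lt_le_trans Mg; rewrite divr_gt0.
apply/(root_slice_quotientP eps psiB.1 Yw w0 a0); split.
  by rewrite (fn_norm HY (fsD HY Yf Yg)); exact: sub.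
rewrite (cone_integral_ge0 HY AL Yw w0).
have one_p : \sum_(i < 1) (1 : R) `^ p = 1 by rewrite big_ord1 one_powR.
have gP1 := gP 1%N (fun=> f) (fun=> 1) (fun=> X0f) (fun=> ler01) one_p.
have lhsE : N g `^ p + \sum_(i < 1) N f `^ p = M (spow p f) + M (spow p g).
  by rewrite big_ord1 (pnorm_spow p1 H Xf) (pnorm_spow p1 H Xg) addrC.
have rhsE : N (fun t => (\sum_(i < 1) `|spow p (1 *: g) t + spow p f t|) `^ p^-1)
    `^ p = M w.
  have -> : (fun t => (\sum_(i < 1) `|spow p (1 *: g) t + spow p f t|) `^ p^-1)
      = fun t => w t `^ p^-1.
    by apply/funext => t; rewrite big_ord1 scale1r addrC.
  rewrite (norm_root_nonneg p1 H Yw w0).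
  exact: (powRVK p_neq0 (fn_ge0 HY Yw)).
rewrite lhsE rhsE in gP1; exact: gP1.
Qed.

(** For X_0 spanned by the signed root of y, the functional psi bounds
    M (g^p + y) from below. *)
Lemma slice_functional_daugavet : convex_slice_functional mu p X N ->
  daugavet_equation mu Y M.
Proof.
move=> [conv slices]; have sub := (p_convex1P p1 H).1 conv.
apply: (daugavet_of_slices HY sub) => phi phiS y Yy e e0.
have [r [r0 re r1]] := min_half e0.
have Xy := pspace_root p1 H Yy.
have [g [Xg [[Yg Mg] phig]] [psi psiB psiP]] := slices phi phiS r r0 r r0 _
  (finite_dimensional_span (fun _ : 'I_1 => Xy)).
exists (spow p g); split; [exact: Yg|exact: Mg|exact: slice_mono phig|].
have Xspan : span (fun _ : 'I_1 => spow p^-1 y) (spow p^-1 y).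
  by have := span_scale ord0 1 (fun _ : 'I_1 => Xy); rewrite scale1r.
have := psiP _ Xspan; rewrite (spowVK p1) -(pnorm_spow p1 H Xg) -(pnorm_root p1 H Yy).
have Yw := fs_norm HY (fsD HY Yy Yg).
have [My Mg0] := (fn_ge0 HY Yy, fn_ge0 HY Yg).
have rlt1 : r < 1 by apply: le_lt_trans r1 _; rewrite ltr_pdivrMr// mul1r ltr1n.
move=> /(root_slice_quotient_le psiB.1 Yw (fun t => normr_ge0 _) (addr_ge0 My Mg0) rlt1).
move=> /le_trans /(_ (dual_ball_le psiB Yw)).
rewrite (fn_norm HY (fsD HY Yy Yg)) (addrC (M y) (M (spow p g))) (addrC y (spow p g)) => h.
apply: le_trans h; apply: ler_wpM2r; first exact: (addr_ge0 Mg0 My).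
by rewrite lerD2l lerN2.
Qed.

End Slices.

(** * Disjoint additivity *)

Section DisjointAdditivity.
Context (R : realType) (d : measure_display) (T : measurableType d).
Context (mu : {measure set T -> \bar R}).
Context (Y : set (T -> R)) (M : (T -> R) -> R).
Hypothesis H : quasi_banach_function_space mu Y M.
Hypothesis disj : forall u v, Y u -> Y v -> (forall t, 0 <= u t) ->
  (forall t, 0 <= v t) -> (forall t, u t = 0 \/ v t = 0) ->
  M (u + v) = M u + M v.

Let disjoint_sum n (E : 'I_n -> T -> R) : (forall i, Y (E i)) ->
  (forall i t, 0 <= E i t) ->
  (forall i j t, i != j -> E i t = 0 \/ E j t = 0) ->
  M (\sum_i E i) = \sum_i M (E i).
Proof.
elim: n E => [|n IH] E YE E0 Edisj.
  by rewrite !big_ord0; have := fn0 H.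
rewrite !big_ord_recl disj ?IH//.
- by move=> i j t ij; apply: Edisj; rewrite (inj_eq lift_inj).
- by apply: (fs_sum H).
- by move=> t; rewrite fct_sumE sumr_ge0.
- move=> t; have [->|E0t] := eqVneq (E ord0 t) 0; [by left|right].
  rewrite fct_sumE big1// => i _.
  by have [/eqP|//] := Edisj ord0 (lift ord0 i) t isT; rewrite (negPf E0t).
Qed.

(** Slice w = u + v into the sets where k w <= n u < (k + 1) w.  There u and v
    agree with k w / n and (n - k) w / n up to w / n, and for step multiples of w
    disjoint additivity suffices. *)
Lemma disjoint_additive_superadditive u v : Y u -> Y v -> (forall t, 0 <= u t) ->
  (forall t, 0 <= v t) -> M u + M v <= M (u + v).
Proof.
move=> Yu Yv u0 v0; pose w := u + v; have Yw : Y w by exact: (fsD H).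
have wE t : w t = u t + v t by [].
have w0 t : 0 <= w t by rewrite wE addr_ge0.
have Mw0 := fn_ge0 H Yw.
suff step (n : nat) : M u + M v <= M w + n.+1%:R^-1 * M w.
  suff le_e (e : R) : 0 < e -> M u + M v <= M w + e by apply/ler_addgt0Pr; exact: le_e.
  move=> e0; have e'0 : 0 < e / (M w + 1) by rewrite divr_gt0// ltr_wpDl.
  have [n ne] : exists n, (n.+1%:R : R)^-1 < e / (M w + 1).
    have := near_infty_natSinv_lt (PosNum e'0).
    by case=> n _ /(_ n (leqnn n)); exists n.
  apply: le_trans (step n) _; rewrite lerD2l.
  move: ne; rewrite ltr_pdivlMr; last by rewrite ltr_wpDl.
  have : 0 < (n.+1%:R : R)^-1 by rewrite invr_gt0.
  by move: ((n.+1%:R : R)^-1) => k k0 ne; nra.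
pose m : R := n.+1%:R; have m0 : 0 < m by rewrite ltr0n.
pose A k t : bool := ((k%:R * w t <= m * u t) && (m * u t < k.+1%:R * w t)).
pose E (k : 'I_n.+2) : T -> R := fun t => if A k t then w t else 0.
have mA k : measurable_fun [set: T] (A k).
  have mu' := fs_meas H Yu; have mw := fs_meas H Yw.
  by apply: measurable_and; [apply: measurable_fun_ler|apply: measurable_fun_ltr];
    apply: measurable_funM => //; exact: measurable_cst.
have E0 k t : 0 <= E k t by rewrite /E; case: ifP.
have YE k : Y (E k).
  apply: (fs_ideal H Yw).
    apply: measurable_fun_ifT; [exact: mA|exact: (fs_meas H)|exact: measurable_cst].
  by move=> t; rewrite /E; case: ifP; rewrite ?normr0.
have A_uniq k l t : A k t -> A l t -> 0 < w t -> (k <= l)%N.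
  move=> /andP[k1 _] /andP[_ l2] wt; have := le_lt_trans k1 l2.
  by rewrite ltr_pM2r// ltr_nat ltnS.
have Edisj k l t : k != l -> E k t = 0 \/ E l t = 0.
  move=> kl; have [wt|] := ltP 0 (w t); last first.
    move=> wt; have {}wt : w t = 0 by apply/eqP; rewrite eq_le wt w0.
    by left; rewrite /E wt; case: ifP.
  rewrite /E; case: ifP => Ak; [case: ifP => Al; [|by right]|by left].
  by exfalso; move/eqP: kl; apply; apply/val_inj/eqP; rewrite eqn_leq (A_uniq _ _ t) ?(A_uniq _ _ t).
have A_ex t : 0 < w t -> exists k : 'I_n.+2, A k t.
  move=> wt; pose x : R := m * u t / w t.
  have x0 : 0 <= x by rewrite divr_ge0// mulr_ge0// ltW.
  have xm : x <= m by rewrite ler_pdivrMr// ler_pM2l// wE lerDl.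
  have /andP[tx xt] := truncn_itv x0.
  have tn : (Num.truncn x < n.+2)%N.
    by rewrite -(ltr_nat R); apply: le_lt_trans tx _; apply: le_lt_trans xm _; rewrite ltr_nat.
  exists (Ordinal tn); rewrite /A /=; apply/andP; split.
    by rewrite -ler_pdivlMr.
  by rewrite -ltr_pdivrMr.
have sumE (c : 'I_n.+2 -> R) t : 0 < w t -> exists2 k : 'I_n.+2, A k t &
    (\sum_i c i *: E i) t = c k * w t.
  move=> wt; have [k Ak] := A_ex t wt; exists k => //.
  rewrite fct_sumE (bigD1 k)//= big1 ?addr0.
    by rewrite [LHS](_ : _ = c k * E k t)// /E Ak.
  move=> l lk; have [Ek0|El0] := Edisj k l t ltac:(by rewrite eq_sym).
    by move: wt; rewrite -Ek0 /E Ak ltxx.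
  by rewrite [LHS](_ : _ = c l * E l t)// El0 mulr0.
have sumE0 (c : 'I_n.+2 -> R) t : w t = 0 -> (\sum_i c i *: E i) t = 0.
  move=> wt; rewrite fct_sumE big1// => i _.
  by rewrite [LHS](_ : _ = c i * E i t)// /E wt if_same mulr0.
have sum_norm (c : 'I_n.+2 -> R) : (forall i, 0 <= c i) ->
    Y (\sum_i c i *: E i) /\ M (\sum_i c i *: E i) = \sum_i c i * M (E i).
  move=> c0; split; first by apply: (fs_sum H) => i _; exact: (fsZ H).
  rewrite disjoint_sum//.
  - by apply: eq_bigr => i _; rewrite (fnZ H)// ger0_norm.
  - by move=> i; exact: (fsZ H).
  - by move=> i t; exact: mulr_ge0.
  - by move=> i j t /(Edisj _ _ t)[h|h]; [left|right];
      [rewrite [LHS](_ : _ = c i * E i t)//|rewrite [LHS](_ : _ = c j * E j t)//];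
      rewrite h mulr0.
pose a (k : 'I_n.+2) : R := k.+1%:R / m.
pose b (k : 'I_n.+2) : R := (n.+1 - k)%N%:R / m.
have a0 k : 0 <= a k by rewrite divr_ge0// ltW.
have b0 k : 0 <= b k by rewrite divr_ge0// ltW.
have [Ya Ma] := sum_norm a a0; have [Yb Mb] := sum_norm b b0.
have [Y1 M1] := sum_norm (fun=> 1) (fun=> ler01).
have M1w : M (\sum_i 1 *: E i) = M w.
  congr M; apply/funext => t; have [wt|wt] := ltP 0 (w t).
    by have [k _ ->] := sumE (fun=> 1) t wt; rewrite mul1r.
  have {}wt : w t = 0 by apply/eqP; rewrite eq_le wt w0.
  by rewrite sumE0 ?wt.
have vm t : v t * m = m * w t - m * u t by rewrite wE; ring.
have Mu : M u <= \sum_i a i * M (E i).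
  rewrite -Ma; apply: (fn_le H) => // t; have [wt|wt] := ltP 0 (w t); last first.
    have ut : u t = 0 by have := u0 t; have := v0 t; move: wt; rewrite wE; lra.
    by rewrite ut normr0.
  have [k /andP[_ k2] ->] := sumE a t wt.
  rewrite (ger0_norm (u0 t)) ger0_norm; last by rewrite mulr_ge0// ltW.
  by rewrite /a mulrAC ler_pdivlMr// mulrC ltW.
have Mv : M v <= \sum_i b i * M (E i).
  rewrite -Mb; apply: (fn_le H) => // t; have [wt|wt] := ltP 0 (w t); last first.
    have vt : v t = 0 by have := u0 t; have := v0 t; move: wt; rewrite wE; lra.
    by rewrite vt normr0.
  have [k /andP[k1 _] ->] := sumE b t wt.
  rewrite (ger0_norm (v0 t)) ger0_norm; last by rewrite mulr_ge0// ltW.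
  rewrite /b mulrAC ler_pdivlMr// vm natrB; last by rewrite -ltnS.
  by rewrite -/m mulrBl lerD2l lerN2.
apply: le_trans (lerD Mu Mv) _; rewrite -M1w M1 mulr_sumr -!big_split /=.
apply: ler_sum => i _.
rewrite -mulrDl [leRHS](_ : _ = (1 + m^-1) * M (E i)); last by rewrite /m; ring.
apply: ler_wpM2r; first exact: (fn_ge0 H).
rewrite /a /b -mulrDl -natrD.
have -> : (i.+1 + (n.+1 - i) = n.+2)%N by rewrite addSn subnKC// -ltnS.
by rewrite -[n.+2]addn1 natrD mulrDl divff ?gt_eqF// mul1r.
Qed.

End DisjointAdditivity.

(** * Equivalences without a representing measure *)

Section Equivalences.
Context (R : realType) (d : measure_display) (T : measurableType d).
Context (mu : {measure set T -> \bar R}) (p : R).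
Context (X : set (T -> R)) (N : (T -> R) -> R).
Hypothesis p1 : 1 <= p.
Hypothesis H : quasi_banach_function_space mu X N.
Implicit Types (f g h u v : T -> R).

Local Notation "f =ae g" := (ae_eq mu [set: T] f g) (at level 70).
Local Notation Y := (pspace p X).
Local Notation M := (pnorm p N).

Let HY : quasi_banach_function_space mu Y M.
Proof. exact: pspace_qbfs. Qed.
Let p_gt0 : 0 < p. Proof. exact: lt_le_trans p1. Qed.
Let p_neq0 : p != 0. Proof. by rewrite gt_eqF. Qed.
Let pV_neq0 : p^-1 != 0. Proof. by rewrite invr_eq0. Qed.
Let pV_gt0 : 0 < p^-1. Proof. by rewrite invr_gt0. Qed.

Let abstract_Lp_disjoint u v : abstract_Lp mu p X N -> Y u -> Y v ->
  (forall t, u t = 0 \/ v t = 0) -> M (u + v) = M u + M v.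
Proof.
move=> [_ _ _ disjX] Yu Yv uv.
have Xu := pspace_root p1 H Yu; have Xv := pspace_root p1 H Yv.
rewrite (pnorm_root p1 H Yu) (pnorm_root p1 H Yv) -(disjX _ _ Xu Xv); last first.
  apply: aeW => t; rewrite !norm_spow//.
  have [->|->] := uv t; rewrite normr0 powR0//.
    by rewrite min_l// powR_ge0.
  by rewrite min_r// powR_ge0.
rewrite (pnorm_root p1 H (fsD HY Yu Yv)); congr (N _ `^ p); apply/funext => t.
rewrite !addrfctE /spow; have [ut|vt] := uv t.
  by rewrite ut !add0r sgr0 mul0r add0r.
by rewrite vt !addr0 sgr0 mul0r addr0.
Qed.

Let additive_abstract_Lp : additive_on_cone Y M -> abstract_Lp mu p X N.
Proof.
move=> AL; have [conv _] := (additive_on_coneP p1 H).1 AL; split.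
- split; [exact: (qbfs_subspace H)|exact: (qbfs_quasi_norm H)| |exact: (qbfs_complete H)].
  exact: (p_convex1_subadditive p1 H conv).
- by move=> f; exact: (fs_norm H).
- by move=> f g Xf Xg; exact: (fn_le_ae H).
move=> f g Xf Xg fg0; have Yf := pspace_spow p1 H Xf; have Yg := pspace_spow p1 H Xg.
have Yfg := pspace_spow p1 H (fsD H Xf Xg).
have Yaf := fs_norm HY Yf; have Yag := fs_norm HY Yg.
rewrite -(pnorm_spow p1 H Xf) -(pnorm_spow p1 H Xg) -(pnorm_spow p1 H (fsD H Xf Xg)).
rewrite -(fn_norm HY Yf) -(fn_norm HY Yg) -(AL _ _ Yaf Yag (fun t => normr_ge0 _)
  (fun t => normr_ge0 _)).
apply: (fn_ae_norm HY Yfg (fsD HY Yaf Yag)).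
apply: filterS fg0 => t fgt; rewrite !addrfctE !norm_spow//.
rewrite [RHS]ger0_norm; last by apply: addr_ge0; exact: powR_ge0.
move: fgt; case: (leP `|f t| `|g t|) => _ /eqP;
  rewrite normr_eq0 => /eqP ->; rewrite normr0 powR0//.
  by rewrite !add0r.
by rewrite !addr0.
Qed.

(** The triangle inequality in Y is part of the Daugavet property; together with
    additivity on disjoint functions it gives additivity on the cone. *)
Lemma daugavet_abstract_LpP : daugavet_abstract_Lp mu p X N <->
  additive_on_cone Y M /\ daugavet_equation mu Y M.
Proof.
split=> [[abs [[_ _ sub _] DE]]|[AL DE]].
  split; last exact: DE.
  move=> u v Yu Yv u0 v0; apply/eqP; rewrite eq_le (sub _ _ Yu Yv) /=.
  apply: (disjoint_additive_superadditive HY) => //.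
  by move=> u' v' Yu' Yv' _ _; exact: (abstract_Lp_disjoint abs).
split; first exact: additive_abstract_Lp.
split; last exact: DE.
split; [exact: (qbfs_subspace HY)|exact: (qbfs_quasi_norm HY)| |exact: (qbfs_complete HY)].
exact: (al_subadditive HY AL).
Qed.

Let sum_convexificationP n (S : 'I_n -> (T -> R) -> T -> R) :
  (forall i h, Y h -> Y (S i h)) ->
  sup_norm X N (fun f => spow p^-1 (\sum_i spow p (convexification p (S i) f)))
    <= (\sum_i sup_norm X N (convexification p (S i)) `^ p) `^ p^-1
  <-> sup_norm Y M (fun h => \sum_i S i h) <= \sum_i sup_norm Y M (S i).
Proof.
move=> YS; have YSS h : Y h -> Y (\sum_i S i h).
  by move=> Yh; apply: (fs_sum HY) => i _; exact: YS.
have sup0 i : 0 <= sup_norm Y M (S i) by exact: (sup_norm_ge0 p1 H (YS i)).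
have supS0 := sup_norm_ge0 p1 H YSS.
have -> : \sum_i sup_norm X N (convexification p (S i)) `^ p =
    \sum_i sup_norm Y M (S i).
  apply: eq_bigr => i _; rewrite (sup_norm_convexification p1 H (YS i)).
  exact: (powRVK p_neq0 (sup0 i)).
rewrite (sup_norm_root p1 H YSS); last first.
  move=> f Xf; rewrite -(norm_root p1 H (YSS _ (pspace_spow p1 H Xf))).
  congr (N (spow _ _)); apply: eq_bigr => i _.
  by rewrite /convexification (spowVK p1).
have sum0 : 0 <= \sum_i sup_norm Y M (S i) by apply: sumr_ge0 => i _; exact: sup0.
split=> le_sup; last exact: (powR_monotone (ltW pV_gt0) supS0 le_sup).
rewrite -(powRVK p_neq0 supS0) -(powRVK p_neq0 sum0).
exact: (powR_monotone (ltW p_gt0) (powR_ge0 _ _) le_sup).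
Qed.

Let rank_one_stable S : rank_one_operator mu Y M S -> forall h, Y h -> Y (S h).
Proof. by move=> [opS _ _]; exact: (operator_stable opS). Qed.

(** The integral is a nonzero functional, and the inequality for finitely many
    operators is the triangle inequality in Y. *)
Lemma daugavet_concave : additive_on_cone Y M -> daugavet_equation mu Y M ->
  concave_daugavet mu p X N.
Proof.
move=> AL DE; have sub := al_subadditive HY AL; split.
- exists (cone_integral M); first exact: (cone_integral_functional HY AL).
  have [y Yy yN0] := qbfs_nonzero HY; exists (fun t => `|y t|); first exact: (fs_norm HY).
  rewrite (cone_integral_ge0 HY AL (fs_norm HY Yy) (fun t => normr_ge0 _)).
  by rewrite (fn_norm HY Yy) gt_eqF// (fn_gt0 HY).
- exact: (additive_on_cone_p_concave1 p1 H AL).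
- move=> n S rS; have YS i := rank_one_stable (rS i); split; last first.
    by move=> i; apply/(p_daugavet_equationP p1 H (YS i)); exact: DE.
  apply/(sum_convexificationP YS).
  apply: (sup_norm_le HY) => h Yh Mh.
  suff [_ MS] : Y (\sum_i S i h) /\ M (\sum_i S i h) <= \sum_i sup_norm Y M (S i).
    exact: MS.
  apply: (big_ind2 (fun w (a : R) => Y w /\ M w <= a)).
  + by split; [exact: (fs0 HY)|rewrite (fn0 HY)].
  + move=> w a w' a' [Yw Mw] [Yw' Mw']; split; first exact: (fsD HY).
    by apply: le_trans (sub _ _ Yw Yw') _; exact: lerD.
  + move=> i _; split; first exact: YS.
    have [opS _ _] := rS i; have [C CP] := operator_bounded HY opS.
    apply: (le_sup_norm (C := `|C|)) Yh Mh => k Yk Mk.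
    apply: le_trans (CP k Yk) _; apply: (@le_trans _ _ (`|C| * M k)).
      by apply: ler_wpM2r; [exact: (fn_ge0 HY Yk)|exact: ler_norm].
    by apply: ler_piMr; [exact: normr_ge0|exact: Mk].
Qed.

(** With T_i the tensor products of one functional with vectors y_i, the first
    inequality of the concave condition is the triangle inequality for the y_i. *)
Lemma concave_daugavet_convex : concave_daugavet mu p X N -> p_convex1 p X N.
Proof.
move=> [[phi phiF [h0 Yh0 phih0]] _ sums]; apply/(p_convex1P p1 H) => u v Yu Yv.
have L0 : 0 < dual_norm Y M phi.
  rewrite lt_neqAle (dual_norm_ge0 HY phiF) andbT eq_sym; apply/eqP => L0.
  have := dual_normP HY phiF Yh0; rewrite L0 mul0r normr_le0.
  by rewrite (negPf phih0).
have Yuv := fsD HY Yu Yv.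
have [u0|uN0] := pselect (u =ae cst 0).
  have -> : M (u + v) = M v.
    apply: (fn_ae HY Yuv Yv); apply: filterS u0 => t /(_ I) ut _.
    by rewrite addrfctE ut; exact: add0r.
  rewrite lerDr; exact: (fn_ge0 HY Yu).
have [v0|vN0] := pselect (v =ae cst 0).
  have -> : M (u + v) = M u.
    apply: (fn_ae HY Yuv Yu); apply: filterS v0 => t /(_ I) vt _.
    by rewrite addrfctE vt; exact: addr0.
  rewrite lerDl; exact: (fn_ge0 HY Yv).
pose y (i : 'I_2) : T -> R := if i == ord0 then u else v.
have Yy i : Y (y i) by rewrite /y; case: ifP.
have yN0 i : ~ (y i =ae cst 0) by rewrite /y; case: ifP.
pose S (i : 'I_2) (h : T -> R) : T -> R := phi h *: y i.
have rS i : rank_one_operator mu Y M (S i).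
  exact: (rank_one_tensor HY phiF L0 (Yy i) (yN0 i)).
have YS i := rank_one_stable (rS i).
have [ineq _] := sums 2 S rS.
have := (sum_convexificationP YS).1 ineq.
have -> : sup_norm Y M (fun h => \sum_i S i h) = dual_norm Y M phi * M (u + v).
  rewrite -(sup_norm_tensor HY phiF Yuv); apply: eq_sup_norm => h _.
  by rewrite sum_ord2 /S /y /= scalerDr.
have -> : \sum_i sup_norm Y M (S i) = dual_norm Y M phi * (M u + M v).
  rewrite sum_ord2 mulrDr; congr (_ + _).
    exact: (sup_norm_tensor HY phiF Yu).
  exact: (sup_norm_tensor HY phiF Yv).
by rewrite (ler_pM2l L0).
Qed.

Lemma concave_daugavet_convex_concave : concave_daugavet mu p X N ->
  convex_concave_daugavet mu p X N.
Proof.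
move=> hyp; have conv := concave_daugavet_convex hyp.
have [_ conc sums] := hyp; split; [exact: conv|exact: conc|] => S rS.
by have [_ /(_ ord0)] := sums 1%N (fun=> S) (fun=> rS).
Qed.

Lemma convex_concave_daugavetP : convex_concave_daugavet mu p X N ->
  additive_on_cone Y M /\ daugavet_equation mu Y M.
Proof.
move=> [conv conc DE]; split; first exact/(additive_on_coneP p1 H).
by move=> S rS; apply/(p_daugavet_equationP p1 H (rank_one_stable rS)); exact: DE.
Qed.

Lemma convex_concave_daugavet_slice_estimate :
  convex_concave_daugavet mu p X N -> convex_slice_estimate mu p X N.
Proof.
move=> /convex_concave_daugavetP[AL DE].
exact: (small_overlap_slice_estimate p1 H AL (daugavet_small_overlap HY AL DE)).
Qed.

Lemma slice_functional_abstract_Lp : convex_slice_functional mu p X N ->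
  daugavet_abstract_Lp mu p X N.
Proof.
move=> hyp; apply/daugavet_abstract_LpP; split.
  exact: (slice_functional_additive p1 H hyp).
exact: (slice_functional_daugavet p1 H hyp).
Qed.

Lemma small_overlap_abstract_Lp : additive_on_cone Y M -> small_overlap mu Y M ->
  daugavet_abstract_Lp mu p X N.
Proof.
move=> AL overlap; apply: slice_functional_abstract_Lp.
apply: (slice_estimate_functional p1 H).
exact: (small_overlap_slice_estimate p1 H AL overlap).
Qed.

Lemma abstract_Lp_concave_daugavet : daugavet_abstract_Lp mu p X N ->
  concave_daugavet mu p X N.
Proof. by move=> /daugavet_abstract_LpP[AL DE]; exact: daugavet_concave. Qed.

End Equivalences.

(** * Densities of functionals over atomless measures *)

Section DensityMeasure.
Context (R : realType) (d : measure_display) (T : measurableType d).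
Context (mu : {measure set T -> \bar R}).
Context (Y : set (T -> R)) (M : (T -> R) -> R).
Hypothesis H : quasi_banach_function_space mu Y M.
Hypothesis AL : additive_on_cone Y M.
Implicit Types (f g h u v w : T -> R) (A B : set T).

Local Notation "f =ae g" := (ae_eq mu [set: T] f g) (at level 70).

Definition cut e A : T -> R := fun t => e t * \1_A t.

Lemma fs_cut e A : Y e -> measurable A -> Y (cut e A).
Proof.
move=> Ye mA; apply: (fs_ideal H Ye).
  by apply: measurable_funM; [exact: (fs_meas H)|exact: measurable_indic].
move=> t; rewrite /cut normrM ler_piMr// indicE.
by case: (t \in A); rewrite ?normr1// normr0.
Qed.

Lemma cut_ge0 e A : (forall t, 0 <= e t) -> forall t, 0 <= cut e A t.
Proof. by move=> e0 t; rewrite mulr_ge0// indicE. Qed.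

Lemma cutT e : cut e [set: T] = e.
Proof. by apply/funext => t; rewrite /cut indicT mulr1. Qed.

Lemma cut0 e : cut e set0 = cst 0.
Proof. by apply/funext => t; rewrite /cut indic0 mulr0. Qed.

Lemma cutU e A B : A `&` B = set0 -> cut e (A `|` B) = cut e A + cut e B.
Proof.
move=> AB; apply/funext => t; rewrite addrfctE /cut -mulrDr; congr (_ * _).
rewrite !indicE in_setU; case: (boolP (t \in A)) => tA; case: (boolP (t \in B)) => tB;
  rewrite ?addr0 ?add0r//.
have : (A `&` B) t by split; exact: set_mem.
by rewrite AB.
Qed.

Lemma cutD e A B : B `<=` A -> cut e A = cut e B + cut e (A `\` B).
Proof. by move=> BA; rewrite -cutU ?setDUK// setDE setICA setICr setI0. Qed.

(** Countable additivity is monotone convergence for the norm. *)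
Lemma density_measure e : Y e -> (forall t, 0 <= e t) ->
  exists nu : {measure set T -> \bar R},
    forall A, measurable A -> nu A = (M (cut e A))%:E.
Proof.
move=> Ye e0.
(* The absolute value makes nu nonnegative also on non-measurable sets. *)
pose nu A : \bar R := (`|M (cut e A)|)%:E.
have nuE A : measurable A -> nu A = (M (cut e A))%:E.
  by move=> mA; rewrite /nu ger0_norm//; apply: (fn_ge0 H); exact: fs_cut.
have nu0 : nu set0 = 0%E by rewrite /nu cut0 (fn0 H) normr0.
have nu_ge0 A : (0 <= nu A)%E by rewrite lee_fin.
have nu_additive : semi_sigma_additive nu.
  move=> F mF tF mUF; pose u n := cut e (\big[setU/set0]_(i < n) F i).
  have mU n : measurable (\big[setU/set0]_(i < n) F i) by exact: bigsetU_measurable.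
  have Yu n : Y (u n) by exact: (fs_cut Ye (mU n)).
  have Mu n : M (u n) = \sum_(i < n) M (cut e (F i)).
    elim: n => [|n IH]; first by rewrite /u !big_ord0 cut0 (fn0 H).
    rewrite /u !big_ord_recr /= cutU; last first.
      rewrite -bigcup_mkord; apply/seteqP; split => // t [[i /= ilt Fit] Fnt].
      by have := ltn_eqF ilt; rewrite (tF i n)// ?eqxx//; exists t.
    rewrite AL; [|exact: (fs_cut Ye (mU n))|exact: (fs_cut Ye (mF n))|exact: cut_ge0|exact: cut_ge0].
    by congr (_ + _); exact: IH.
  have sub_bigcup n : \big[setU/set0]_(i < n) F i `<=` \bigcup_i F i.
    by rewrite -bigcup_mkord => t [i _ Fit]; exists i.
  have le_cut A B t : A `<=` B -> cut e A t <= cut e B t.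
    move=> AB; rewrite /cut ler_wpM2l// !indicE.
    by case: (boolP (t \in A)) => // /set_mem/AB/mem_set ->.
  have [_ cvgM] : Y (cut e (\bigcup_i F i)) /\
      M (u n) @[n --> \oo] --> M (cut e (\bigcup_i F i)).
    apply: (al_monotone_convergence H AL (C := M e)) => //.
    - by move=> n t; exact: cut_ge0.
    - by move=> t n m nm; apply: le_cut; exact: subset_bigsetU.
    - move=> t; case: (pselect ((\bigcup_i F i) t)) => [[k _ Fkt]|nFt].
        apply: cvg_near_cst; exists k.+1 => // n kn.
        rewrite /u /cut !indicE mem_set ?mem_set//; first by exists k.
        by rewrite -bigcup_mkord; exists k.
      apply: cvg_near_cst; apply: nearW => n; rewrite /u /cut !indicE.
      by rewrite !memNset// => /sub_bigcup.
    - move=> n; apply: (fn_le H) => // t; rewrite !ger0_norm//; last exact: cut_ge0.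
      by rewrite -[leRHS]/(e t) -[in leRHS](cutT e); exact: le_cut.
  rewrite nuE//; have -> : (fun n => \sum_(0 <= i < n) nu (F i))%E = EFin \o (M \o u).
    apply/funext => n; rewrite big_mkord /= Mu -sumEFin.
    by apply: eq_bigr => i _; rewrite nuE.
  apply: cvg_EFin; last exact: cvgM.
  exact: nearW.
pose nuM := isMeasure.Build d T R nu nu0 nu_ge0 nu_additive.
pose nu' : {measure set T -> \bar R} := HB.pack nu nuM.
by exists nu'.
Qed.

Lemma cut_null e A : Y e -> measurable A -> (forall t, 0 < e t) ->
  M (cut e A) = 0 -> mu A = 0%E.
Proof.
move=> Ye mA e0 M0; apply/negligibleP => //.
apply: negligibleS (fn_eq0 H (fs_cut Ye mA) M0) => t At /= /(_ I).
rewrite /cut indicE mem_set// mulr1 => et.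
by have := e0 t; rewrite et ltxx.
Qed.

(** Only the set where e is positive matters, and there nu and mu have the same
    null sets. *)
Lemma density_atomless e (nu : {measure set T -> \bar R}) : atomless mu ->
  Y e -> (forall t, 0 <= e t) ->
  (forall A, measurable A -> nu A = (M (cut e A))%:E) -> atomless nu.
Proof.
move=> mu_atomless Ye e0 nuE A mA nuA.
pose P := [set t | 0 < e t].
have mP : measurable P.
  have := measurable_fun_ltr (@measurable_cst _ _ T R [set: T] 0) (fs_meas H Ye).
  by move=> /(_ measurableT [set true]); rewrite setTI; apply.
have mAP : measurable (A `&` P) by exact: measurableI.
have pos B : measurable B -> B `<=` P -> (0 < mu B)%E -> (0 < nu B)%E.
  move=> mB BP muB; rewrite lt0e measure_ge0 andbT; apply/eqP => nuB.
  suff : mu B = 0%E by move=> muB0; rewrite muB0 ltxx in muB.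
  apply/negligibleP => //.
  have MB : M (cut e B) = 0 by apply: EFin_inj; rewrite -nuE.
  apply: negligibleS (fn_eq0 H (fs_cut Ye mB) MB) => t Bt /= /(_ I).
  rewrite /cut indicE mem_set// mulr1 => et.
  by have := BP t Bt; rewrite /P /= et ltxx.
have muAP : (0 < mu (A `&` P))%E.
  rewrite lt0e measure_ge0 andbT; apply/eqP => muAP.
  suff : nu A = 0%E by move=> nuA0; rewrite nuA0 ltxx in nuA.
  rewrite nuE//; congr EFin; apply: (fn_ae0 H); first exact: fs_cut.
  have /negligibleP/negligibleS := muAP; apply => // t /= nt.
  apply: contrapT => nAP; apply: nt => _; rewrite /cut indicE.
  case: (boolP (t \in A)) => [/set_mem At|_]; last by rewrite mulr0.
  rewrite mulr1; apply/eqP; rewrite eq_le e0 andbT leNgt; apply/negP => et.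
  exact: nAP.
have [B [mB BAP] [muB muAB]] := mu_atomless _ mAP muAP.
exists B; first by split => // t /BAP[].
split; first by apply: pos => // t /BAP[].
apply: (@lt_le_trans _ _ (nu ((A `&` P) `\` B))).
  by apply: pos => //; [exact: measurableD|move=> t [[]]].
apply: le_measure; rewrite ?inE; [exact: measurableD|exact: measurableD|].
by move=> t [[At _] nBt].
Qed.

(** A set on which phi almost attains its norm along h keeps this property on one
    of the two halves of any splitting, so one can repeatedly halve the mass that
    the set has for the density e. *)
Lemma atomless_small_overlap : atomless mu -> small_overlap mu Y M.
Proof.
move=> mu_atomless phi [phiF phi1] e0 Ye0 delta' eps delta'0 eps0.
have [delta [delta0 delta_le delta_half]] := min_half delta'0.
pose e t := `|e0 t|; have Ye : Y e by exact: (fs_norm H).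
have e_ge0 t : 0 <= e t by exact: normr_ge0.
have [nu nuE] := density_measure Ye e_ge0.
have nu_atomless := density_atomless mu_atomless Ye e_ge0 nuE.
have nu_fin : (nu [set: T] < +oo)%E by rewrite nuE// ltry.
have lt1 : 1 - delta < dual_norm Y M phi by rewrite phi1; lra.
have [h [Yh Mh phih]] := dual_norm_lt H phiF lt1.
have McutD A B : measurable A -> measurable B -> B `<=` A ->
    M (cut h A) = M (cut h B) + M (cut h (A `\` B)).
  move=> mA mB BA; have YB := fs_cut Yh mB.
  have YD := fs_cut Yh (measurableD mA mB).
  rewrite -(fn_norm H YB) -(fn_norm H YD) -AL//;
    [|exact: (fs_norm H)|exact: (fs_norm H)].
  rewrite -(fn_norm H (fs_cut Yh mA)); congr M; apply/funext => t.
  rewrite addrfctE (cutD h BA) addrfctE /cut !indicE in_setD.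
  by case: (t \in B); rewrite /= ?andbF ?mulr0 ?addr0 ?add0r ?normr0 ?addr0 ?add0r.
pose good A := measurable A /\ (1 - delta) * M (cut h A) < phi (cut h A).
have halving (n : nat) : exists2 A, good A &
    fine (nu A) <= (2 / 3) ^+ n * fine (nu [set: T]).
  elim: n => [|n [A [mA goodA] nuA]].
    exists [set: T]; last by rewrite expr0 mul1r.
    split; first exact: measurableT.
    rewrite cutT; apply: le_lt_trans phih.
    by rewrite ler_piMr// subr_ge0; lra.
  have [B [mB BA nuB nuAB]] := atomless_split nu_atomless nu_fin mA.
  have mAB : measurable (A `\` B) by exact: measurableD.
  have step : 2 / 3 * fine (nu A) <= (2 / 3) ^+ n.+1 * fine (nu [set: T]).
    by rewrite exprS -[leRHS]mulrA; apply: ler_wpM2l => //; rewrite divr_ge0.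
  have [gB|gB] := ltP ((1 - delta) * M (cut h B)) (phi (cut h B)).
    by exists B => //; exact: le_trans nuB step.
  exists (A `\` B); last exact: le_trans nuAB step.
  split => //; move: goodA; rewrite (McutD A B)// (cutD h BA).
  rewrite (functionalD phiF); [|exact: fs_cut|exact: fs_cut].
  by move: gB; lra.
have [n nP] : exists n : nat, (2 / 3) ^+ n * fine (nu [set: T]) <= eps.
  have : (2 / 3 : R) ^+ n * fine (nu [set: T]) @[n --> \oo] --> (0 * fine (nu [set: T]) : R).
    apply: cvgM; last exact: cvg_cst.
    by apply: cvg_expr; rewrite ger0_norm ?divr_ge0//; lra.
  rewrite mul0r => /cvgrPdist_lt/(_ eps eps0)[n _ /(_ n (leqnn n))].
  rewrite sub0r normrN => /ltW h'; exists n; apply: le_trans h'; exact: ler_norm.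
have [A [mA goodA] nuA] := halving n.
have YA := fs_cut Yh mA.
have MA : 0 < M (cut h A).
  rewrite lt_neqAle (fn_ge0 H YA) andbT eq_sym; apply/eqP => MA0.
  move: goodA; rewrite MA0 mulr0; have := dual_normP H phiF YA.
  by rewrite MA0 mulr0 normr_le0 => /eqP ->; rewrite ltxx.
have MV : 0 <= (M (cut h A))^-1 by rewrite invr_ge0 ltW.
have YV : Y ((M (cut h A))^-1 *: cut h A) by exact: (fsZ H).
exists ((M (cut h A))^-1 *: cut h A); split => //.
- by rewrite (fnZ H)// ger0_norm// mulVf// gt_eqF.
- apply: (slice_mono delta_le); rewrite (functionalZ H phiF)//.
  by rewrite [leRHS]mulrC ler_pdivlMr// ltW.
apply: (@le_trans _ _ (M (cut e A))); last first.
  have fin_nu : nu A = (fine (nu A))%:E by rewrite nuE.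
  by rewrite -lee_fin -nuE// fin_nu lee_fin; exact: le_trans nuA nP.
apply: (fn_le H) => [||t]; [exact: (fs_min H)|exact: fs_cut|].
rewrite ger0_norm ?le_min ?normr_ge0// [leRHS]ger0_norm; last exact: cut_ge0.
rewrite [X in Num.min X _](_ : _ = (M (cut h A))^-1 * (`|h t| * \1_A t)); last first.
  rewrite [LHS](_ : _ = `|(M (cut h A))^-1 * (h t * \1_A t)|)// !normrM.
  by rewrite (ger0_norm MV) [`|\1_A t|]ger0_norm// indicE.
rewrite /cut indicE; case: (t \in A) => /=; last by rewrite !mulr0 min_l.
by rewrite !mulr1 ge_min /e lexx orbT.
Qed.

End DensityMeasure.

(** * Atoms *)

Section Atoms.
Context (R : realType) (d : measure_display) (T : measurableType d).
Context (mu : {measure set T -> \bar R}).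

Definition atom (A : set T) : Prop :=
  [/\ measurable A, (0 < mu A)%E &
    forall B, measurable B -> B `<=` A -> mu B = 0%E \/ mu (A `\` B) = 0%E].

Lemma not_atomless : ~ atomless mu -> exists A, atom A.
Proof.
move=> nat; apply: contrapT => no_atom; apply: nat => A mA muA.
apply: contrapT => nosplit; apply: no_atom; exists A; split => // B mB BA.
have [B0|BN0] := eqVneq (mu B) 0%E; [by left|right].
apply: contrapT => /eqP ABN0; apply: nosplit; exists B => //.
by split; rewrite lt0e measure_ge0 ?BN0 ?ABN0.
Qed.

(** The constant is the supremum of the q for which the part of A where h < q is
    null. *)
Lemma atom_constant (A : set T) (h : T -> R) : atom A ->
  measurable_fun [set: T] h ->
  exists c : R, {ae mu, forall t, A t -> h t = c}.
Proof.
move=> [mA muA atomA] mh; pose L (q : R) := A `&` [set t | h t < q].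
have mL q : measurable (L q).
  apply: measurableI => //.
  have := measurable_fun_ltr mh (@measurable_cst _ _ T R [set: T] q).
  by move=> /(_ measurableT [set true]); rewrite setTI; apply.
have LA q : L q `<=` A by move=> t [].
have dicho q : mu.-negligible (L q) \/ mu.-negligible (A `\` L q).
  have [h0|h0] := atomA _ (mL q) (@LA q); [left|right]; apply/negligibleP => //.
  exact: measurableD.
have nA : ~ mu.-negligible A.
  by move=> /negligibleP => /(_ mA) A0; rewrite A0 ltxx in muA.
have Lmono q r : q <= r -> L q `<=` L r.
  by move=> qr t [At /= ht]; split => //=; exact: lt_le_trans ht qr.
pose Q := [set q | mu.-negligible (L q)].
have Q0 : Q !=set0.
  apply: contrapT => nQ; apply: nA.
  have negl n : mu.-negligible (A `\` L (- (n%:R : R))).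
    by have [negl|//] := dicho (- n%:R); exfalso; apply: nQ; exists (- n%:R).
  apply: negligibleS (negligible_bigcup negl) => t At.
  exists (Num.truncn `|h t|).+1 => //; split => //= -[_ /=].
  rewrite ltNge => /negP; apply.
  have := truncnS_gt `|h t|; have := ler_norm (- h t); rewrite normrN; lra.
have Qub : has_ubound Q.
  have [n nQn] : exists n : nat, ~ Q n%:R.
    apply: contrapT => allQ; apply: nA.
    have negl n : mu.-negligible (L n%:R).
      by apply: contrapT => nQn; apply: allQ; exists n.
    apply: negligibleS (negligible_bigcup negl) => t At.
    exists (Num.truncn (h t)).+1 => //; split => //=; exact: truncnS_gt.
  exists n%:R => q Qq; rewrite leNgt; apply/negP => nq; apply: nQn.
  by apply: negligibleS Qq; exact/Lmono/ltW.
have hQ : has_sup Q by split.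
pose c : R := sup Q; exists c.
have inv_pos (n : nat) : 0 < (n.+1%:R : R)^-1 by rewrite invr_gt0.
have below n : mu.-negligible (L (c - (n.+1%:R : R)^-1)).
  have [q Qq cq] := sup_adherent (inv_pos n) hQ.
  by apply: negligibleS Qq; apply: Lmono; exact: ltW.
have above n : mu.-negligible (A `\` L (c + (n.+1%:R : R)^-1)).
  have [Qc|//] := dicho (c + (n.+1%:R : R)^-1).
  exfalso; have := ub_le_sup Qub Qc; rewrite -/c.
  by have := inv_pos n; move: (_^-1) => k; lra.
apply: negligibleS (negligibleU (negligible_bigcup below) (negligible_bigcup above)).
move=> t /= nt; have [At htc] : A t /\ h t <> c by apply/not_implyP.
have small_inv (e : R) : 0 < e -> exists n : nat, (n.+1%:R : R)^-1 < e.
  move=> e0; have := near_infty_natSinv_lt (PosNum e0).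
  by case=> n _ /(_ n (leqnn n)); exists n.
have [ht|ht|//] := ltgtP (h t) c.
  have [n ne] := small_inv (c - h t) ltac:(lra).
  by left; exists n => //; split => //=; move: (_^-1) ne => k; lra.
have [n ne] := small_inv (h t - c) ltac:(lra).
right; exists n => //; split => // -[_ /=].
by move: (_^-1) ne => k; lra.
Qed.

End Atoms.

Section AtomDaugavet.
Context (R : realType) (d : measure_display) (T : measurableType d).
Context (mu : {measure set T -> \bar R}).
Context (Y : set (T -> R)) (M : (T -> R) -> R).
Hypothesis H : quasi_banach_function_space mu Y M.
Hypothesis DE : daugavet_equation mu Y M.
Hypothesis Y1 : Y (cst 1).

Local Notation "f =ae g" := (ae_eq mu [set: T] f g) (at level 70).

(** On an atom A all functions are constant, so that T h = - h 1_A has rank one;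
    but Id + T, being a contraction, does not have norm 2. *)
Lemma daugavet_atomless : atomless mu.
Proof.
apply: contrapT => /not_atomless[A atomA]; have [mA muA _] := atomA.
pose S (h : T -> R) : T -> R := - cut h A.
have YS h : Y h -> Y (S h) by move=> Yh; apply: (fsN H); exact: (fs_cut H).
have Slin c h k : S (c *: h + k) = c *: S h + S k.
  apply/funext => t; change (- ((c * h t + k t) * \1_A t)
    = c * - (h t * \1_A t) - k t * \1_A t); ring.
have Scut h : Y h -> M (S h) = M (cut h A).
  by move=> Yh; apply: (fnN H); exact: (fs_cut H).
have Sle h : Y h -> M (S h) <= M h.
  move=> Yh; rewrite Scut//; apply: (fn_le H) => [||t] //; first exact: (fs_cut H).
  rewrite /cut normrM ler_piMr// indicE.
  by case: (t \in A); rewrite ?normr1// normr0.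
pose y : T -> R := cut (cst 1) A; have Yy : Y y by exact: (fs_cut H).
have yN0 : ~ (y =ae cst 0).
  move=> y0; have : mu A = 0%E.
    apply/negligibleP => //; apply: negligibleS y0 => t At /= /(_ I).
    by rewrite /y /cut indicE mem_set// mulr1 => /eqP; rewrite oner_eq0.
  by move=> A0; rewrite A0 ltxx in muA.
have My := fn_gt0 H Yy yN0.
have SyE : S y = - y.
  apply/funext => t; change (- ((1 : R) * \1_A t * \1_A t) = - ((1 : R) * \1_A t)).
  by rewrite indicE; case: (t \in A); rewrite ?mulr1// !mulr0.
have rS : rank_one_operator mu Y M S.
  split.
  - split => //.
    + move=> h k Yh Yk; apply: filterS => t /(_ I) hk _.
      by change (- (h t * \1_A t) = - (k t * \1_A t)); rewrite hk.
    + by move=> c h k Yh Yk; rewrite Slin; exact: ae_eq_refl.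
    + move=> h Yh e e0; exists e => // k Yk; apply: le_lt_trans.
      have -> : S k - S h = S (k - h).
        apply/funext => t; change (- (k t * \1_A t) - - (h t * \1_A t)
          = - ((k t - h t) * \1_A t)); ring.
      by apply: Sle; exact: (fsB H).
  - exists y => // Sy0; apply: yN0; apply: filterS Sy0 => t /(_ I).
    rewrite SyE; change (- y t = 0 -> True -> y t = 0).
    by move=> /eqP; rewrite oppr_eq0 => /eqP.
  - exists y => // h Yh; have [c hc] := atom_constant atomA (fs_meas H Yh).
    exists (- c); apply: filterS hc => t hc _.
    change (- (h t * \1_A t) = - c * ((1 : R) * \1_A t)); rewrite indicE.
    case: (boolP (t \in A)) => [/set_mem At|_]; last by rewrite !mulr0 oppr0.
    by rewrite hc// !mulr1.
have := DE rS; apply/eqP; rewrite lt_eqF//.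
have bound h : Y h -> M h <= 1 -> M (S h) <= 1.
  by move=> Yh; apply: le_trans; exact: Sle.
have MV : 0 < (M y)^-1 by rewrite invr_gt0.
have supS : 1 <= sup_norm Y M S.
  have YV : Y ((M y)^-1 *: y) by exact: (fsZ H).
  have MVy : M ((M y)^-1 *: y) = 1 by rewrite (fnZ H)// gtr0_norm// mulVf// gt_eqF.
  have -> : 1 = M (S ((M y)^-1 *: y)).
    have -> : S ((M y)^-1 *: y) = - ((M y)^-1 *: y).
      have := Slin (M y)^-1 y (cst 0).
      have -> : (M y)^-1 *: y + cst 0 = (M y)^-1 *: y by exact: addr0.
      move=> ->; rewrite SyE scalerN; apply/funext => t.
      change (- ((M y)^-1 * y t) - 0 * \1_A t = - ((M y)^-1 * y t)); ring.
    by rewrite (fnN H).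
  by apply: (le_sup_norm bound) => //; rewrite MVy.
apply: (@le_lt_trans _ _ 1); last by lra.
apply: (sup_norm_le H) => h Yh Mh; apply: le_trans Mh.
apply: (fn_le H) => [||t] //; first by apply: (fsD H) => //; exact: YS.
change (`|h t - h t * \1_A t| <= `|h t|); rewrite indicE.
by case: (t \in A); rewrite ?mulr1 ?subrr ?normr0// mulr0 subr0.
Qed.

End AtomDaugavet.

(** * The measure given by the norm *)

From mathcomp Require Import finmap.
Import HBNNSimple.

Section DensityIntegral.
Context (R : realType) (d : measure_display) (T : measurableType d).
Context (mu : {measure set T -> \bar R}).
Context (Y : set (T -> R)) (M : (T -> R) -> R).
Hypothesis H : quasi_banach_function_space mu Y M.
Hypothesis AL : additive_on_cone Y M.
Hypothesis Y1 : Y (cst 1).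
Context (nu : {measure set T -> \bar R}).
Hypothesis nuE : forall A, measurable A -> nu A = (M (cut (cst 1) A))%:E.
Implicit Types (g : T -> R).

Let nnsfun_density (s : {nnsfun T >-> R}) :
  Y s /\ (\int[nu]_x (s x)%:E = (M s)%:E)%E.
Proof.
pose rs := fset_set (range s).
have fin_s : finite_set (range s) by exact: fimfunP.
pose P r := s @^-1` [set r].
have mP r : measurable (P r) by exact: measurable_sfunP.
pose u r : T -> R := `|r| *: cut (cst 1) (P r).
have Yu r : Y (u r) by apply: (fsZ H); exact: (fs_cut H).
have u0 r t : 0 <= u r t.
  by apply: mulr_ge0 => //; apply: mulr_ge0 => //; rewrite indicE.
have rs0 r : r \in rs -> `|r| = r.
  by rewrite in_fset_set// => /set_mem[t _ <-]; rewrite ger0_norm.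
have sE : (s : T -> R) = \sum_(r <- rs) u r.
  apply/funext => t; rewrite fimfunE fsbig_finite// fct_sumE.
  apply: eq_big_seq => r /rs0 rE.
  by rewrite [RHS](_ : _ = `|r| * (1 * \1_(P r) t))// rE mul1r.
split; first by rewrite sE; exact: (fs_sum H).
have -> : M s = \sum_(r <- rs) M (u r).
  by rewrite -(al_sum H AL _ Yu u0); congr M; exact: sE.
rewrite integralT_nnsfun sintegralE fsbig_finite// -sumEFin.
apply: eq_big_seq => r /rs0 rE; rewrite (nuE (mP r)) (fnZ H _ (fs_cut H Y1 (mP r))).
by rewrite normr_id rE EFinM.
Qed.

(** Both sides are continuous along the increasing approximation by simple
    functions, the left one by monotone convergence for nu and the right one by
    monotone convergence in Y. *)
Lemma density_integral g : measurable_fun [set: T] g -> (forall t, 0 <= g t) ->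
  Y g \/ (\int[nu]_x (g x)%:E < +oo)%E ->
  Y g /\ (\int[nu]_x (g x)%:E = (M g)%:E)%E.
Proof.
move=> mg g0 hyp.
have mgE : measurable_fun [set: T] (EFin \o g) by exact/measurable_EFinP.
pose s := nnsfun_approx measurableT mgE.
have Ys n : Y (s n) := (nnsfun_density (s n)).1.
have intE n : (\int[nu]_x (s n x)%:E = (M (s n))%:E)%E := (nnsfun_density (s n)).2.
have s_nd t : {homo (fun n => s n t) : n m / (n <= m)%N >-> n <= m}.
  by move=> n m nm; have /lefP := nd_nnsfun_approx measurableT mgE nm; exact.
have cvg_s t : s n t @[n --> \oo] --> g t.
  have := @cvg_nnsfun_approx _ _ _ _ measurableT _ mgE
    (fun x _ => g0 x : (0 <= (EFin \o g) x)%E) t Logic.I.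
  by move/fine_cvgP => [_].
have s_le n t : s n t <= g t.
  by apply: (cvgr_to_ge (cvg_s t)); near=> m; apply: s_nd; near: m; exact: nbhs_infty_ge.
have cvg_int : (\int[nu]_x (s n x)%:E @[n --> \oo] --> \int[nu]_x (g x)%:E)%E.
  have -> : (\int[nu]_x (g x)%:E = \int[nu]_x (limn (fun n => (s n x)%:E)))%E.
    apply: eq_integral => t _; apply/esym/cvg_lim => //.
    by apply: cvg_EFin; [exact: nearW|exact: cvg_s].
  apply: cvg_monotone_convergence => //.
  - by move=> n; apply/measurable_EFinP.
  - by move=> n t _; rewrite lee_fin.
  - by move=> t _ n m nm; rewrite lee_fin; exact: s_nd.
have [C MC] : exists C, forall n, M (s n) <= C.
  case: hyp => [Yg|int_fin].
    exists (M g) => n; apply: (fn_le H) => // t.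
    by rewrite !ger0_norm//; exact: s_le.
  have int0 : (0 <= \int[nu]_x (g x)%:E)%E by apply: integral_ge0 => t _; rewrite lee_fin.
  exists (fine (\int[nu]_x (g x)%:E)) => n.
  rewrite -lee_fin fineK ?ge0_fin_numE// -intE; apply: ge0_le_integral => //.
  - by move=> t _; rewrite lee_fin.
  - exact/measurable_EFinP.
  - by move=> t _; rewrite lee_fin; exact: s_le.
have [Yg cvgM] : Y g /\ M (s n) @[n --> \oo] --> M g.
  apply: (al_monotone_convergence H AL (C := C)) => //.
split => //.
have cvg2 : (\int[nu]_x (s n x)%:E @[n --> \oo] --> (M g)%:E)%E.
  have -> : (fun n => \int[nu]_x (s n x)%:E)%E = EFin \o (fun n => M (s n)).
    by apply/funext => n; rewrite intE.
  by apply: cvg_EFin; [exact: nearW|exact: cvgM].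
by rewrite -(cvg_lim _ cvg_int)// (cvg_lim _ cvg2).
Unshelve. all: by end_near.
Qed.

(** The density does not vanish on a non-null set A, because nu A is the norm of
    the indicator of A. *)
Lemma radon_nikodym_density : sigma_finite [set: T] mu ->
  exists h : T -> R, [/\ mu.-integrable [set: T] (EFin \o h),
    {ae mu, forall t, 0 < h t} &
    forall A, measurable A -> nu A = (\int[mu]_(t in A) (h t)%:E)%E].
Proof.
move=> sf.
have nu_fin : fin_num_fun nu by move=> A mA; rewrite nuE.
pose S1 := isSFinite.Build _ _ _ _ (sfinite_measure_sigma_finite sf).
pose S2 := isSigmaFinite.Build _ _ _ _ sf.
pose mu' := HB.pack_for (SigmaFiniteMeasure.type T R) (Measure.sort mu) S1 S2.
have nu_sf : sigma_finite [set: T] nu.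
  by apply: fin_num_fun_sigma_finite => //; rewrite measure0.
pose F1 := isFinite.Build _ _ _ _ nu_fin.
pose F2 := isSFinite.Build _ _ _ _ (sfinite_measure_sigma_finite nu_sf).
pose F3 := isSigmaFinite.Build _ _ _ _ nu_sf.
pose nu' := HB.pack_for (FiniteMeasure.type T R) (Measure.sort nu) F1 F2 F3.
have dom : nu' `<< mu'.
  apply/null_content_dominatesP => A mA muA; change (nu A = 0%E).
  rewrite nuE//; congr EFin; apply: (fn_ae0 H); first exact: (fs_cut H).
  have /negligibleP/negligibleS := muA; apply => // t /= nt.
  by apply: contrapT => nAt; apply: nt => _; rewrite /cut indicE memNset// mulr0.
have [f [f0 ffin fint nuf]] := radon_nikodym_sigma_finite dom.
pose h t := fine (f t); have fE t : f t = (h t)%:E by rewrite /h fineK.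
have mf := measurable_int _ fint.
have mh : measurable_fun [set: T] h by exact: measurableT_comp.
have h0 t : 0 <= h t by exact/fine_ge0/f0.
have hE : EFin \o h = f by apply/funext => t; rewrite /= -fE.
exists h; split; [by rewrite hE| |by move=> A mA; under eq_integral do rewrite -fE; exact: nuf].
pose Z := [set t | h t <= 0].
have mZ : measurable Z.
  have := measurable_fun_ler mh (@measurable_cst _ _ T R [set: T] 0).
  by move=> /(_ measurableT [set true]); rewrite setTI; apply.
have nuZ : nu Z = 0%E.
  rewrite [LHS](nuf _ mZ); apply: integral0_eq => t Zt.
  by rewrite fE; congr EFin; apply/eqP; rewrite eq_le h0 andbT.
have muZ : mu Z = 0%E.
  by apply: (cut_null H Y1 mZ) => //; apply: EFin_inj; rewrite -nuE.
have /negligibleP/negligibleS := muZ; apply => // t /= nt.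
by rewrite /Z /= leNgt; exact/negP.
Qed.

End DensityIntegral.

(** * Weighted L^p spaces *)

Section WeightedLp.
Context (R : realType) (d : measure_display) (T : measurableType d).
Context (mu : {measure set T -> \bar R}) (p : R).
Context (X : set (T -> R)) (N : (T -> R) -> R).
Hypothesis p1 : 1 <= p.
Hypothesis H : quasi_banach_function_space mu X N.
Implicit Types (f h w : T -> R).

Local Notation Y := (pspace p X).
Local Notation M := (pnorm p N).

Let HY : quasi_banach_function_space mu Y M.
Proof. exact: pspace_qbfs. Qed.
Let p_gt0 : 0 < p. Proof. exact: lt_le_trans p1. Qed.
Let p_neq0 : p != 0. Proof. by rewrite gt_eqF. Qed.

Let Lnorm_integral (nu : {measure set T -> \bar R}) f :
  ('N[nu]_p%:E[EFin \o f] `^ p = \int[nu]_x (`|f x| `^ p)%:E)%E.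
Proof.
by rewrite powR_Lnorm//; apply: eq_integral => t _; rewrite /= poweR_EFin.
Qed.

(** The measure A |-> M(1_A) has a density with respect to mu by the
    Radon-Nikodym theorem, and its integral of |f|^p is M(|f|^p) = N(f)^p. *)
Lemma abstract_Lp_weighted : sigma_finite [set: T] mu -> X (cst 1) ->
  daugavet_abstract_Lp mu p X N -> weighted_Lp_atomless mu p X N.
Proof.
move=> sf X1 /(daugavet_abstract_LpP p1 H)[AL DE].
have Y1 : Y (cst 1).
  have -> : cst 1 = (fun t : T => `|cst 1 t| `^ p) :> (T -> R).
    by apply/funext => t; rewrite /= normr1 powR1.
  exact: (pspace_abs_power p1 H X1).
split; last exact: (daugavet_atomless HY DE Y1).
have [nu nuE] := density_measure HY AL Y1 (fun=> ler01).
have [h [hint h0 nuh]] := radon_nikodym_density HY Y1 nuE sf.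
have mpow f : measurable_fun [set: T] f ->
    measurable_fun [set: T] (fun t => `|f t| `^ p).
  exact: measurable_norm_powR.
have int_X f : X f -> (\int[nu]_x (`|f x| `^ p)%:E = (N f `^ p)%:E)%E.
  move=> Xf; rewrite -(pnorm_abs_power p1 H Xf).
  have [] // := density_integral HY AL Y1 nuE (mpow f (fs_meas H Xf))
    (fun t => powR_ge0 _ _) (or_introl (pspace_abs_power p1 H Xf)).
have NE f : X f -> (N f)%:E = ('N[nu]_p%:E[EFin \o f])%E.
  move=> Xf; have := int_X f Xf; rewrite -Lnorm_integral => /(congr1 (fun x => x `^ p^-1)%E).
  rewrite -poweRrM divff// poweRe1 ?Lnorm_ge0// => ->.
  by rewrite poweR_EFin powRKV// (fn_ge0 H Xf).
exists h, nu; split => //; apply/seteqP; split => f /=.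
  move=> Xf; apply/andP; split; apply/mem_set; first exact: (fs_meas H Xf).
  by rewrite /= /finite_norm -(NE f Xf) ltry.
move=> /andP[/set_mem /= mf /set_mem fin_f].
have int_f : (\int[nu]_x (`|f x| `^ p)%:E < +oo)%E.
  by rewrite -Lnorm_integral poweR_lty.
have [[_ Xf] _] := density_integral HY AL Y1 nuE (mpow f mf)
    (fun t => powR_ge0 _ _) (or_intror int_f).
apply: (fs_ideal H Xf mf) => t.
by rewrite (ger0_norm (powR_ge0 _ p^-1)) (ger0_norm (powR_ge0 _ p)) powRKV.
Qed.

(** Here M is the L^1 norm of the weighted measure, which is additive on the
    cone. *)
Lemma weighted_abstract_Lp : weighted_Lp_atomless mu p X N ->
  daugavet_abstract_Lp mu p X N.
Proof.
move=> [[h [nu [_ _ _ _ NE]]] mu_atomless].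
have ME w : Y w -> (M w)%:E = (\int[nu]_x `|w x|%:E)%E.
  move=> [_ Xw]; rewrite /pnorm -poweR_EFin (NE _ Xw) Lnorm_integral.
  apply: eq_integral => t _; congr EFin.
  by rewrite (ger0_norm (powR_ge0 _ _)) powRVK.
have AL : additive_on_cone Y M.
  have real_sum (a b c : R) (A B C : \bar R) :
      a%:E = A -> b%:E = B -> c%:E = C -> (C = A + B)%E -> c = a + b.
    by move=> <- <- <- cE; exact: EFin_inj.
  move=> u v Yu Yv u0 v0.
  apply: (real_sum _ _ _ _ _ _ (ME _ Yu) (ME _ Yv) (ME _ (fsD HY Yu Yv))).
  have mE w : Y w -> measurable_fun [set: T] (fun t => `|w t|%:E).
    by move=> Yw; apply/measurable_EFinP; exact: (fs_meas HY (fs_norm HY Yw)).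
  rewrite -ge0_integralD//; [|exact: mE|exact: mE].
  apply: eq_integral => t _; rewrite -EFinD; congr EFin.
  by rewrite addrfctE !ger0_norm ?addr_ge0.
exact: (small_overlap_abstract_Lp p1 H AL (atomless_small_overlap HY AL mu_atomless)).
Qed.

End WeightedLp.

Theorem theorem2p8 (R : realType) (d : measure_display) (T : measurableType d)
    (mu : {measure set T -> \bar R}) (p : R)
    (X : set (T -> R)) (N : (T -> R) -> R) :
  1 <= p ->
  quasi_banach_function_space mu X N ->
  [/\ [<-> daugavet_abstract_Lp mu p X N;
           concave_daugavet mu p X N;
           convex_concave_daugavet mu p X N;
           convex_slice_estimate mu p X N;
           convex_slice_functional mu p X N],
      weighted_Lp_atomless mu p X N -> daugavet_abstract_Lp mu p X N
    & sigma_finite [set: T] mu -> X (cst 1) ->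
      [<-> daugavet_abstract_Lp mu p X N;
           weighted_Lp_atomless mu p X N;
           concave_daugavet mu p X N;
           convex_concave_daugavet mu p X N;
           convex_slice_estimate mu p X N;
           convex_slice_functional mu p X N]].
Proof.
move=> p1 H; split; first 1 last.
- exact: weighted_abstract_Lp.
- move=> sf X1; tfae.
  + exact: abstract_Lp_weighted.
  + by move=> /(weighted_abstract_Lp p1 H); exact: abstract_Lp_concave_daugavet.
  + exact: concave_daugavet_convex_concave.
  + exact: convex_concave_daugavet_slice_estimate.
  + exact: slice_estimate_functional.
  + exact: slice_functional_abstract_Lp.
tfae.
- exact: abstract_Lp_concave_daugavet.
- exact: concave_daugavet_convex_concave.
- exact: convex_concave_daugavet_slice_estimate.
- exact: slice_estimate_functional.
- exact: slice_functional_abstract_Lp.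
Qed.
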